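(* Let $X$ be a compact infra-nilmanifold and $Y$ a compact nilmanifold with $\dim X\ge\dim Y$, and let $f,g:X\to Y$ be (continuous) maps. If $N(f,g)=0$, then $f$ and $g$ are deformable to be coincidence free, i.e. there exist maps $f'\sim f$ and $g'\sim g$ with $C(f',g')=\emptyset$.
   Context: Maps are continuous and $\sim$ denotes homotopy. For maps $f,g:M\to N$ put $C(f,g)=\{x\in M\mid f(x)=g(x)\}$. A compact infra-nilmanifold is in particular a closed manifold having a compact nilmanifold as a finite regular cover. Geometric Nielsen coincidence number $N(f,g)$ (Brooks): two coincidences $x_1,x_2\in C(f,g)$ are equivalent if there is a path $\alpha:[0,1]\to M$ with $\alpha(0)=x_1$, $\alpha(1)=x_2$ such that $f\circ\alpha$ and $g\circ\alpha$ are homotopic relative to the endpoints; the equivalence classes are the coincidence classes of $f,g$. If $\{f_t\},\{g_t\}$ ($t\in[0,1]$) are homotopies with $f_0=f$, $g_0=g$, then $x\in C(f,g)$ and $y\in C(f_1,g_1)$ are $\{f_t\},\{g_t\}$-related if there is a path $C:[0,1]\to M$ with $C(0)=x$, $C(1)=y$ such that the paths $t\mapsto f_t(C(t))$ and $t\mapsto g_t(C(t))$ are homotopic relative to the endpoints. A coincidence class $\gamma$ of $f,g$ is related to a coincidence class $\beta$ of $f_1,g_1$ if some (equivalently every) coincidence in $\gamma$ is related to some (equivalently every) coincidence in $\beta$. A coincidence class $\gamma$ of $f,g$ is essential if for all homotopies $\{f_t\},\{g_t\}$ of $f,g$ there is a coincidence class of $f_1,g_1$ to which $\gamma$ is related.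 $N(f,g)$ is the number of essential coincidence classes. *)

(* Defs.v *)
From HB Require Import structures.
From mathcomp Require Import all_boot all_order all_algebra.
From mathcomp Require Import all_classical all_reals all_analysis.

Set Implicit Arguments.
Unset Strict Implicit.
Unset Printing Implicit Defensive.

Import Order.TTheory GRing.Theory Num.Theory.
Import numFieldNormedType.Exports.

Local Open Scope classical_set_scope.
Local Open Scope ring_scope.

(** * Homotopies *)

(* Paths and homotopies are total functions of a real parameter, of which only
   the restriction to [0, 1] is constrained; [R] is explicit where it cannot be
   inferred. *)
Definition path_from_to (R : realType) (T : topologicalType) (x y : T)
    (a : R -> T) : Prop :=
  [/\ {within `[0, 1], continuous a}, a 0 = x & a 1 = y].

Definition path_homotopic (R : realType) (T : topologicalType)
    (a b : R -> T) : Prop :=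
  exists H : R * R -> T,
    [/\ {within (`[0, 1] `*` `[0, 1]), continuous H},
        forall t, t \in `[0, 1] -> H (0, t) = a t /\ H (1, t) = b t
      & forall s, s \in `[0, 1] -> H (s, 0) = a 0 /\ H (s, 1) = a 1].

Definition is_homotopy (R : realType) (M N : topologicalType)
    (f g : M -> N) (F : R * M -> N) : Prop :=
  [/\ {within (`[0, 1] `*` [set: M]), continuous F},
      forall x, F (0, x) = f x & forall x, F (1, x) = g x].

Definition homotopic (R : realType) (M N : topologicalType)
    (f g : M -> N) : Prop :=
  exists F : R * M -> N, is_homotopy f g F.

Definition simply_connected (R : realType) (T : topologicalType) : Prop :=
  [/\ [set: T] !=set0,
      forall x y : T, exists a : R -> T, path_from_to x y a
    & forall (x : T) (a : R -> T), path_from_to x x a ->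
        path_homotopic a (fun=> x)].

(** * The Nielsen coincidence number *)

Definition coincidences (M N : Type) (f g : M -> N) : set M :=
  [set x | f x = g x].

Definition coinc_equiv (R : realType) (M N : topologicalType) (f g : M -> N)
    (x y : M) : Prop :=
  exists a : R -> M, path_from_to x y a /\ path_homotopic (f \o a) (g \o a).

Definition coinc_class (R : realType) (M N : topologicalType)
    (f g : M -> N) (gamma : set M) : Prop :=
  exists2 x, coincidences f g x &
    gamma = [set y | coincidences f g y /\ coinc_equiv R f g x y].

Definition coinc_related (R : realType) (M N : topologicalType)
    (F G : R * M -> N) (x y : M) : Prop :=
  exists c : R -> M, path_from_to x y c /\
    path_homotopic (fun t => F (t, c t)) (fun t => G (t, c t)).

Definition class_related (R : realType) (M N : topologicalType)
    (F G : R * M -> N) (gamma beta : set M) : Prop :=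
  exists x y, [/\ gamma x, beta y & coinc_related F G x y].

Definition essential_class (R : realType) (M N : topologicalType)
    (f g : M -> N) (gamma : set M) : Prop :=
  coinc_class R f g gamma /\
  forall (f1 g1 : M -> N) (F G : R * M -> N),
    is_homotopy f f1 F -> is_homotopy g g1 G ->
    exists2 beta, coinc_class R f1 g1 beta & class_related F G gamma beta.

(* Extended-real valued, so that infinitely many essential classes would give
   +oo rather than a junk value. *)
Definition nielsen_number (R : realType) (M N : topologicalType)
    (f g : M -> N) : \bar R :=
  counting [set gamma : set M | essential_class R f g gamma].

(** * Lie groups *)

#[short(type="preTopGroupType")]
HB.structure Definition PreTopGroup := {G of Group G & Topological G}.

HB.mixin Record isTopGroup G of PreTopGroup G := {
  mulg_continuous : continuous (fun z : G * G => (z.1 * z.2)%g) ;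
  invg_continuous : continuous (fun x : G => (x^-1)%g) ;
}.

#[short(type="topGroupType")]
HB.structure Definition TopGroup := {G of isTopGroup G & PreTopGroup G}.

Fixpoint Ck_on (R : realType) (n k : nat) (U : set 'rV[R]_n)
    (f : 'rV[R]_n -> R) : Prop :=
  (forall x, U x -> {for x, continuous f}) /\
  match k with
  | 0%N => True
  | k'.+1 => forall i : 'I_n,
      (forall x, U x -> derivable f x (delta_mx 0 i)) /\
      Ck_on k' U ('D_(delta_mx 0 i) f)
  end.

(* Meant for U open. *)
Definition smooth_on (R : realType) (n p : nat) (U : set 'rV[R]_n)
    (f : 'rV[R]_n -> 'rV[R]_p) : Prop :=
  forall (k : nat) (j : 'I_p), Ck_on k U (fun x => f x 0 j).

Record chart (R : realType) (n : nat) (T : Type) := Chart {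
  chart_dom : set T ;
  chart_map : T -> 'rV[R]_n ;
  chart_inv : 'rV[R]_n -> T }.

Definition chart_img (R : realType) (n : nat) (T : Type) (c : chart R n T) :
  set 'rV[R]_n := chart_map c @` chart_dom c.

Definition is_chart (R : realType) (n : nat) (T : topologicalType)
    (c : chart R n T) : Prop :=
  [/\ open (chart_dom c), open (chart_img c),
      {in chart_dom c, cancel (chart_map c) (chart_inv c)},
      {within chart_dom c, continuous (chart_map c)}
    & {within chart_img c, continuous (chart_inv c)}].

Definition smooth_atlas (R : realType) (n : nat) (T : topologicalType)
    (A : set (chart R n T)) : Prop :=
  [/\ forall c, A c -> is_chart c,
      \bigcup_(c in A) chart_dom c = setT
    & forall c d, A c -> A d ->
        smooth_on [set v | chart_img c v /\ chart_dom d (chart_inv c v)]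
          (chart_map d \o chart_inv c)].

(* Smoothness of multiplication is read in product charts, with R^n x R^n
   identified with R^(n + n) through row concatenation. *)
Definition lie_group (R : realType) (n : nat) (G : topGroupType) : Prop :=
  [/\ hausdorff_space G, @second_countable G &
      exists A : set (chart R n G),
      [/\ smooth_atlas A,
          forall a b c, A a -> A b -> A c ->
            smooth_on
              [set w : 'rV[R]_(n + n) |
                [/\ chart_img a (lsubmx w), chart_img b (rsubmx w) &
                    chart_dom c (chart_inv a (lsubmx w)
                                 * chart_inv b (rsubmx w))%g]]
              (fun w => chart_map c (chart_inv a (lsubmx w)
                                     * chart_inv b (rsubmx w))%g)
        & forall a c, A a -> A c ->
            smooth_on
              [set v | chart_img a v /\ chart_dom c (chart_inv a v)^-1%g]
              (fun v => chart_map c (chart_inv a v)^-1%g)]].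

Definition is_subgroup (G : groupType) (H : set G) : Prop :=
  group_closed (fun x => x \in H).

Fixpoint lower_central (G : groupType) (k : nat) : set G :=
  match k with
  | 0%N => setT
  | k'.+1 => smallest (@is_subgroup G)
      [set [~ x, y]%g | x in @lower_central G k' & y in [set: G]]
  end.

Definition is_nilpotent (G : groupType) : Prop :=
  exists k, @lower_central G k = [set 1%g].

Definition nilpotent_model (R : realType) (n : nat) (G : topGroupType) : Prop :=
  [/\ lie_group R n G, connected [set: G], simply_connected R G
    & is_nilpotent G].

(** * Nilmanifolds and infra-nilmanifolds *)

Definition discrete_subset (T : topologicalType) (D : set T) : Prop :=
  D `<=` isolated D.

Definition quotient_map (T Q : topologicalType) (p : T -> Q) : Prop :=
  set_surj setT setT p /\ forall U : set Q, open U <-> open (p @^-1` U).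

(* Y is (homeomorphic to) a coset space G / Gamma, with Gamma a discrete
   subgroup of an n-dimensional simply connected nilpotent Lie group G. *)
Definition compact_nilmanifold (R : realType) (n : nat)
    (Y : topologicalType) : Prop :=
  compact [set: Y] /\
  exists (G : topGroupType) (Gamma : set G) (p : G -> Y),
    [/\ nilpotent_model R n G, is_subgroup Gamma, discrete_subset Gamma,
        quotient_map p
      & forall x y : G, p x = p y <-> Gamma (x^-1 * y)%g].

Definition is_automorphism (G : topGroupType) (phi : G -> G) : Prop :=
  [/\ {morph phi : x y / (x * y)%g}, continuous phi &
      exists psi : G -> G,
        [/\ cancel phi psi, cancel psi phi & continuous psi]].

Definition aut_subgroup (G : topGroupType)
    (C : set {compact-open, G -> G}) : Prop :=
  [/\ forall phi, C phi -> is_automorphism phi,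
      C idfun,
      forall phi psi, C phi -> C psi -> C (phi \o psi)
    & forall phi, C phi ->
        exists psi, [/\ C psi, cancel phi psi & cancel psi phi]].

(* The affine group G x| Aut(G): the pair (d, phi) stands for the
   transformation x |-> d * phi x of G. *)
Definition affine (G : topGroupType) : topologicalType :=
  (G * {compact-open, G -> G})%type.

Definition aff_act (G : topGroupType) (a : affine G) (x : G) : G :=
  (a.1 * a.2 x)%g.

Definition aff_one (G : topGroupType) : affine G := (1%g, idfun).

Definition aff_mul (G : topGroupType) (a b : affine G) : affine G :=
  ((a.1 * a.2 b.1)%g, a.2 \o b.2).

Definition aff_subgroup (G : topGroupType) (P : set (affine G)) : Prop :=
  [/\ P (aff_one G),
      forall a b, P a -> P b -> P (aff_mul a b)
    & forall a, P a ->
        exists b, [/\ P b, aff_mul a b = aff_one G & aff_mul b a = aff_one G]].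

Definition aff_torsion_free (G : topGroupType) (P : set (affine G)) : Prop :=
  forall (a : affine G) (k : nat), P a ->
    iter k.+1 (aff_mul a) (aff_one G) = aff_one G -> a = aff_one G.

(* X is (homeomorphic to) the orbit space of a torsion-free discrete subgroup
   of G x| C acting on an m-dimensional simply connected nilpotent Lie group G,
   where C is a compact subgroup of Aut(G). *)
Definition compact_infra_nilmanifold (R : realType) (m : nat)
    (X : topologicalType) : Prop :=
  compact [set: X] /\
  exists (G : topGroupType) (C : set {compact-open, G -> G})
         (P : set (affine G)) (p : G -> X),
    [/\ nilpotent_model R m G,
        aut_subgroup C /\ compact C,
        [/\ P `<=` [set a | C a.2], aff_subgroup P, discrete_subset P
          & aff_torsion_free P],
        quotient_map p
      & forall x y : G, p x = p y <-> exists2 a, P a & y = aff_act a x].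

(* Main.v *)
(* Lift f and g to the universal covers S of X and G of Y (written through inverses): the lifts are
   equivariant under the deck group of X.  Averaging along a Malcev basis of G, each equivariant map
   can be replaced by an equivariant homomorphism, homotopic to it because G is homeomorphic to R^k;
   call the two homomorphisms Phi and Psi.  Coincidences disappear once Phi is multiplied by an
   invariant map Q that avoids every map x |-> Phi(x)^-1 c Psi(x) with c in the lattice.

   Filter x |-> Phi(x)^-1 Psi(x) along the Malcev basis.  If some coordinate vanishes on its step of
   the filtration, a generic constant Q in the corresponding one-parameter group works, since every
   lattice element excludes at most one parameter.  Otherwise x |-> Phi(x)^-1 Psi(x) has a continuous
   section G -> S; as N(f,g) = 0, some homotopic lifts never coincide, and composing with the section
   turns them into a bounded fixed point free self-map of R^k.  Cut off outside a ball and shrunk to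
   the scale at which lattice translates are separated, this map defines Q near each of the maps
   x |-> Phi(x)^-1 c Psi(x), and Q = 1 elsewhere.  (Brouwer's theorem would exclude this second case,
   but it is not needed.) *)
Require Import Defs.
From HB Require Import structures.
From mathcomp Require Import all_boot all_order all_algebra.
From mathcomp Require Import all_classical all_reals all_analysis.
From mathcomp Require Import ring lra.

Set Implicit Arguments.
Unset Strict Implicit.
Unset Printing Implicit Defensive.

Import Order.TTheory GRing.Theory Num.Theory.
Import numFieldNormedType.Exports.

Local Open Scope classical_set_scope.
Local Open Scope ring_scope.

(** * Functions with bounded right increments on nilpotent groups *)

(** The homomorphisms are found one Malcev coordinate at a time, so the analytic core concerns real
    functions on a group whose right increments are bounded. They cannot simply be averaged: the
    acting group is infinite, and its linear parts may move an element through an infinite, though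
    relatively compact, orbit. Exactness is gained by climbing a central series: growth along powers
    defines slopes, an infimum over words makes a slope almost exact while preserving equivariance,
    and an ultrafilter limit makes all slopes exact. This is applied not to [S] but to a fibre
    product of [S] and [G], which turns a homomorphism modulo one step of the filtration of [G] into
    one modulo the next. Malcev bases are built without Lie algebras: the exponential is a limit of
    powers, and characters are obtained by integrating local homomorphisms through monodromy. The
    monodromy argument on normed spaces also produces the lifts to covers. *)

Section AlmostHom.
Context {R : realType} {A : groupType}.
Implicit Types (x y z v w : A) (be : A -> R) (W : set A) (k : nat).

Lemma ler_of_natmul (a b C : R) :
  (forall k, k%:R * a <= C + k%:R * b) -> a <= b.
Proof.
move=> h; rewrite leNgt; apply/negP => ab.
have ab0 : 0 < a - b by rewrite subr_gt0.
have := archi_boundP (normr_ge0 (C / (a - b))).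
set k := Num.bound _ => hk.
have : C / (a - b) < k%:R by exact: le_lt_trans (ler_norm _) hk.
by rewrite ltr_pdivrMr // mulrBr => hC; have := h k; lra.
Qed.

Lemma natmul_bounded_eq0 (a C : R) : (forall k, k%:R * `|a| <= C) -> a = 0.
Proof.
move=> h; apply/eqP; rewrite -normr_le0; apply: (@ler_of_natmul _ _ C) => k.
by rewrite mulr0 addr0.
Qed.

Lemma natmul_norm k (a : R) : k%:R * `|a| = `|k%:R * a|.
Proof. by rewrite normrM ger0_norm. Qed.

Definition translation_bound be y (c r : R) :=
  forall x, `|be (x * y)%g - be x - c| <= r.

(** Invariance under commutators with [W], stated inside an arbitrary product so that words can be
    rearranged. *)
Definition commutes_on be W :=
  forall w, W w -> forall y x z, be (y * w * x * z)%g = be (y * x * w * z)%g.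

Lemma translation_boundX be y (c r : R) k :
  translation_bound be y c r ->
  translation_bound be (y ^+ k)%g (k%:R * c) (k%:R * r).
Proof.
move=> h; elim: k => [|k ih] x.
  by rewrite expg0 mulg1 !mul0r subrr subr0 normr0.
rewrite expgS mulgA -natr1 !mulrDl !mul1r.
have := ih (x * y)%g; have := h x.
rewrite !ler_norml => /andP[? ?] /andP[? ?]; apply/andP; split; lra.
Qed.

Lemma translation_bound_neg be y (c r : R) :
  translation_bound be y c r -> translation_bound be (y^-1)%g (- c) r.
Proof.
move=> h x; have := h (x * y^-1)%g; rewrite mulgVK.
by rewrite -normrN => h'; apply: le_trans h'; rewrite le_eqVlt; apply/orP; left;
  apply/eqP; congr (`|_|); ring.
Qed.

Section Comm.
Context {be : A -> R} {W : set A}.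
Hypothesis cW : commutes_on be W.

Lemma commutes_onXM v w k x z : W w -> (forall j, W (w ^+ j)%g) ->
  be (x * (v * w) ^+ k * z)%g = be (x * v ^+ k * w ^+ k * z)%g.
Proof.
move=> Ww WX; elim: k x z => [|k ih] x z; first by rewrite !expg0 !mulg1.
rewrite [((v * w) ^+ _)%g]expgS mulgA ih.
have -> : (x * (v * w) * v ^+ k * w ^+ k * z = (x * v) * w * v ^+ k * (w ^+ k * z))%g.
  by rewrite !mulgA.
by rewrite cW // !expgS !mulgA.
Qed.

End Comm.

End AlmostHom.

(** * Real functions equivariant under an affine action *)

Section LinearDisplacement.
Context {R : realType} {A : groupType} {I : Type}.
Variables (d : I -> A) (th : I -> A -> A) (iv : I -> I) (cp : I -> I -> I).
Hypothesis thM : forall a, {morph th a : x y / (x * y)%g}.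
Hypothesis thK : forall a, cancel (th a) (th (iv a)).
Hypothesis thVK : forall a, cancel (th (iv a)) (th a).
Hypothesis thC : forall a b x, th (cp a b) x = th a (th b x).
Variables (K Mo : A -> R) (D : set A) (MD : R).
Hypothesis KO : forall w a, K (th a w) <= Mo w.
Hypothesis KD0 : forall y, D y -> K y <= MD.
Hypothesis KD : forall a y, D y -> K (th a y) <= MD.
Hypothesis Ktb : forall w (e : R), 0 < e -> exists (n : nat) (b : nat -> I),
  forall a, exists2 j, (j < n)%N & K ((th (b j) w)^-1 * th a w)%g <= e.

(** The assumptions on [iv] and [cp] concern linear parts only, so translation parts may be chosen
    freely there. [K] measures displacement, and [Ktb] says that orbits of linear parts are totally
    bounded for it. *)
Definition affact a x := (d a * th a x)%g.
Hypothesis cocpt : forall x, exists a, exists2 y, D y & x = affact a y.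

Variables (u : I -> R).
Implicit Types (x y z v w : A) (be : A -> R) (W : set A) (k : nat).

Definition equivariant be := forall a x, be (affact a x) = be x + u a.
Definition displacement_bounded be := forall y, translation_bound be y 0 (K y).

Lemma th1 a : th a 1%g = 1%g.
Proof. by apply: (@mulgI _ (th a 1%g)); rewrite -thM !mulg1. Qed.

Lemma thV a x : th a (x^-1)%g = ((th a x)^-1)%g.
Proof. by apply: (@mulgI _ (th a x)); rewrite -thM !mulgV th1. Qed.

Lemma thX a x k : th a (x ^+ k)%g = (th a x ^+ k)%g.
Proof. by elim: k => [|k ih]; rewrite ?expg0 ?th1 // !expgS thM ih. Qed.

Definition stable_subgroup W := [/\ W 1%g,
  forall v w, W v -> W w -> W (v * w)%g,
  forall w, W w -> W (w^-1)%g & forall a w, W w -> W (th a w)].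

Lemma stableX W w k : stable_subgroup W -> W w -> W (w ^+ k)%g.
Proof.
by move=> [W1 WM _ _] Ww; elim: k => [|k ih]; rewrite ?expg0 // expgS; apply: WM.
Qed.

Definition additive_on be W :=
  forall w, W w -> forall x y, be (x * w * y)%g = be (x * y)%g + (be w - be 1%g).

(** * Vanishing of commutator defects *)

Section CommStep.
Variables (be : A -> R) (Z W : set A).
Hypotheses (eqb : equivariant be) (bdb : displacement_bounded be).
Hypotheses (adZ : additive_on be Z) (sW : stable_subgroup W).
Hypothesis comZ : forall w x, W w -> Z [~ w, x]%g.

Let e w x := be [~ w, x]%g - be 1%g.

Let eE w x y z : W w -> be (y * w * x * z)%g = be (y * x * w * z)%g + e w x.
Proof.
move=> Ww; have -> : (y * w * x * z = (y * x * w) * [~ w, x] * z)%g.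
  by rewrite -[(y * x * w)%g]mulgA -[(y * w * x)%g]mulgA (commgC w x) !mulgA.
by rewrite adZ //; apply: comZ.
Qed.

Let eE1 w x : W w -> be (w * x)%g = be (x * w)%g + e w x.
Proof. by move=> Ww; have := eE x 1%g 1%g Ww; rewrite !mul1g !mulg1. Qed.

Let eM2 w x y : W w -> e w (x * y)%g = e w x + e w y.
Proof.
move=> Ww; have := eE1 (x * y)%g Ww.
have := eE x 1%g y Ww; have := eE y x 1%g Ww; rewrite !mul1g !mulg1 !mulgA.
by move=> -> -> /esym; rewrite -addrA => /addrI ->; rewrite addrC.
Qed.

Let eM1 v w x : W v -> W w -> e (v * w)%g x = e v x + e w x.
Proof.
move=> Wv Ww; have [_ WM _ _] := sW.
have := eE1 x (WM _ _ Wv Ww).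
have := eE x v 1%g Ww; have := eE x 1%g w Wv; rewrite !mul1g !mulg1 !mulgA.
by move=> -> -> /esym; rewrite -addrA => /addrI ->.
Qed.

Let eX1 w x k : W w -> e (w ^+ k)%g x = k%:R * e w x.
Proof.
move=> Ww; elim: k => [|k ih].
  by rewrite expg0 mul0r /e comm1g subrr.
by rewrite expgS eM1 ?ih -?natr1 ?mulrDl ?mul1r 1?addrC//; apply: stableX.
Qed.

Let eX2 w x k : W w -> e w (x ^+ k)%g = k%:R * e w x.
Proof.
move=> Ww; elim: k => [|k ih]; first by rewrite expg0 mul0r /e commg1 subrr.
by rewrite expgS eM2 ?ih -?natr1 ?mulrDl ?mul1r 1?addrC.
Qed.

Let bd1 y : `|be y - be 1%g| <= K y.
Proof. by have := bdb y 1%g; rewrite mul1g subr0. Qed.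

Let bdX y k : `|be (y ^+ k)%g - be 1%g| <= k%:R * K y.
Proof.
by have := translation_boundX k (bdb y) 1%g; rewrite mul1g mulr0 subr0.
Qed.

(** On [w ^+ k] the defect grows linearly, while equivariance computes [be (d a * th a w ^+ k)] from
    [be (w ^+ k)]. Dividing by [k] removes the contributions of [d a] and [u a]. *)
Let e_trans a w : W w -> `|e (th a w) (d a)| <= K (th a w) + K w.
Proof.
move=> Ww; have Wt : W (th a w) by case: sW => _ _ _; apply.
apply: (@ler_of_natmul _ _ _ (K (d a) + `|u a|)) => k.
rewrite natmul_norm -eX1 //.
have h1 := eE1 (d a) (stableX k sW Wt).
have h2 : be (d a * (th a w) ^+ k)%g = be (w ^+ k)%g + u a.
  by rewrite -thX -eqb.
have h3 := bdb (d a) ((th a w) ^+ k)%g.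
have h4 := bdX (th a w) k; have h5 := bdX w k.
have h6 : u a <= `|u a| by exact: ler_norm.
have h7 : - u a <= `|u a| by rewrite -normrN; exact: ler_norm.
move: h1 h2 h3 h4 h5; rewrite subr0 !ler_norml => h1 h2 /andP[? ?] /andP[? ?] /andP[? ?].
rewrite mulrDr; apply/andP; split; lra.
Qed.

(** For fixed [w] the defect is additive in its second argument. It is also bounded, because every
    element is some [d a] times a point of the orbit of [D] and both factors contribute boundedly. A
    bounded additive function is zero. *)
Lemma commutes_step : commutes_on be W.
Proof.
suff e0 w x : W w -> e w x = 0 by move=> w Ww y x z; rewrite eE // e0 // addr0.
move=> Ww; pose C := K w + Mo w + (2 * MD + 2 * K w).
have eC y : `|e w y| <= C.
  have [a [y' Dy' ->]] := cocpt y; rewrite eM2 //.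
  have h1 : `|e w (d a)| <= K w + Mo w.
    have := @e_trans a (th (iv a) w); rewrite thVK => h.
    apply: le_trans (h _) _; first by case: sW => _ _ _; apply.
    by rewrite lerD2l; apply: KO.
  have h2 : `|e w (th a y')| <= 2 * MD + 2 * K w.
    have h := eE1 (th a y') Ww.
    have k1 := bdb (th a y') w; have k2 := bdb w (th a y').
    have k3 := bd1 w; have k4 := bd1 (th a y'); have k5 := KD a Dy'.
    move: k1 k2 k3 k4; rewrite !subr0 !ler_norml.
    move=> /andP[? ?] /andP[? ?] /andP[? ?] /andP[? ?].
    apply/andP; split; lra.
  exact: le_trans (ler_normD _ _) (lerD h1 h2).
apply: (@natmul_bounded_eq0 _ _ C) => k.
by rewrite natmul_norm -eX2.
Qed.

End CommStep.

(** * Growth rates along powers *)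

Section Slope.
Variables (be : A -> R) (W : set A).
Hypotheses (eqb : equivariant be) (bdb : displacement_bounded be).
Hypotheses (sW : stable_subgroup W) (cW : commutes_on be W).

Let De v x := be (x * v)%g - be x.

Let De_lip v x y : W v -> `|De v (x * y)%g - De v x| <= 2 * K y.
Proof.
move=> Wv; have := cW Wv x y 1%g; rewrite !mulg1 /De => <-.
have := bdb y (x * v)%g; have := bdb y x; rewrite !subr0 !ler_norml.
move=> /andP[? ?] /andP[? ?]; apply/andP; split; lra.
Qed.

Let De_act a v x : De (th a v) (affact a x) = De v x.
Proof.
rewrite /De /affact -mulgA -thM -!/(affact _ _) !eqb; ring.
Qed.

Let De_near v v' (e : R) k x : W v -> W v' -> K (v'^-1 * v)%g <= e ->
  `|De (v ^+ k)%g x - De (v' ^+ k)%g x| <= k%:R * e.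
Proof.
move=> Wv Wv' Ke; have [_ WM WV _] := sW.
set s := (v'^-1 * v)%g in Ke.
have Ws : W s by apply: WM => //; apply: WV.
have -> : v = (v' * s)%g by rewrite /s mulVKg.
have := @commutes_onXM _ _ _ _ cW v' s k x 1%g Ws (fun j => stableX j sW Ws).
rewrite !mulg1 /De => ->.
have := translation_boundX k (bdb s) (x * v' ^+ k)%g; rewrite mulr0 subr0.
set a := be _; set b := be _; set c := be _ => h.
rewrite opprB addrA addrNK; apply: le_trans h _.
by rewrite ler_wpM2l.
Qed.

(** A priori the oscillation could grow like a multiple of [k]. Equivariance moves the base point
    into [D] at the price of twisting [w] by a linear part; total boundedness replaces the twist by
    one of finitely many, with error [e] per factor, and each of these is compared with the base
    point 1 at a cost independent of [k]. *)
Lemma displacement_osc w (e : R) : W w -> 0 < e -> exists2 C, 0 <= C &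
  forall k x, `|De (w ^+ k)%g x - De (w ^+ k)%g 1%g| <= k%:R * e + C.
Proof.
move=> Ww e0; have [n [b hb]] := Ktb w e0.
have [_ _ _ Wt] := sW.
pose C := \sum_(j < n) `|2 * K (d (b j))|.
exists (`|2 * MD| + C); first by rewrite addr_ge0 // sumr_ge0.
move=> k x; have [a [y Dy ->]] := cocpt x.
have [j jn hj] := hb (iv a).
set v := (w ^+ k)%g; set v1 := th (iv a) v; set v2 := th (b j) v.
have Wv : W v by apply: stableX.
have Wv1 : W v1 by apply: Wt.
have Wv2 : W v2 by apply: Wt.
have -> : De v (affact a y) = De v1 y by rewrite -(De_act a v1 y) /v1 thVK.
have h1 : `|De v1 y - De v1 1%g| <= `|2 * MD|.
  have := De_lip 1%g y Wv1; rewrite mul1g => h; apply: le_trans h _.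
  apply: le_trans (ler_norm _); rewrite ler_wpM2l //.
  exact: KD0.
have h2 : `|De v1 1%g - De v2 1%g| <= k%:R * e.
  by rewrite /v1 /v2 /v !thX; apply: De_near => //; apply: Wt.
have h3 : `|De v2 1%g - De v 1%g| <= C.
  have -> : De v 1%g = De v2 (d (b j)).
    by rewrite -(De_act (b j) v 1%g) /affact th1 mulg1.
  have := De_lip 1%g (d (b j)) Wv2; rewrite mul1g distrC => h.
  apply: le_trans h _; apply: le_trans (ler_norm _) _.
  by rewrite /C (bigD1 (Ordinal jn)) //= lerDl sumr_ge0.
move: h1 h2 h3; rewrite !(ler_norml (_ - _)).
by move=> /andP[? ?] /andP[? ?] /andP[? ?]; apply/andP; split; lra.
Qed.

(** A version of Fekete's lemma: the slope is the growth rate of upper bounds for the increments,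
    and the small oscillation turns it into a limit that is uniform in the base point. *)
Lemma slope_exists : exists E : A -> R, forall w, W w -> forall e : R, 0 < e ->
  exists C, forall k, translation_bound be (w ^+ k)%g (k%:R * E w) (k%:R * e + C).
Proof.
suff h w : exists Ew : R, W w -> forall e : R, 0 < e ->
    exists C, forall k, translation_bound be (w ^+ k)%g (k%:R * Ew) (k%:R * e + C).
  by have [E hE] := choice h; exists E => w; apply: hE.
have [Ww|nWw] := pselect (W w); last by exists 0 => /nWw.
pose U := [set r : R | exists k M, [/\ (0 < k)%N,
  forall x, De (w ^+ k)%g x <= M & r = M / k%:R]].
have DeX k j x m M : (forall x, m <= De (w ^+ k)%g x <= M) ->
    j%:R * m <= De (w ^+ (k * j))%g x <= j%:R * M.
  move=> h; elim: j x => [|j ih] x.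
    by rewrite muln0 expg0 /De mulg1 subrr !mul0r lexx.
  rewrite mulnS expgnDr -natr1 !mulrDl !mul1r.
  have -> : De (w ^+ k * w ^+ (k * j))%g x =
      De (w ^+ (k * j))%g (x * w ^+ k)%g + De (w ^+ k)%g x.
    by rewrite /De mulgA; ring.
  by have /andP[h1 h2] := h x; have /andP[h3 h4] := ih (x * w ^+ k)%g;
    rewrite !lerD.
(* A lower bound at exponent [k] and an upper bound at exponent [j] are compared at the common power
   [k * j]. *)
have lbU k m r : (0 < k)%N -> (forall x, m <= De (w ^+ k)%g x) -> U r -> m / k%:R <= r.
  move=> k0 hm [j [M [j0 hM ->]]].
  rewrite ler_pdivrMr ?ltr0n// mulrAC ler_pdivlMr ?ltr0n//.
  have h1 : j%:R * m <= De (w ^+ (k * j))%g 1%g.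
    have [M' hM'] : exists M', forall x, De (w ^+ k)%g x <= M'.
      exists (k%:R * K w) => x; have := translation_boundX k (bdb w) x.
      by rewrite mulr0 subr0 ler_norml => /andP[].
    by have /andP[] := @DeX k j 1%g m M' (fun x => introT andP (conj (hm x) (hM' x))).
  have h2 : De (w ^+ (j * k))%g 1%g <= k%:R * M.
    have [m' hm'] : exists m', forall x, m' <= De (w ^+ j)%g x.
      exists (- (j%:R * K w)) => x; have := translation_boundX j (bdb w) x.
      by rewrite mulr0 subr0 ler_norml => /andP[].
    by have /andP[] := @DeX j k 1%g m' M (fun x => introT andP (conj (hm' x) (hM x))).
  by rewrite mulrC (le_trans h1) // mulnC (le_trans h2) // mulrC.
have U0 : U !=set0.
  exists (K w); exists 1%N, (K w); split; rewrite ?divr1// => x.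
  by have := bdb w x; rewrite expg1 subr0 ler_norml => /andP[].
have hinfU : has_inf U.
  split=> //; exists (- K w) => r Ur; rewrite -[- K w]divr1 -[1]/(1%:R).
  apply: lbU => // x; rewrite expg1.
  by have := bdb w x; rewrite subr0 ler_norml => /andP[].
exists (inf U) => _ e e0.
have e20 : 0 < e / 2 by rewrite divr_gt0.
have [C C0 hC] := displacement_osc Ww e20; exists (2 * C) => -[|k] x.
  by rewrite expg0 mulg1 !mul0r add0r subrr subr0 normr0 mulr_ge0.
set q := De (w ^+ k.+1)%g 1%g.
have k0 : 0 < k.+1%:R :> R by rewrite ltr0n.
have h1 : k.+1%:R * inf U <= q + (k.+1%:R * (e / 2) + C).
  rewrite mulrC -ler_pdivlMr //; apply: ge_inf; first by case: hinfU.
  exists k.+1, (q + (k.+1%:R * (e / 2) + C)); split => // y.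
  by have := hC k.+1 y; rewrite ler_norml -/q => /andP[_]; rewrite lerBlDl.
have h2 : q - (k.+1%:R * (e / 2) + C) <= k.+1%:R * inf U.
  rewrite [leRHS]mulrC -ler_pdivrMr //; apply: lb_le_inf => // r Ur.
  apply: lbU => // y.
  by have := hC k.+1 y; rewrite ler_norml -/q => /andP[]; lra.
have := hC k.+1 x; rewrite -/q /De !ler_norml => /andP[? ?].
apply/andP; split; lra.
Qed.

End Slope.

(** * Inf-convolution over words *)

Section InfConvolution.
Variables (be : A -> R) (W : set A) (z : A) (s e : R).
Hypotheses (eqb : equivariant be) (bdb : displacement_bounded be).
Hypotheses (sW : stable_subgroup W) (cW : commutes_on be W) (Wz : W z).
Hypothesis slz : forall e : R, 0 < e -> exists C, forall k,
  translation_bound be (z ^+ k)%g (k%:R * s) (k%:R * e + C).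
Hypothesis e0 : 0 < e.

(** All translates [th a z] get the same value [s]: an equivariant function has equal slopes along
    an orbit of linear parts. *)
Definition letter (g : A) (t : R) :=
  exists a, (g = th a z /\ t = s) \/ (g = ((th a z)^-1)%g /\ t = - s).

Inductive word (L : A -> R -> Prop) : A -> R -> nat -> Prop :=
| word_nil : word L 1%g 0 0
| word_cons g t v r n : L g t -> word L v r n -> word L (g * v)%g (t + r) n.+1.

(** An infimal convolution: the increment along a word is compared with the value [t] that its
    letters ought to produce, and each letter costs [e]. The cost keeps the infimum finite, and
    prefixing one letter changes it by at most [e] beyond the expected slope. *)
Definition infconv x :=
  inf [set r : R | exists v t n, word letter v t n /\ r = be (x * v)%g - t + e * n%:R].

Lemma letterW g t : letter g t -> W g.
Proof.
have [_ _ WV Wt] := sW.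
by move=> [a [[-> _]|[-> _]]]; [apply: Wt | apply: WV; apply: Wt].
Qed.

Lemma wordW (L : A -> R -> Prop) : (forall g t, L g t -> W g) ->
  forall v t n, word L v t n -> W v.
Proof.
by have [W1 WM _ _] := sW => LW v t n; elim => // g t' v' r n' /LW Wg _ /(WM _ _ Wg).
Qed.

Lemma letter_slope g t : letter g t -> forall e' : R, 0 < e' -> exists C, forall k,
  translation_bound be (g ^+ k)%g (k%:R * t) (k%:R * e' + C).
Proof.
have pos a (e' : R) : 0 < e' -> exists C, forall k,
    translation_bound be ((th a z) ^+ k)%g (k%:R * s) (k%:R * e' + C).
  move=> /slz [C hC]; exists C => k x; have := hC k (affact (iv a) x).
  suff -> : be (affact (iv a) x * z ^+ k)%g - be (affact (iv a) x) =
    be (x * (th a z) ^+ k)%g - be x by [].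
  rewrite -[(z ^+ k)%g](thK a) /affact -mulgA -thM -!/(affact _ _) !eqb thX; ring.
move=> [a [[-> ->]|[-> ->]]] e' /(pos a) [C hC]; exists C => k //.
by rewrite expVgn mulrN; apply: translation_bound_neg.
Qed.

(* Collecting equal letters: only finitely many slopes matter, whatever the length of the word. *)
Lemma finite_word_bound (l : seq (A * R)) :
  (forall p, p \in l -> W p.1 /\ forall e' : R, 0 < e' -> exists C, forall k,
    translation_bound be (p.1 ^+ k)%g (k%:R * p.2) (k%:R * e' + C)) ->
  forall e' : R, 0 < e' -> exists C, forall v t n,
    word (fun g r => (g, r) \in l) v t n -> translation_bound be v t (n%:R * e' + C).
Proof.
elim: l => [|[g r] l ih] hl e' e'0.
  exists 0 => v t n; case=> [x|? ? ? ? ? //].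
  by rewrite mulg1 !subrr normr0 mul0r addr0.
have [Wg /(_ e' e'0) [C1 hC1]] : W g /\ _ := hl (g, r) (mem_head _ _).
have hl' p (pl : p \in l) := hl p (@mem_behead _ ((g, r) :: l) p pl).
have [C2 hC2] := ih hl' e' e'0.
have split_word v t n : word (fun g' r' => (g', r') \in (g, r) :: l) v t n ->
    exists k v' t' n', [/\ n = (k + n')%N, t = k%:R * r + t',
      word (fun g r => (g, r) \in l) v' t' n' &
      forall x y, be (x * v * y)%g = be (x * g ^+ k * v' * y)%g].
  elim=> [|g' t1 v1 r1 n1 Lg _ [k [v' [t' [n' [-> -> hw hv]]]]]].
    exists 0%N, 1%g, 0, 0%N; rewrite mul0r addr0; split => //; first exact: word_nil.
    by move=> x y; rewrite expg0 !mulg1.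
  move: Lg; rewrite inE => /orP[/eqP[-> ->]|Lg].
    exists k.+1, v', t', n'; rewrite -natr1 mulrDl mul1r; split => //; first ring.
    by move=> x y; rewrite mulgA hv expgS !mulgA.
  exists k, (g' * v')%g, (t1 + t'), n'.+1; rewrite addnS; split => //; first ring.
    by apply: word_cons.
  move=> x y; have Wg' : W g' by have [] := hl' _ Lg.
  rewrite mulgA hv -[(x * g' * g ^+ k * v' * y)%g]mulgA.
  by rewrite (cW Wg' x (g ^+ k)%g) !mulgA.
exists (C1 + C2) => v t n /split_word [k [v' [t' [n' [-> -> hw hv]]]]] x.
have := hv x 1%g; rewrite !mulg1 => ->.
have := hC1 k x; have := hC2 _ _ _ hw (x * g ^+ k)%g.
rewrite /= natrD mulrDl !ler_norml => /andP[? ?] /andP[? ?]; apply/andP; split; lra.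
Qed.

(** The alphabet may be infinite. Replacing each letter by one from a finite net costs [e' / 2],
    which leaves the other half for the finite alphabet. *)
Lemma word_bound (e' : R) : 0 < e' -> exists C, forall v t n,
  word letter v t n -> translation_bound be v t (n%:R * e' + C).
Proof.
move=> e'0; have e2 : 0 < e' / 2 by rewrite divr_gt0.
have [N1 [b1 hb1]] := Ktb z e2; have [N2 [b2 hb2]] := Ktb (z^-1)%g e2.
pose l := [seq (th (b1 j) z, s) | j <- iota 0 N1] ++
          [seq ((th (b2 j) z)^-1%g, - s) | j <- iota 0 N2].
have lL p : p \in l -> letter p.1 p.2.
  rewrite mem_cat => /orP[] /mapP[j _ ->]; [exists (b1 j); left | exists (b2 j); right];
  by [].
have [C hC] := @finite_word_bound l (fun p pl => conj (letterW (lL p pl)) (letter_slope (lL p pl))) _ e2.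
exists C => v t n wv.
have [v' wv' hv'] : exists2 v', word (fun g r => (g, r) \in l) v' t n &
    forall x, `|be (x * v)%g - be (x * v')%g| <= n%:R * (e' / 2).
  elim: wv => [|g t1 v1 r1 n1 Lg wv1 [v' wv' hv']].
    exists 1%g; first exact: word_nil.
    by move=> x; rewrite subrr normr0 mul0r.
  have Wv1 : W v1 by apply: wordW wv1; exact: letterW.
  have [g' lg' Kg'] : exists2 g', (g', t1) \in l & K (g'^-1 * g)%g <= e' / 2.
    have [a [[-> ->]|[-> ->]]] := Lg.
      have [j jN hj] := hb1 a; exists (th (b1 j) z) => //.
      by rewrite mem_cat; apply/orP; left; apply/mapP; exists j; rewrite ?mem_iota ?add0n.
    have [j jN] := hb2 a; rewrite !thV => hj; exists ((th (b2 j) z)^-1)%g => //.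
    by rewrite mem_cat; apply/orP; right; apply/mapP; exists j; rewrite ?mem_iota ?add0n.
  exists (g' * v')%g; first by apply: word_cons.
  move=> x; have := hv' (x * g')%g; rewrite -!mulgA.
  (* Commutation moves the discrepancy of the two letters to the right end, where [K] bounds its
     effect. *)
  have -> : be (x * (g * v1))%g = be (x * (g' * v1) * (g'^-1 * g))%g.
    have Wg := letterW Lg; have Wg' := letterW (lL _ lg').
    have [_ WM WV _] := sW.
    have := cW (WM _ _ (WV _ Wg') Wg) (x * g')%g v1 1%g.
    by rewrite !mulg1 !mulgA mulgK.
  have := bdb (g'^-1 * g)%g (x * (g' * v1))%g; rewrite -[n1.+1%:R]natr1 mulrDl mul1r subr0.
  by rewrite !ler_norml => /andP[? ?] /andP[? ?]; apply/andP; split; lra.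
move=> x; have := hv' x; have := hC _ _ _ wv' x.
by rewrite !ler_norml => /andP[? ?] /andP[? ?]; apply/andP; split; lra.
Qed.

Lemma infconv_ge x : exists m, forall v t n, word letter v t n ->
  m <= be (x * v)%g - t + e * n%:R.
Proof.
have [C hC] := word_bound e0; exists (be x - C) => v t n /hC /(_ x).
by rewrite ler_norml => /andP[? ?]; lra.
Qed.

Lemma infconv_le x v t n : word letter v t n -> infconv x <= be (x * v)%g - t + e * n%:R.
Proof.
move=> wv; apply: ge_inf; last by exists v, t, n.
by have [m hm] := infconv_ge x; exists m => _ [v' [t' [n' [wv' ->]]]]; apply: hm.
Qed.

Lemma le_infconv x (m : R) : (forall v t n, word letter v t n ->
  m <= be (x * v)%g - t + e * n%:R) -> m <= infconv x.
Proof.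
move=> h; apply: lb_le_inf; last by move=> _ [v [t [n [/h ? ->]]]].
by eexists; exists 1%g, 0, 0%N; split; [exact: word_nil | reflexivity].
Qed.

(** By commutation [y] passes through every word, so both infima run over the same increments. Hence
    slopes that are already straightened survive when another one is treated. *)
Lemma infconv_translation y c r :
  translation_bound be y c r -> translation_bound infconv y c r.
Proof.
move=> h x; have cv v t n : word letter v t n -> be (x * y * v)%g = be (x * v * y)%g.
  move=> /(wordW letterW) Wv; have := cW Wv x y 1%g; by rewrite !mulg1.
rewrite ler_norml; apply/andP; split.
  suff : infconv x + c - r <= infconv (x * y)%g by lra.
  apply: le_infconv => v t n wv; rewrite (cv _ _ _ wv).
  have := h (x * v)%g; have := infconv_le x wv.
  by rewrite ler_norml => ? /andP[? ?]; lra.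
suff : infconv (x * y)%g - c - r <= infconv x by lra.
apply: le_infconv => v t n wv; have := infconv_le (x * y)%g wv.
have := h (x * v)%g; rewrite (cv _ _ _ wv).
by rewrite ler_norml => /andP[? ?] ?; lra.
Qed.

Lemma word_th a v t n : word letter v t n -> word letter (th a v) t n.
Proof.
elim=> [|g t' v' r n' [b hb] _ ih]; first by rewrite th1; exact: word_nil.
rewrite thM; apply: word_cons => //; exists (cp a b); rewrite thC.
by case: hb => [[-> ->]|[-> ->]]; [left | right; rewrite thV].
Qed.

(** Linear parts permute the words and preserve their values and lengths. *)
Lemma infconv_equivariant : equivariant infconv.
Proof.
suff h a x : infconv (affact a x) <= infconv x + u a.
  move=> a x; apply/eqP; rewrite eq_le h /=; apply: le_infconv => v t n wv.
  have := infconv_le x (word_th (iv a) wv).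
  have -> : be (affact a x * v)%g = be (x * th (iv a) v)%g + u a.
    by rewrite -eqb /affact thM thVK mulgA.
  lra.
rewrite -lerBlDr; apply: le_infconv => v t n wv.
have := infconv_le (affact a x) (word_th a wv).
by rewrite /affact -mulgA -thM -/(affact _ _) eqb; lra.
Qed.

Lemma infconv_commutes : commutes_on infconv W.
Proof.
move=> w Ww y x y'; rewrite /infconv.
have E v : be (y * w * x * y' * v)%g = be (y * x * w * y' * v)%g.
  by rewrite -!(mulgA _ y' v) cW.
congr inf; apply/seteqP.
by split=> r [v [t [n [wv ->]]]]; exists v, t, n; rewrite E.
Qed.

Lemma infconv_slope : (exists a, forall x, th a x = x) ->
  translation_bound infconv z s e.
Proof.
move=> [a ha] x.
have Lz : letter z s by exists a; left; rewrite ha.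
have LzV : letter (z^-1)%g (- s) by exists a; right; rewrite ha.
rewrite ler_norml; apply/andP; split.
  suff : infconv x + s - e <= infconv (x * z)%g by lra.
  apply: le_infconv => v t n wv; have := infconv_le x (word_cons Lz wv).
  by rewrite mulgA -natr1; lra.
suff : infconv (x * z)%g - s - e <= infconv x by lra.
apply: le_infconv => v t n wv; have := infconv_le (x * z)%g (word_cons LzV wv).
by rewrite -mulgA mulVKg -natr1; lra.
Qed.

End InfConvolution.

(** * Exact slopes by an ultrafilter limit *)

Section ExactStep.
Variables (be : A -> R) (W : set A) (E : A -> R).
Hypotheses (eqb : equivariant be) (bdb : displacement_bounded be).
Hypotheses (sW : stable_subgroup W) (cW : commutes_on be W).
Hypothesis slE : forall w, W w -> forall e : R, 0 < e -> exists C, forall k,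
  translation_bound be (w ^+ k)%g (k%:R * E w) (k%:R * e + C).
Hypothesis idI : exists a, forall x, th a x = x.

Definition refines (be1 be : A -> R) := [/\ equivariant be1, commutes_on be1 W &
  forall y c r, translation_bound be y c r -> translation_bound be1 y c r].

Lemma refine_finite (F : seq A) (e : R) : 0 < e -> exists be1, refines be1 be /\
  forall z, z \in F -> W z -> translation_bound be1 z (E z) e.
Proof.
move=> e0; elim: F => [|z F [be1 [[eq1 c1 t1] h1]]]; first by exists be; split.
have [Wz|nWz] := pselect (W z); last first.
  exists be1; split=> // z'; rewrite inE => /orP[/eqP->|zF] Wz'; first by [].
  exact: h1.
have bd1 : displacement_bounded be1 by move=> y; apply: t1.
have sl1 (e' : R) : 0 < e' -> exists C, forall k,
    translation_bound be1 (z ^+ k)%g (k%:R * E z) (k%:R * e' + C).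
  by move=> /(slE Wz) [C hC]; exists C => k; apply: t1.
have tr := infconv_translation eq1 bd1 sW c1 Wz sl1 e0.
exists (infconv be1 z (E z) e); split.
  split; first exact: (infconv_equivariant eq1 bd1 sW c1 Wz sl1 e0).
    exact: infconv_commutes.
  by move=> y c r h; apply: tr; apply: t1.
move=> z'; rewrite inE => /orP[/eqP->|zF] Wz'.
  exact: (infconv_slope eq1 bd1 sW c1 Wz sl1 e0).
by apply: tr; apply: h1.
Qed.

Lemma ultra_fmap {T S : Type} (U : set_system T) (phi : T -> S) :
  UltraFilter U -> UltraFilter (phi @ U).
Proof.
move=> UU; split=> [|G PG UG]; first exact: fmap_proper_filter.
apply/seteqP; split=> // B GB; have [//|nB] := in_ultra_setVsetC (phi @^-1` B) UU.
have /(filterI GB) := UG (~` B) nB; rewrite setICr => /filter_ex [x []].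
Qed.

Lemma ultra_lim {T : choiceType} (U : set_system T) (phi : T -> R) (M : R) :
  UltraFilter U -> U [set t | `|phi t| <= M] -> exists l : R, phi @ U --> l.
Proof.
move=> UU hM; have := @segment_compact R (- M) M; rewrite compact_ultra.
move=> /(_ (phi @ U)) [||l [_ hl]]; last by exists l.
  exact: ultra_fmap.
have : U (phi @^-1` [set` `[- M, M]]); last by [].
by apply: (filterS _ hM) => t /=; rewrite in_itv /= ler_norml.
Qed.

(** Error 0 on all of [W] at once requires a limit over finite sets and errors. After subtraction of
    the value at 1, the inherited displacement bound confines every function to a compact interval
    at each point, so the ultrafilter converges. *)
Lemma refine_limit : exists be1, refines be1 be /\
  forall z, W z -> translation_bound be1 z (E z) 0.
Proof.
pose B (i : seq A * nat) : set (A -> R) := [set h | refines h be /\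
  forall z, z \in i.1 -> W z -> translation_bound h z (E z) i.2.+1%:R^-1].
pose F := filter_from setT B.
have FF : Filter F.
  apply: filter_from_filter; first by exists ([::], 0%N).
  move=> [F1 k1] [F2 k2] _ _; exists (F1 ++ F2, maxn k1 k2) => //= h [hr hz].
  split; split=> // z zF Wz x; have := hz z; rewrite mem_cat zF ?orbT /= => /(_ isT Wz x);
  move=> /le_trans; apply; rewrite lef_pV2 ?posrE ?ltr0n// ler_nat ltnS.
    exact: leq_maxl.
  exact: leq_maxr.
have PF : ProperFilter F.
  apply: filter_from_proper => -[F1 k1] _.
  have k0 : 0 < k1.+1%:R^-1 :> R by rewrite invr_gt0 ltr0n.
  by have [h hh] := refine_finite F1 k0; exists h.
have [U [UU FU]] := ultraFilterLemma PF.
have UB i : U (B i) by apply: FU; exists i.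
have lim x : exists l : R, (fun h : A -> R => h x - h 1%g) @ U --> l.
  apply: (@ultra_lim _ U _ (K x) UU).
  apply: filterS (UB ([::], 0%N)) => h [[_ _ ht] _] /=.
  by have := ht _ _ _ (bdb x) 1%g; rewrite mul1g subr0.
have [be1 hbe1] := choice lim.
(* The limit determines differences only; every property to be transferred is a closed condition on
   one difference. *)
have pass x y (c r : R) i : (forall h, B i h -> `|h x - h y - c| <= r) ->
    `|be1 x - be1 y - c| <= r.
  move=> hB.
  have cv : (fun h : A -> R => `|h x - h y - c|) @ U --> `|be1 x - be1 y - c|.
    apply: (@cvg_norm _ _ _ U).
    have -> : (fun h : A -> R => h x - h y - c) =
        (fun h => (h x - h 1%g) - (h y - h 1%g) - c).
      by apply/funext => h; ring.
    apply: cvgB; last exact: cvg_cst.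
    by apply: cvgB; exact: hbe1.
  by apply: (cvgr_to_le cv); apply: filterS (UB i) => h /hB.
exists be1; split; first split.
- move=> a x; apply/eqP; rewrite -subr_eq0 opprD addrA -normr_le0.
  apply: (pass _ _ _ _ ([::], 0%N)) => h [[he _ _] _].
  by rewrite he (_ : _ - _ - _ = 0) ?normr0 //; ring.
- move=> w Ww y x z; apply/eqP; rewrite -subr_eq0 -normr_le0 -[_ - _]subr0.
  apply: (pass _ _ _ _ ([::], 0%N)) => h [[_ hc _] _].
  by rewrite hc // !subrr normr0.
- by move=> y c r hy x; apply: (pass _ _ _ _ ([::], 0%N)) => h [[_ _ ht] _]; apply: ht.
move=> z Wz x; apply/ler_addgt0Pl => e e0; rewrite addr0.
have [k] := ltr_add_invr e0; rewrite add0r => ke.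
apply: (pass _ _ _ _ ([:: z], k)) => h [_ hz].
apply: le_trans (hz z _ Wz x) (ltW ke); exact: mem_head.
Qed.

End ExactStep.

(* The chain [Z] is a central series read upwards: [Z 0] is trivial and [Z n] is everything. *)
Theorem equivariant_hom (Z : nat -> set A) (n : nat) (be : A -> R) :
  equivariant be -> displacement_bounded be ->
  (exists a, forall x, th a x = x) ->
  Z 0%N = [set 1%g] -> Z n = setT -> (forall i, stable_subgroup (Z i)) ->
  (forall i w x, Z i.+1 w -> Z i [~ w, x]%g) ->
  exists B : A -> R, [/\ {morph B : x y / (x * y)%g >-> x + y},
    forall y, `|B y| <= K y & forall a x, B (affact a x) = B x + u a].
Proof.
move=> eqb bdb idI Z0 Zn sZ cZ.
have [be1 [eq1 bd1 ad1]] : exists be1, [/\ equivariant be1, displacement_bounded be1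
    & additive_on be1 (Z n)].
  elim: {Zn} n => [|i [be1 [eq1 bd1 ad1]]].
    by exists be; split => // w; rewrite Z0 => -> x y; rewrite mulg1 subrr addr0.
  have c1 := commutes_step eq1 bd1 ad1 (sZ i.+1) (cZ i).
  have [E slE] := slope_exists eq1 bd1 (sZ i.+1) c1.
  have [be2 [[eq2 c2 t2] ex2]] := refine_limit eq1 bd1 (sZ i.+1) c1 slE idI.
  exists be2; split => //; first by move=> y; apply: t2.
  move=> w Zw; have eE x : be2 (x * w)%g = be2 x + E w.
    by apply/eqP; rewrite -subr_eq0 opprD addrA -normr_le0; apply: ex2.
  move=> x y; have := c2 w Zw x y 1%g; rewrite !mulg1 => ->.
  by rewrite eE; have := eE 1%g; rewrite mul1g => ->; rewrite addrAC subrr add0r.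
have adT w x y : be1 (x * w * y)%g = be1 (x * y)%g + (be1 w - be1 1%g).
  by apply: ad1; rewrite Zn.
exists (fun x => be1 x - be1 1%g); split.
- by move=> x y; have := adT y x 1%g; rewrite !mulg1 => ->; ring.
- by move=> y; have := bd1 y 1%g; rewrite mul1g subr0.
- by move=> a x; rewrite eq1 addrAC.
Qed.

End LinearDisplacement.

(** * Topological groups and Malcev bases *)

Lemma cvg_at_comp {T : Type} {F : set_system T} {FF : Filter F} {U V : topologicalType}
    {f : T -> U} {g : U -> V} {a : U} :
  f @ F --> a -> {for a, continuous g} -> (fun x => g (f x)) @ F --> g a.
Proof. by move=> h hg; exact: (cvg_comp _ _ h hg). Qed.

Lemma cvg_pair_at {T : Type} {F : set_system T} {FF : Filter F} {U V : topologicalType}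
    {f : T -> U} {g : T -> V} {a : U} {b : V} :
  f @ F --> a -> g @ F --> b -> (fun x => (f x, g x)) @ F --> (a, b).
Proof. by move=> fa gb; exact: cvg_pair. Qed.

Lemma cvg_id_at {U : topologicalType} (x : U) : (fun y => y) @ x --> x.
Proof. exact: cvg_id. Qed.

Section TopGroup.
Context {G : topGroupType}.

Lemma cvgMg {T : Type} {F : set_system T} {FF : Filter F} (f g : T -> G) (a b : G) :
  f @ F --> a -> g @ F --> b -> (fun x => f x * g x)%g @ F --> (a * b)%g.
Proof.
move=> fa gb; apply: (@continuous2_cvg _ _ _ _ F FF f g (fun u v => u * v)%g a b _ fa gb).
exact: (@mulg_continuous G (a, b)).
Qed.

Lemma cvgVg {T : Type} {F : set_system T} {FF : Filter F} (f : T -> G) (a : G) :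
  f @ F --> a -> (fun x => (f x)^-1)%g @ F --> (a^-1)%g.
Proof. by move=> fa; apply: (continuous_cvg _ _ fa); exact: invg_continuous. Qed.

End TopGroup.

(** * Uniform choices over compact sets *)

Section NearCompact.
Context {X Y : topologicalType} {R : realType}.

Lemma compact_near_all (Q : set X) (y0 : Y) (P : X * Y -> Prop) :
  compact Q -> (forall q, Q q -> \forall z \near (q, y0), P z) ->
  \forall y \near y0, forall q, Q q -> P (q, y).
Proof.
move=> /compact_near_coveringP cQ hP.
apply: (cQ Y (nbhs y0) (fun y x => P (x, y))) => q /hP.
by case=> -[U V] [Uq Vy] UV; exists (U, V) => //= -[a b] /UV.
Qed.

(** Lists ordered by inclusion serve as the filter in the near-covering form of compactness. The net
    then consists of members of the family [ga], not of arbitrary points of [Q]. *)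
Lemma compact_finite_net {I : Type} (Q : set X) (ga : I -> X) (rho : X -> X -> Prop) :
  compact Q -> (forall a, Q (ga a)) -> inhabited I ->
  (forall q, Q q -> \forall z \near (q, q), rho z.1 z.2) ->
  exists (n : nat) (b : nat -> I), forall a, exists2 j, (j < n)%N & rho (ga (b j)) (ga a).
Proof.
move=> /compact_near_coveringP cQ hga [a0] hrho.
pose F := filter_from [set: seq I] (fun l => [set l' | forall a, List.In a l -> List.In a l']).
have FF : ProperFilter F.
  apply: filter_from_proper; last by move=> l _; exists l.
  apply: filter_from_filter; first by exists [::].
  move=> l1 l2 _ _; exists (l1 ++ l2) => // l hl; split=> a ha; apply: hl;
  apply: List.in_or_app; by [left|right].
have := cQ _ F (fun l q => forall a, ga a = q ->
  exists2 b, List.In b l & rho (ga b) (ga a)) _ _.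
case=> [q Qq|l _ /(_ l (fun a h => h)) hl].
  have [[U V] [Uq Vq] UV] := hrho q Qq.
  have [[a1 [Ua1 Va1]]|nUV] := pselect (exists a, U (ga a) /\ V (ga a)).
    exists (V, [set l | List.In a1 l]).
      by split=> //; exists [:: a1] => // l; apply; left.
    by move=> [q' l] [/= Vq' al] a aq; exists a1 => //; apply: (UV (_, _)); rewrite /= aq.
  exists (U `&` V, setT); first by split=> //=; [exact: filterI|exact: filterT].
  move=> [q' l] [/= [Uq' Vq'] _] a aq; exfalso; apply: nUV; exists a.
  by rewrite aq.
exists (size l), (fun j => List.nth j l a0) => a.
have [b bl rb] := hl _ (hga a) a erefl.
have [j [jl jb]] := List.In_nth l b a0 bl.
by exists j; [apply/ssrnat.ltP | rewrite jb].
Qed.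

Lemma compact_norm_bounded (Q : set X) (f : X -> R) :
  compact Q -> (forall q, Q q -> {for q, continuous f}) ->
  exists M, forall q, Q q -> `|f q| <= M.
Proof.
move=> /compact_near_coveringP cQ cf.
have [|M _ /(_ M (leqnn M)) hM] := cQ nat \oo (fun M q => `|f q| <= M%:R) _; last first.
  by exists M%:R.
move=> q /cf cfq.
have hU := @cvgr_norm_lt _ _ _ _ (nbhs_filter q) f _ cfq (`|f q| + 1) _.
exists ([set x | `|f x| < `|f q| + 1], [set m | (Num.bound (`|f q| + 1) <= m)%N]).
  split => /=; first by apply: hU; rewrite ltrDl.
  by exists (Num.bound (`|f q| + 1)).
move=> [x m] /= [hx hm]; apply: le_trans (ltW hx) _.
apply: le_trans (ltW (archi_boundP _)) _; first by rewrite addr_ge0.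
by rewrite ler_nat.
Qed.

End NearCompact.

Section SupNorm.
Context {X : topologicalType} {R : realType}.
Variables (Q : set X).

Definition supnorm (f : X -> R) : R := sup [set `|f q| | q in Q].

Lemma supnorm_ge f q : compact Q -> (forall q, Q q -> {for q, continuous f}) ->
  Q q -> `|f q| <= supnorm f.
Proof.
move=> cQ cf Qq; have [M hM] := compact_norm_bounded cQ cf.
by apply: sup_ubound; [exists M => _ [x Qx <-]; exact: hM | exists q].
Qed.

Lemma supnorm_le f M : Q !=set0 -> (forall q, Q q -> `|f q| <= M) -> supnorm f <= M.
Proof.
move=> [q Qq] h; apply: ge_sup; first by exists `|f q|; exists q.
by move=> _ [x Qx <-]; exact: h.
Qed.

End SupNorm.

(** * Malcev bases and congruences modulo their filtration *)

Section Malcev.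
Context {R : realType} {G : topGroupType}.
Implicit Types (x y z g : G).

(* A strong Malcev basis of the second kind, given by its one-parameter subgroups [e j]. *)
Record malcev (k : nat) (N : nat -> set G) (chi : nat -> G -> R) (e : nat -> R -> G) :
    Prop := Malcev {
  malcev_top : N 0%N = setT ;
  malcev_bot : N k = [set 1%g] ;
  malcev_chi_cont : forall j, (j < k)%N -> continuous (chi j) ;
  malcev_chiM : forall j x y, (j < k)%N -> N j x -> N j y ->
    chi j (x * y)%g = chi j x + chi j y ;
  malcev_ker : forall j x, (j < k)%N -> N j.+1 x <-> N j x /\ chi j x = 0 ;
  malcev_comm : forall j x g, (j < k)%N -> N j x -> N j.+1 [~ x, g]%g ;
  malcev_e_cont : forall j, (j < k)%N -> continuous (e j) ;
  malcev_eD : forall j s t, (j < k)%N -> e j (s + t) = (e j s * e j t)%g ;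
  malcev_eN : forall j t, (j < k)%N -> N j (e j t) ;
  malcev_chie : forall j t, (j < k)%N -> chi j (e j t) = t }.

Section Theory.
Context {k : nat} {N : nat -> set G} {chi : nat -> G -> R} {e : nat -> R -> G}.
Hypothesis H : malcev k N chi e.

Lemma malcev_subset j x : (j < k)%N -> N j.+1 x -> N j x.
Proof. by move=> jk /(malcev_ker H x jk) []. Qed.

Lemma malcev_normal j : (j <= k)%N -> [/\ N j 1%g,
  forall x y, N j x -> N j y -> N j (x * y)%g, forall x, N j x -> N j (x^-1)%g &
  forall x g, N j x -> N j (x ^ g)%g].
Proof.
elim: j => [_|j ih jk]; first by rewrite (malcev_top H).
have [N1 NM NV NJ] := ih (ltnW jk).
have c1 : chi j 1%g = 0.
  by have /eqP := malcev_chiM H jk N1 N1; rewrite mulg1 -subr_eq0 opprD addNKr oppr_eq0 => /eqP.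
have kerM x y : N j.+1 x -> N j.+1 y -> N j.+1 (x * y)%g.
  move=> /(malcev_ker H _ jk) [Nx cx] /(malcev_ker H _ jk) [Ny cy].
  by apply/(malcev_ker H _ jk); split; [exact: NM | rewrite (malcev_chiM H) // cx cy addr0].
split => //.
- by apply/(malcev_ker H _ jk).
- move=> x /(malcev_ker H _ jk) [Nx cx]; apply/(malcev_ker H _ jk); split; first exact: NV.
  by have := malcev_chiM H jk Nx (NV _ Nx); rewrite mulgV c1 cx add0r.
- move=> x g Nx; have -> : (x ^ g = x * [~ x, g])%g by rewrite commgEl mulVKg.
  by apply: kerM => //; apply: (malcev_comm H) => //; exact: malcev_subset.
Qed.

Lemma malcev_chi1 j : (j < k)%N -> chi j 1%g = 0.
Proof.
move=> jk; have [N1 _ _ _] := malcev_normal (ltnW jk).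
by have /eqP := malcev_chiM H jk N1 N1; rewrite mulg1 -subr_eq0 opprD addNKr oppr_eq0 => /eqP.
Qed.

Lemma malcev_chiJ j x g : (j < k)%N -> N j x -> chi j (x ^ g)%g = chi j x.
Proof.
move=> jk Nx; have -> : (x ^ g = x * [~ x, g])%g by rewrite commgEl mulVKg.
have [Nc c0] := (malcev_ker H _ jk).1 (malcev_comm H g jk Nx).
by rewrite (malcev_chiM H) // c0 addr0.
Qed.

Lemma malcev_e0 j : (j < k)%N -> e j 0 = 1%g.
Proof.
by move=> jk; apply: (@mulgI _ (e j 0)); rewrite -(malcev_eD H) // addr0 mulg1.
Qed.

Lemma malcev_eNeg j t : (j < k)%N -> e j (- t) = ((e j t)^-1)%g.
Proof.
move=> jk; apply: (@mulgI _ (e j t)).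
by rewrite -(malcev_eD H) // subrr malcev_e0 // mulgV.
Qed.

Definition cong j x y := N j (x^-1 * y)%g.

Lemma cong_refl j x : (j <= k)%N -> cong j x x.
Proof. by move=> /malcev_normal []; rewrite /cong mulVg. Qed.

Lemma cong_sym j x y : (j <= k)%N -> cong j x y -> cong j y x.
Proof. by move=> /malcev_normal [_ _ NV _] /NV; rewrite /cong invgM invgK. Qed.

Lemma cong_trans j y x z : (j <= k)%N -> cong j x y -> cong j y z -> cong j x z.
Proof.
move=> /malcev_normal [_ NM _ _] xy yz; have := NM _ _ xy yz.
by rewrite /cong -mulgA mulVKg.
Qed.

Lemma congM j x x' y y' : (j <= k)%N -> cong j x x' -> cong j y y' ->
  cong j (x * y)%g (x' * y')%g.
Proof.
move=> /malcev_normal [_ NM _ NJ] xx yy; rewrite /cong.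
have -> : ((x * y)^-1 * (x' * y') = ((x^-1 * x') ^ y) * (y^-1 * y'))%g.
  by rewrite conjgE invgM !mulgA mulgK.
by apply: NM => //; apply: NJ.
Qed.

Lemma congV j x y : (j <= k)%N -> cong j x y -> cong j (x^-1)%g (y^-1)%g.
Proof.
move=> jk xy; have [_ _ NV NJ] := malcev_normal jk; rewrite /cong.
have -> : (x^-1^-1 * y^-1 = ((x^-1 * y)^-1) ^ x^-1)%g.
  by rewrite conjgE !invgM !invgK !mulgA mulgK.
by apply: NJ; apply: NV.
Qed.

Lemma cong_bot x y : cong k x y -> x = y.
Proof. by rewrite /cong (malcev_bot H) => /mulg1_eq; rewrite invgK. Qed.

End Theory.
End Malcev.

(** * Equivariant maps extend to equivariant homomorphisms *)

Section Subgroups.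
Context {G : groupType}.
Implicit Types (H : set G) (x y : G).

Lemma is_subgroupP H : is_subgroup H <->
  H 1%g /\ forall x y, H x -> H y -> H (x * y^-1)%g.
Proof.
split=> [[h1 h2]|[h1 h2]].
  split; first by move: h1; rewrite /in_mem /= inE.
  by move=> x y Hx Hy; have := h2 x y; rewrite /in_mem /= !inE; apply.
split; first by rewrite /in_mem /= inE.
by move=> x y; rewrite /in_mem /= !inE; exact: h2.
Qed.

Lemma is_subgroup1 H : is_subgroup H -> H 1%g. Proof. by case/is_subgroupP. Qed.

Lemma is_subgroupV H x : is_subgroup H -> H x -> H (x^-1)%g.
Proof. by move=> /is_subgroupP [H1 HV] Hx; rewrite -[(_^-1)%g]mul1g; apply: HV. Qed.

Lemma is_subgroupM H x y : is_subgroup H -> H x -> H y -> H (x * y)%g.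
Proof.
move=> sH Hx Hy; rewrite -[y]invgK; move/is_subgroupP: (sH) => [_]; apply => //.
exact: is_subgroupV.
Qed.

Lemma lower_central_subgroup k : is_subgroup (@lower_central G k).
Proof.
case: k => [|k]; first by apply/is_subgroupP.
apply/is_subgroupP; split=> [|x y hx hy] H [sH gH]; first exact: is_subgroup1.
by apply: is_subgroupM => //; [exact: hx | apply: is_subgroupV => //; exact: hy].
Qed.

Lemma lower_central_comm k x y : @lower_central G k x -> @lower_central G k.+1 [~ x, y]%g.
Proof. by move=> hx H [sH gH]; apply: gH; exists x => //; exists y. Qed.

Lemma lower_central_morph (th : G -> G) k x : {morph th : x y / (x * y)%g} ->
  @lower_central G k x -> @lower_central G k (th x).
Proof.
move=> thM; have th1 : th 1%g = 1%g.
  by apply: (@mulgI _ (th 1%g)); rewrite -thM !mulg1.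
have thV y : th (y^-1)%g = ((th y)^-1)%g.
  by apply: (@mulgI _ (th y)); rewrite -thM !mulgV th1.
elim: k x => [//|k ih] x hx; have sL := lower_central_subgroup k.+1.
suff h : [set M | is_subgroup M /\ [set [~ x, y]%g | x in @lower_central G k & y in [set: G]]
    `<=` M] [set x | @lower_central G k.+1 (th x)] by exact: (hx _ h).
split; last first.
  move=> _ [y hy [z _ <-]]; rewrite /= !thM !thV -?thM.
  have -> : ((th y)^-1 * ((th z)^-1 * th (y * z)) = [~ th y, th z])%g.
    by rewrite thM commgEl conjgE.
  by apply: lower_central_comm; apply: ih.
apply/is_subgroupP; split; first by have := is_subgroup1 sL; rewrite -[in X in X -> _]th1.
move=> y z hy hz; have := is_subgroupM sL hy (is_subgroupV sL hz).
by rewrite -thV -thM.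
Qed.

Lemma lower_central_trivial k l : @lower_central G k = [set 1%g] ->
  (k <= l)%N -> @lower_central G l = [set 1%g].
Proof.
move=> hk /subnK <-; elim: (l - k)%N => [//|i ih]; rewrite addSn.
apply/seteqP; split=> [x /(_ [set 1%g])|_ ->]; last first.
  exact: is_subgroup1 (lower_central_subgroup _).
apply; split; first by apply/is_subgroupP; split=> // a b -> ->; rewrite mulgV.
move=> _ [y hy [z _ <-]]; have := hy; rewrite -/(lower_central _) ih => ->.
by rewrite comm1g.
Qed.

End Subgroups.

Section SubgroupType.
Context {A : groupType}.

(** Bundled so that the sub-type carries a [groupType] structure, which the fibre product below
    requires. *)
Record subgroup_set := SubgroupSet {
  sgset :> set A ;
  sgset1 : sgset 1%g ;
  sgsetM : forall x y, sgset x -> sgset y -> sgset (x * y)%g ;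
  sgsetV : forall x, sgset x -> sgset (x^-1)%g }.

Definition sgtype (H : subgroup_set) := {x : A | x \in sgset H}.

HB.instance Definition _ (H : subgroup_set) := SubChoice.on (sgtype H).

Lemma sgtype_closed (H : subgroup_set) : group_closed (fun x => x \in sgset H).
Proof.
split; rewrite /in_mem /= ?inE; first exact: sgset1.
by move=> x y; rewrite /in_mem /= !inE => Hx Hy; apply: sgsetM => //; apply: sgsetV.
Qed.

HB.instance Definition _ (H : subgroup_set) :=
  SubChoice_isSubGroup.Build A _ (sgtype H) (sgtype_closed H).

Definition mksg (H : subgroup_set) x (Hx : sgset H x) : sgtype H := exist _ x (mem_set Hx).

Lemma sgtypeP (H : subgroup_set) (p : sgtype H) : sgset H (val p).
Proof. exact: set_mem (valP p). Qed.

End SubgroupType.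

(** * Descending the filtration of the target through fibre products *)

Section Extension.
Context {R : realType} {S G : topGroupType} {T : topologicalType} {I : Type}.
Variables (C : set T) (al : T -> S -> S) (D : set S).
Variables (d : I -> S) (th : I -> S -> S) (iv : I -> I) (cp : I -> I -> I) (phi : I -> G).
Hypotheses (cptC : compact C) (cptD : compact D).
Hypothesis al_cont : forall c x, C c -> {for (c, x), continuous (fun p : T * S => al p.1 p.2)}.
Hypothesis thal : forall a, exists2 c, C c & forall x, th a x = al c x.
Hypothesis al1 : forall c, C c -> al c 1%g = 1%g.
Hypothesis thM : forall a, {morph th a : x y / (x * y)%g}.
Hypothesis thK : forall a, cancel (th a) (th (iv a)).
Hypothesis thVK : forall a, cancel (th (iv a)) (th a).
Hypothesis thC : forall a b x, th (cp a b) x = th a (th b x).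
Hypothesis act_id : exists2 a, d a = 1%g & forall x, th a x = x.
Hypothesis cocpt : forall x, exists a, exists2 y, D y & x = (d a * th a y)%g.
Hypotheses (nilS : is_nilpotent S) (nilG : is_nilpotent G).
Context {k : nat} {N : nat -> set G} {chi : nat -> G -> R} {e : nat -> R -> G}.
Hypothesis HG : malcev k N chi e.

Definition quasi_hom j (Phi : S -> G) := [/\ continuous Phi,
  forall a x, Phi (d a * th a x)%g = (phi a * Phi x)%g &
  forall x y, cong (N := N) j (Phi (x * y)%g) (Phi x * Phi y)%g].

Section Step.
Variables (j : nat) (Phi : S -> G).
Hypotheses (jk : (j < k)%N) (qP : quasi_hom j Phi).

Let cPhi : continuous Phi. Proof. by case: qP. Qed.
Let ePhi a x : Phi (d a * th a x)%g = (phi a * Phi x)%g. Proof. by case: qP. Qed.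
Let hPhi x y : cong (N := N) j (Phi (x * y)%g) (Phi x * Phi y)%g. Proof. by case: qP. Qed.
Let jk' : (j <= k)%N := ltnW jk.

Let cg := cong (N := N) j.

Let Phi1 : cg 1%g (Phi 1%g).
Proof.
have [_ NM NV NJ] := malcev_normal HG jk'.
by have := hPhi 1%g 1%g; rewrite /cg /cong !mulg1 mulgA mulVg mul1g invg1 mul1g.
Qed.

Let PhiV x : cg (Phi (x^-1)%g) ((Phi x)^-1)%g.
Proof.
have := hPhi (x^-1)%g x; rewrite mulVg => h.
have h2 : cg 1%g (Phi (x^-1)%g * Phi x)%g := cong_trans HG jk' Phi1 h.
apply: (cong_sym HG jk').
have := congM HG jk' h2 (cong_refl HG (Phi x)^-1%g jk').
by rewrite mul1g mulgK.
Qed.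

Let Phith a x : cg (Phi (th a x)) (Phi x).
Proof.
have h1 : cg (Phi (d a)) (phi a).
  have := ePhi a 1%g; rewrite (th1 thM) mulg1 => ->.
  have := congM HG jk' (cong_refl HG (phi a) jk') (cong_sym HG jk' Phi1).
  by rewrite mulg1.
have h2 := hPhi (d a) (th a x); rewrite ePhi in h2.
have h3 := congM HG jk' h1 (cong_refl HG (Phi (th a x)) jk').
have := cong_sym HG jk' (cong_trans HG jk' h2 h3).
by rewrite /cg /cong invgM -!mulgA mulKg.
Qed.

(** The fibre product of [S] and [G] over [G / N j]. On it the failure of [Phi] to be multiplicative
    modulo [N j.+1] becomes a real function. *)
Definition ext_set : set (S * G) := [set p | cg (Phi p.1) p.2].

Lemma ext_setM p q : ext_set p -> ext_set q -> ext_set (p * q)%g.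
Proof.
by move=> hp hq; apply: (cong_trans HG jk' (hPhi _ _)); apply: (congM HG jk').
Qed.

Lemma ext_setV p : ext_set p -> ext_set (p^-1)%g.
Proof. by move=> hp; apply: (cong_trans HG jk' (PhiV _)); apply: (congV HG jk'). Qed.

Definition ext_subgroup : @subgroup_set (S * G)%type :=
  @SubgroupSet (S * G)%type ext_set (cong_sym HG jk' Phi1) ext_setM ext_setV.

Let E := sgtype ext_subgroup.

Let valM (p q : E) : val (p * q)%g = (val p * val q)%g. Proof. by []. Qed.
(** The height of [p] above the graph of [Phi]. If a homomorphism with the same equivariance takes
    its place, its kernel is the graph of an improved map modulo [N j.+1]. *)
Let be (p : E) : R := chi j ((Phi (val p).1)^-1 * (val p).2)%g.

(** The increment of [be] under right translation by [y], after equivariance has moved the base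
    point into [D]; the parameter in [C] is the linear part picked up on the way. Compactness of [D]
    and [C] makes the supremum over these parameters finite, and small for [y] near 1. *)
Let kap (q : S * T) (y : S * G) : R :=
  chi j ((Phi (q.1 * al q.2 y.1))^-1 * Phi q.1 * y.2)%g.

Let Q := D `*` C.
Let KK (y : S * G) := supnorm Q (kap^~ y).

Let cptQ : compact Q. Proof. exact: compact_setX. Qed.

Let kap_cont q y : Q q ->
  {for (q, y), continuous (fun z : (S * T) * (S * G) => kap z.1 z.2)}.
Proof.
move=> [Dq Cq].
have c11 : (fun z : (S * T) * (S * G) => z.1.1) @ (q, y) --> q.1.
  by apply: (cvg_comp _ _ cvg_fst); exact: cvg_fst.
have c12 : (fun z : (S * T) * (S * G) => z.1.2) @ (q, y) --> q.2.
  by apply: (cvg_comp _ _ cvg_fst); exact: cvg_snd.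
have c21 : (fun z : (S * T) * (S * G) => z.2.1) @ (q, y) --> y.1.
  by apply: (cvg_comp _ _ cvg_snd); exact: cvg_fst.
have c22 : (fun z : (S * T) * (S * G) => z.2.2) @ (q, y) --> y.2.
  by apply: (cvg_comp _ _ cvg_snd); exact: cvg_snd.
have ca : (fun z : (S * T) * (S * G) => al z.1.2 z.2.1) @ (q, y) --> al q.2 y.1.
  exact: (cvg_comp _ _ (cvg_pair c12 c21) (@al_cont q.2 y.1 Cq)).
have cm : (fun z : (S * T) * (S * G) => (z.1.1 * al z.1.2 z.2.1)%g) @ (q, y) -->
    (q.1 * al q.2 y.1)%g by exact: cvgMg.
have c3 := cvg_comp _ _ cm (@cPhi _); have c4 := cvg_comp _ _ c11 (@cPhi _).
have h : (fun z : (S * T) * (S * G) =>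
    ((Phi (z.1.1 * al z.1.2 z.2.1))^-1 * Phi z.1.1 * z.2.2)%g) @ (q, y) -->
    ((Phi (q.1 * al q.2 y.1))^-1 * Phi q.1 * y.2)%g.
  by apply: cvgMg => //; apply: cvgMg => //; exact: cvgVg.
have hh := malcev_chi_cont HG jk; have h5 := cvg_comp _ _ h (hh _).
exact: h5.
Qed.

Let kap_contl q y : Q q -> {for q, continuous (kap^~ y)}.
Proof. by move=> Qq; exact: (cvg_comp _ _ (cvg_pair_at (@cvg_id_at _ _) (cvg_cst y)) (kap_cont (y := y) Qq)). Qed.

Let kap_le q y : Q q -> `|kap q y| <= KK y.
Proof. by move=> Qq; exact: (supnorm_ge cptQ (fun q' Qq' => kap_contl (y := y) Qq') Qq). Qed.

Let Q0 : Q !=set0.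
Proof.
have [a [y Dy _]] := cocpt 1%g; have [c Cc _] := thal a.
by exists (y, c).
Qed.

Let KK_small (eps : R) : 0 < eps -> \forall y \near ((1%g, 1%g) : S * G), KK y <= eps.
Proof.
move=> e0; have := @compact_near_all _ (S * G)%type Q (1%g, 1%g)
  (fun z => `|kap z.1 z.2| < eps) cptQ.
move=> h; apply: filterS (h _); last first.
  move=> q Qq; have hq := kap_cont (y := (1%g, 1%g)) Qq.
  apply: (@cvgr_norm_lt _ _ _ _ _ _ _ hq eps).
  have [_ Cq] := Qq; rewrite /kap /= al1 // !mulg1 mulVg.
  by rewrite (malcev_chi1 HG jk) normr0.
by move=> y hy; apply: supnorm_le => // q Qq; apply: ltW; exact: (hy q Qq).
Qed.

Let KK_family {X : topologicalType} (P : set X) (h : X -> S * G) :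
  compact P -> (forall p, P p -> {for p, continuous h}) ->
  exists M, forall p, P p -> KK (h p) <= M.
Proof.
move=> cP ch.
have [|[q p] [/= Qq Pp]|M hM] := @compact_norm_bounded _ R (Q `*` P) (fun z => kap z.1 (h z.2)).
- exact: compact_setX.
- have c2 : (fun z : (S * T) * X => h z.2) @ (q, p) --> h p.
    refine (cvg_at_comp cvg_snd (ch _ Pp)).
  have c1 : (fun z : (S * T) * X => (z.1, h z.2)) @ (q, p) --> (q, h p).
    exact: (cvg_pair cvg_fst c2).
  refine (cvg_at_comp c1 (kap_cont (y := h p) Qq)).
exists M => p Pp; apply: supnorm_le => // q Qq; exact: (hM (q, p)).
Qed.

Let be_translation (p r : E) : exists2 q, Q q & be (p * r)%g - be p = kap q (val r).
Proof.
have [a [y Dy xE]] := cocpt (val p).1; have [c Cc cE] := thal (iv a).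
exists (y, c) => //; rewrite /be /kap valM.
set x := (val p).1 in xE *; set g := (val p).2; set v := (val r).1; set h := (val r).2.
have hp : cg (Phi x) g := sgtypeP p; have hr : cg (Phi v) h := sgtypeP r.
have -> : (val p * val r)%g.1 = (x * v)%g by [].
have -> : (val p * val r)%g.2 = (g * h)%g by [].
have -> : ((Phi (y * al c v))^-1 * Phi y * h)%g = ((Phi (x * v))^-1 * Phi x * h)%g.
  have -> : (x * v = d a * th a (y * al c v))%g by rewrite xE thM -cE thVK mulgA.
  by rewrite xE !ePhi invgM !mulgA mulgVK.
have [N1 NM NV NJ] := malcev_normal HG jk'.
have hm : N j ((Phi (x * v))^-1 * Phi x * h)%g.
  have := cong_trans HG jk' (hPhi x v) (congM HG jk' (cong_refl HG (Phi x) jk') hr).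
  by rewrite /cong mulgA.
have -> : ((Phi (x * v))^-1 * (g * h) =
    ((Phi (x * v))^-1 * Phi x * h) * ((Phi x)^-1 * g) ^ h)%g.
  by rewrite conjgE !mulgA mulgK mulgK.
rewrite (malcev_chiM HG jk hm) ?(malcev_chiJ HG) //; last exact: NJ.
by rewrite addrK.
Qed.

(** Adjoining [N j] to the acting group makes the action on the fibre product cocompact, with the
    graph over [D] as fundamental set, and forces the resulting homomorphism to be [chi j] on
    [N j]. *)
Let Ie := (I * {n : G | N j n})%type.
Let n1 : {n : G | N j n}.
Proof. by exists 1%g; case: (malcev_normal HG jk'). Defined.

Let dE_set (a : Ie) : ext_set (d a.1, phi a.1 * proj1_sig a.2)%g.
Proof.
case: a => a [n /= Nn]; rewrite /ext_set /=.
have h : cg (Phi (d a)) (phi a).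
  have := ePhi a 1%g; rewrite (th1 thM) mulg1 => ->.
  have := congM HG jk' (cong_refl HG (phi a) jk') (cong_sym HG jk' Phi1).
  by rewrite mulg1.
have h1 : cg 1%g n by rewrite /cg /cong invg1 mul1g.
by have := congM HG jk' h h1; rewrite mulg1.
Qed.

Let thE_set (a : I) (p : E) : ext_set (th a (val p).1, (val p).2).
Proof. exact: (cong_trans HG jk' (Phith a _) (sgtypeP p)). Qed.

Let dE (a : Ie) : E := mksg (dE_set a : sgset ext_subgroup _).
Let thE (a : Ie) (p : E) : E := mksg (thE_set a.1 p : sgset ext_subgroup _).
Let ivE (a : Ie) : Ie := (iv a.1, n1).
Let cpE (a b : Ie) : Ie := (cp a.1 b.1, n1).

Let pairE (p : S * G) : p = (p.1, p.2). Proof. by case: p. Qed.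

Lemma ext_hom_exists : exists B : E -> R, [/\ {morph B : x y / (x * y)%g >-> x + y},
  forall y, `|B y| <= KK (val y) &
  forall a x, B (dE a * thE a x)%g = B x + chi j (proj1_sig a.2)].
Proof.
have thEM a : {morph thE a : x y / (x * y)%g}.
  by move=> x y; apply/val_inj => /=; rewrite /thE /= thM.
have thEK a : cancel (thE a) (thE (ivE a)).
  by move=> x; apply/val_inj; rewrite /= thK -pairE.
have thEVK a : cancel (thE (ivE a)) (thE a).
  by move=> x; apply/val_inj; rewrite /= thVK -pairE.
have thEC a b x : thE (cpE a b) x = thE a (thE b x).
  by apply/val_inj; rewrite /= thC.
have exMo (w : E) : exists M, forall a, KK (val (thE a w)) <= M.
  have [c Cc|M hM] := @KK_family _ C (fun c => (al c (val w).1, (val w).2)) cptC.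
    have c1 : (fun c => al c (val w).1) @ c --> al c (val w).1.
      refine (cvg_at_comp (cvg_pair_at (@cvg_id_at _ _) (cvg_cst (val w).1)) (@al_cont _ _ Cc)).
    exact: (cvg_pair c1 (cvg_cst (val w).2)).
  exists M => a; have [c Cc cE] := thal a.1; rewrite /= cE; exact: hM.
have [Mo hMo] := choice exMo.
pose DE : set E := [set p | D (val p).1 /\ (val p).2 = Phi (val p).1].
have [MD hMD] : exists M, forall a y, DE y -> KK (val (thE a y)) <= M.
  have [|[c y] [Cc Dy]|M hM] := @KK_family _ (C `*` D)
    (fun z => (al z.1 z.2, Phi z.2)); first exact: compact_setX.
    have c1 : (fun z : T * S => Phi z.2) @ (c, y) --> Phi y.
      refine (cvg_at_comp cvg_snd (@cPhi y)).
    exact: (cvg_pair (@al_cont _ y Cc) c1).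
  exists M => a y [Dy yE]; have [c Cc cE] := thal a.1; rewrite /= cE yE.
  exact: (hM (c, (val y).1)).
have [a0 da0 ha0] := act_id.
have thE0 x : thE (a0, n1) x = x by apply/val_inj; rewrite /= ha0 -pairE.
have hMD0 y : DE y -> KK (val y) <= MD by move=> Dy; rewrite -(thE0 y); exact: hMD.
have Ktb (w : E) (eps : R) : 0 < eps -> exists (n : nat) (b : nat -> Ie),
    forall a, exists2 i, (i < n)%N & KK (val ((thE (b i) w)^-1 * thE a w)%g) <= eps.
  move=> e0; set x := (val w).1.
  have thal' a : exists c, C c /\ forall x, th a x = al c x.
    by have [c Cc cE] := thal a; exists c.
  have [ga hga] := choice thal'.
  have [||c Cc|n [b hb]] := @compact_finite_net _ I C ga
      (fun c c' => KK ((al c x)^-1 * al c' x, 1)%g <= eps) cptC.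
  - by move=> a; have [] := hga a.
  - by constructor; exact: a0.
  - have c1 : (fun z : T * T => al z.1 x) @ (c, c) --> al c x.
      refine (cvg_at_comp (cvg_pair_at cvg_fst (cvg_cst x)) (@al_cont _ x Cc)).
    have c2 : (fun z : T * T => al z.2 x) @ (c, c) --> al c x.
      refine (cvg_at_comp (cvg_pair_at cvg_snd (cvg_cst x)) (@al_cont _ x Cc)).
    have c3 : (fun z : T * T => ((al z.1 x)^-1 * al z.2 x, 1)%g) @ (c, c) -->
        ((1%g, 1%g) : S * G).
      apply: cvg_pair; last exact: cvg_cst.
      by rewrite -(mulVg (al c x)); apply: cvgMg => //; exact: cvgVg.
    exact: (c3 _ (KK_small e0)).
  exists n, (fun i => (b i, n1)) => a; have [i lin hi] := hb a.1; exists i => //.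
  apply: le_trans hi; have [_ E1] := hga (b i); have [_ E2] := hga a.1.
  have -> : val ((thE (b i, n1) w)^-1 * thE a w)%g =
      ((th (b i) x)^-1 * th a.1 x, (val w).2^-1 * (val w).2)%g by [].
  by rewrite mulVg E1 E2.
have cocptE (p : E) : exists a, exists2 y, DE y & p = (dE a * thE a y)%g.
  have [a [y Dy xE]] := cocpt (val p).1.
  have hy : ext_set (y, Phi y) := cong_refl HG (Phi y) jk'.
  have hn : N j ((phi a)^-1 * (val p).2 * (Phi y)^-1)%g.
    have [N1 NM NV NJ] := malcev_normal HG jk'.
    have := NJ _ (Phi y)^-1%g (sgtypeP p : cg _ _); rewrite xE ePhi.
    by rewrite conjgE invgK invgM !mulgA mulgV mul1g.
  exists (a, exist _ _ hn), (mksg (hy : sgset ext_subgroup _)) => //.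
  apply/val_inj => /=; rewrite -[LHS]/(val p) [LHS]pairE [in LHS]xE.
  by congr (_, _); rewrite /= !mulgA mulgV mul1g mulgVK.
have [cS hS] := nilS; have [cG hG] := nilG.
pose c := maxn cS cG.
have LS : @lower_central S c = [set 1%g] by apply: lower_central_trivial hS _; rewrite leq_maxl.
have LG : @lower_central G c = [set 1%g] by apply: lower_central_trivial hG _; rewrite leq_maxr.
(* Commutators in the fibre product are formed in both factors, so the two lower central series,
   brought to a common length and read backwards, give the required chain. *)
pose Z i : set E := [set p | @lower_central S (c - i) (val p).1 /\
  @lower_central G (c - i) (val p).2].
have := @equivariant_hom R E Ie dE thE ivE cpE thEM thEK thEVK thEC (fun p => KK (val p))
  Mo DE MD hMo hMD0 hMD Ktb cocptE (fun a => chi j (proj1_sig a.2)) Z c be.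
apply.
- move=> a p; rewrite /affact /be.
  have -> : val (dE a * thE a p)%g = (d a.1 * th a.1 (val p).1,
    phi a.1 * proj1_sig a.2 * (val p).2)%g by [].
  rewrite /= ePhi invgM.
  have [N1 NM NV NJ] := malcev_normal HG jk'.
  have Nn := proj2_sig a.2; set n := proj1_sig a.2.
  have -> : ((Phi (val p).1)^-1 * (phi a.1)^-1 * (phi a.1 * n * (val p).2) =
    ((Phi (val p).1)^-1 * (val p).2) * (n ^ (val p).2))%g.
    by rewrite conjgE !mulgA mulgVK mulgK.
  rewrite (malcev_chiM HG jk) ?(malcev_chiJ HG) //; last exact: NJ.
  exact: (sgtypeP p).
- by move=> y x; have [q Qq ->] := be_translation x y; rewrite subr0; exact: kap_le.
- by exists (a0, n1).
- rewrite /Z subn0 LS LG; apply/seteqP; split=> [p [p1 p2]|_ -> //].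
  by apply/val_inj; rewrite [LHS]pairE p1 p2.
- by rewrite /Z subnn; apply/seteqP.
- move=> i; have s1 := @lower_central_subgroup S (c - i).
  have s2 := @lower_central_subgroup G (c - i); split.
  + by split; exact: is_subgroup1.
  + by move=> v w [? ?] [? ?]; split; exact: is_subgroupM.
  + by move=> w [? ?]; split; exact: is_subgroupV.
  + by move=> a w [? ?]; split=> //; exact: lower_central_morph.
- move=> i w x [w1 w2]; have [ic|ci] := ltnP i c; last first.
    by rewrite /Z /=; have -> : (c - i = 0)%N by apply/eqP; rewrite subn_eq0.
  rewrite /Z /= -subSS subSn //; split; exact: lower_central_comm.
Qed.

(** Correcting along [e j] moves the graph of [Phi] into the kernel of [B]. As [B] is [chi j] on
    [N j], two elements of the kernel over the same point of [S] agree modulo [N j.+1], which yields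
    multiplicativity there. *)
Lemma quasi_hom_step : exists Phi', quasi_hom j.+1 Phi'.
Proof.
have [B [BM BK BE]] := ext_hom_exists.
have [N1 NM NV NJ] := malcev_normal HG jk'.
have gr x : ext_set (x, Phi x) := cong_refl HG (Phi x) jk'.
pose gE x : E := mksg (gr x : sgset ext_subgroup _).
pose b x := B (gE x).
have B1 : B 1%g = 0 by apply: (addrI (B 1%g)); rewrite -BM mulg1 addr0.
have BV p : B (p^-1)%g = - B p.
  by apply: (addrI (B p)); rewrite -BM mulgV B1 subrr.
have nset n : N j n -> ext_set (1%g, n).
  by move=> Nn; apply: (cong_trans HG jk' (cong_sym HG jk' Phi1)); rewrite /cong invg1 mul1g.
have Bn n (Nn : N j n) : B (mksg (nset n Nn : sgset ext_subgroup _)) = chi j n.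
  have [a0 da0 ha0] := act_id; have phi0 : phi a0 = 1%g.
    by apply: (@mulIg _ (Phi 1%g)); rewrite mul1g -ePhi da0 ha0 mul1g.
  have := BE (a0, exist _ n Nn) 1%g; rewrite B1 add0r => <-; congr B.
  by apply/val_inj => /=; rewrite da0 ha0 phi0 /= !mulg1 !mul1g.
pose Phi' x := (Phi x * e j (- b x))%g.
have PP x : cg (Phi x) (Phi' x).
  by rewrite /cg /cong /Phi' mulKg; apply: (malcev_eN HG).
pose gE' x : E := mksg (PP x : sgset ext_subgroup (x, Phi' x)).
have B0 x : B (gE' x) = 0.
  have -> : gE' x = (gE x * mksg (nset _ (malcev_eN HG (- b x) jk) : sgset ext_subgroup _))%g.
    have E0 : (x * 1, Phi x * e j (- b x))%g = (x, Phi' x) by rewrite mulg1.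
    by apply/val_inj; exact: (esym E0).
  by rewrite BM Bn (malcev_chie HG) // subrr.
exists Phi'; split.
- move=> x; apply: cvgMg; first exact: cPhi.
  (* [b y - b x] is the value of [B] at a point that tends to 1, and the displacement bound is small
     there. *)
  suff cb : b @ x --> b x.
    have h : (fun y => - b y) @ x --> - b x by exact: cvgN.
    have h5 := malcev_e_cont HG jk; refine (cvg_at_comp h (h5 _)).
  apply/cvgrPdist_le => eps e0.
  have c1 : (fun y => (x^-1 * y, (Phi x)^-1 * Phi y)%g) @ x --> ((1%g, 1%g) : S * G).
    rewrite -{1}(mulVg x) -(mulVg (Phi x)).
    have c2 : (fun y => Phi y) @ x --> Phi x by exact: cPhi.
    exact (cvg_pair_at (cvgMg (cvg_cst (x^-1)%g) (@cvg_id_at _ x))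
      (cvgMg (cvg_cst ((Phi x)^-1)%g) c2)).
  have h0 : nbhs x [set y | KK (x^-1 * y, (Phi x)^-1 * Phi y)%g <= eps].
    exact: c1 (KK_small e0).
  apply: (@filterS _ _ _ _ _ _ h0) => y /= hy.
  apply: le_trans hy; rewrite distrC.
  have -> : b y - b x = B ((gE x)^-1 * gE y)%g by rewrite BM BV addrC.
  exact: BK.
- move=> a x; rewrite /Phi' ePhi mulgA; congr (_ * e j (- _))%g.
  have := BE (a, n1) (gE x); rewrite /= (malcev_chi1 HG jk) addr0 -[b x]/(B (gE x)) => <-; congr B.
  by apply/val_inj => /=; rewrite ePhi mulg1.
- move=> x y; set m := ((Phi' (x * y))^-1 * (Phi' x * Phi' y))%g.
  have Nm : N j m.
    apply: (cong_trans HG jk' (cong_sym HG jk' (PP _))).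
    apply: (cong_trans HG jk' (hPhi _ _)).
    by apply: (congM HG jk'); exact: PP.
  apply/(malcev_ker HG _ jk); split=> //.
  have : (gE' (x * y) * mksg (nset m Nm : sgset ext_subgroup _) = gE' x * gE' y)%g.
    have E0 : (x * y * 1, Phi' (x * y) * m)%g = (x * y, Phi' x * Phi' y)%g.
      by rewrite mulg1 /m mulVKg.
    by apply/val_inj; exact: E0.
  by move=> /(congr1 B); rewrite !BM !B0 add0r Bn addr0.
Qed.

End Step.

Theorem extend_hom (f : S -> G) : continuous f ->
  (forall a x, f (d a * th a x)%g = (phi a * f x)%g) ->
  exists Phi : S -> G, [/\ continuous Phi,
    forall a x, Phi (d a * th a x)%g = (phi a * Phi x)%g &
    {morph Phi : x y / (x * y)%g}].
Proof.
move=> cf ef; suff [Phi [c1 e1 h1]] : exists Phi, quasi_hom k Phi.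
  by exists Phi; split => // x y; apply: (cong_bot HG); exact: h1.
have: (k <= k)%N by []; elim: {1 3}k => [_|i ih ik]; last first.
  by have [Phi qP] := ih (ltnW ik); exact: quasi_hom_step qP.
by exists f; split => // x y; rewrite /cong (malcev_top HG).
Qed.

End Extension.

(** * Local coordinates of a Lie group *)

Section RowNorm.
Context {R : realType} {n : nat}.
Implicit Types (v w : 'rV[R]_n).

Lemma row_coord_le v (j : 'I_n) : `|v 0 j| <= `|v|.
Proof. by rewrite [leRHS]/Num.norm /= mx_normrE; apply: (le_bigmax _ (fun ij => `|v ij.1 ij.2|) (0, j)). Qed.

Lemma row_norm_le v (r : R) : 0 <= r -> (forall j, `|v 0 j| <= r) -> `|v| <= r.
Proof.
move=> r0 h; rewrite [leLHS]/Num.norm /= mx_normrE; apply: bigmax_le => // -[i j] _ /=.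
by rewrite ord1.
Qed.

Lemma row_norm_lt v (r : R) : 0 < r -> (forall j, `|v 0 j| < r) -> `|v| < r.
Proof.
by move=> r0 h; rewrite [ltLHS]/Num.norm /= mx_normrE; apply: bigmax_lt => // -[i j] _ /=; rewrite ord1.
Qed.

End RowNorm.

(** * Lipschitz and mixed-difference estimates *)

Section PartialLipschitz.
Context {R : realType}.

Lemma is_derive_line {V : normedModType R} (F : V -> R) (w e : V) (t : R) :
  derivable F (w + t *: e) e ->
  is_derive t 1 (fun s : R => F (w + s *: e)) ('D_e F (w + t *: e)).
Proof.
move=> dF.
have E : (fun h : R => h^-1 *: (((fun s : R => F (w + s *: e)) \o shift t) (h *: 1)
    - F (w + t *: e))) =
    (fun h : R => h^-1 *: ((F \o shift (w + t *: e)) (h *: e) - F (w + t *: e))).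
  apply/funext => h; congr (_ *: (F _ - _)).
  by rewrite /= /shift /= [h *: 1]mulr1 scalerDl addrCA addrA addrC addrA addrC.
by split; rewrite /derivable /derive E.
Qed.

(** Coordinates are changed one at a time, which does not leave a ball of the maximum norm; each
    change is an application of the mean value theorem. *)
Lemma partial_lipschitz {N : nat} (F : 'rV[R]_N -> R) (w0 : 'rV[R]_N) (rad M : R) :
  0 < rad ->
  (forall w, `|w - w0| < rad -> forall i,
    derivable F w (delta_mx 0 i) /\ `|'D_(delta_mx 0 i) F w| <= M) ->
  forall w w', `|w - w0| < rad -> `|w' - w0| < rad ->
    `|F w - F w'| <= N%:R * M * `|w - w'|.
Proof.
move=> rad0 hF w w' hw hw'.
have line (v : 'rV[R]_N) (i : 'I_N) (b : R) : 0 <= b ->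
    (forall t, 0 <= t <= b -> `|v + t *: delta_mx 0 i - w0| < rad) ->
    `|F (v + b *: delta_mx 0 i) - F v| <= M * b.
  move=> b0 hv; pose g (t : R) := F (v + t *: delta_mx 0 i).
  have dg t : 0 <= t <= b -> is_derive t 1 g ('D_(delta_mx 0 i) F (v + t *: delta_mx 0 i)).
    by move=> tb; apply: is_derive_line; have [] := hF _ (hv _ tb) i.
  have cg : {within `[0, b], continuous g}.
    apply: derivable_within_continuous => t; rewrite in_itv /= => tb.
    by have [] := dg t tb.
  have [|c] := @MVT_segment R g (fun t => 'D_(delta_mx 0 i) F (v + t *: delta_mx 0 i)) 0 b b0 _ cg.
    by move=> t; rewrite in_itv /= => /andP[t0 tb]; apply: dg; rewrite !ltW.
  rewrite in_itv /= => cb; rewrite /g scale0r addr0 subr0 => ->.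
  rewrite normrM (ger0_norm b0); apply: ler_wpM2r => //.
  by have [_ ->] := hF _ (hv _ cb) i.
pose W k : 'rV[R]_N := \row_j (if (j < k)%N then w 0 j else w' 0 j).
have WN : W N = w by apply/rowP => j; rewrite !mxE ltn_ord.
have W0 : W 0%N = w' by apply/rowP => j; rewrite !mxE.
have M0 (i : 'I_N) : 0 <= M by have [_] := hF _ hw i; apply: le_trans.
have step k : (k < N)%N -> `|F (W k.+1) - F (W k)| <= M * `|w - w'|.
  move=> kN; pose i := Ordinal kN.
  pose v (s : R) : 'rV[R]_N := \row_j (if (j < k)%N then w 0 j else
     if j == i then s else w' 0 j).
  have vE s t : v s + t *: delta_mx 0 i = v (s + t).
    apply/rowP => j; rewrite !mxE ?eqxx /=.
    have [->|ji] := eqVneq j i; first by rewrite ltnn mulr1.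
    by rewrite mulr0 addr0; case: ifP.
  have vw : v (w 0 i) = W k.+1.
    apply/rowP => j; rewrite !mxE ltnS [(j <= k)%N]leq_eqVlt.
    have [->|ji] := eqVneq j i; first by rewrite /= ?eqxx ltnn.
    have -> : (j == k :> nat) = false by apply/negbTE; apply: contra_neq ji => jk; exact/val_inj.
    by [].
  have vw' : v (w' 0 i) = W k.
    apply/rowP => j; rewrite !mxE.
    by case: ifP => // _; case: eqP => // ->.
  have vin s : `|s - w0 0 i| < rad -> `|v s - w0| < rad.
    move=> hs; apply: row_norm_lt => // j; rewrite !mxE.
    case: ifP => _.
      by have := row_coord_le (w - w0) j; rewrite !mxE => /le_lt_trans; apply.
    case: eqP => [->//|_].
    by have := row_coord_le (w' - w0) j; rewrite !mxE => /le_lt_trans; apply.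
  have hwi : `|w 0 i - w0 0 i| < rad.
    by have := row_coord_le (w - w0) i; rewrite !mxE => /le_lt_trans; apply.
  have hwi' : `|w' 0 i - w0 0 i| < rad.
    by have := row_coord_le (w' - w0) i; rewrite !mxE => /le_lt_trans; apply.
  have hbd : M * `|w 0 i - w' 0 i| <= M * `|w - w'|.
    apply: ler_wpM2l (M0 i) _ _ _.
    by have := row_coord_le (w - w') i; rewrite !mxE.
  rewrite -vw -vw'; apply: le_trans _ hbd.
  have between (s s' t : R) : `|s - w0 0 i| < rad -> `|s' - w0 0 i| < rad -> s <= s' ->
      0 <= t <= s' - s -> `|s + t - w0 0 i| < rad.
    clear M0; rewrite !ltr_norml => /andP[? ?] /andP[? ?] ? /andP[? ?]; apply/andP; split; lra.
  have [le|/ltW le] := leP (w' 0 i) (w 0 i).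
    have E : `|w 0 i - w' 0 i| = w 0 i - w' 0 i by rewrite ger0_norm ?subr_ge0.
    rewrite E; have h := line (v (w' 0 i)) i (w 0 i - w' 0 i).
    rewrite vE subrKC in h; apply: h; first by rewrite subr_ge0.
    by move=> t tb; rewrite vE; apply: vin; exact: between hwi' hwi le tb.
  have E : `|w 0 i - w' 0 i| = w' 0 i - w 0 i by rewrite distrC ger0_norm ?subr_ge0.
  rewrite E; have h := line (v (w 0 i)) i (w' 0 i - w 0 i).
  rewrite vE subrKC in h; rewrite distrC; apply: h; first by rewrite subr_ge0.
  by move=> t tb; rewrite vE; apply: vin; exact: between hwi hwi' le tb.
rewrite -WN -W0 -[F (W N) - F (W 0%N)](@telescope_sumr _ 0 N (fun k => F (W k))) //.
apply: le_trans (ler_norm_sum _ _ _) _; rewrite WN W0.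
apply: (@le_trans _ _ (\sum_(0 <= k < N) M * `|w - w'|)).
  rewrite !big_nat; apply: ler_sum => k /andP[_ kN]; exact: step.
by rewrite sumr_const_nat subn0 -mulrnAl -mulr_natl.
Qed.

End PartialLipschitz.

Section MixedEstimate.
Context {R : realType} {n : nat}.

Lemma row_mx_norm_lt (u v u0 v0 : 'rV[R]_n) (r : R) : `|u - u0| < r -> `|v - v0| < r ->
  `|row_mx u v - row_mx u0 v0| < r.
Proof.
move=> hu hv; have r0 : 0 < r by apply: le_lt_trans hu; exact: normr_ge0.
rewrite opp_row_mx add_row_mx; apply: row_norm_lt => // j; rewrite mxE.
by case: splitP => k _; apply: le_lt_trans (row_coord_le _ k) _.
Qed.

Lemma row_mx_norm_r (u v v' : 'rV[R]_n) : `|row_mx u v - row_mx u v'| <= `|v - v'|.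
Proof.
rewrite opp_row_mx add_row_mx subrr; apply: row_norm_le => // j; rewrite mxE.
by case: splitP => k _; [rewrite mxE normr0 | exact: row_coord_le].
Qed.

Lemma row_mx_delta (u v : 'rV[R]_n) (h : R) i :
  row_mx (h *: delta_mx 0 i + u) v = h *: delta_mx 0 (lshift n i) + row_mx u v.
Proof.
have -> : delta_mx 0 (lshift n i) = row_mx (delta_mx 0 i) 0 :> 'rV[R]_(n + n).
  apply/rowP => j; rewrite !mxE eqxx /=; case: splitP => k jk; rewrite !mxE ?eqxx /=.
    by congr (_%:R); rewrite -val_eqE /= jk.
  by rewrite -val_eqE /= jk; case: eqP => // ik; have := ltn_ord i; rewrite -ik ltnNge leq_addr.
by rewrite scale_row_mx scaler0 add_row_mx add0r.
Qed.

Lemma is_derive_row_mx (F : 'rV[R]_(n + n) -> R) u v i :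
  derivable F (row_mx u v) (delta_mx 0 (lshift n i)) ->
  is_derive u (delta_mx 0 i) (fun u => F (row_mx u v))
    ('D_(delta_mx 0 (lshift n i)) F (row_mx u v)).
Proof.
move=> dF.
have E : (fun h : R => h^-1 *: (((fun u => F (row_mx u v)) \o shift u) (h *: delta_mx 0 i)
    - F (row_mx u v))) = (fun h : R => h^-1 *:
      ((F \o shift (row_mx u v)) (h *: delta_mx 0 (lshift n i)) - F (row_mx u v))).
  by apply/funext => h; rewrite /= /shift /= row_mx_delta.
by split; rewrite /derivable /derive E.
Qed.

Lemma le_double_sum {N : nat} (f : 'I_N -> 'I_N -> R) i l : (forall i l, 0 <= f i l) ->
  f i l <= \sum_i \sum_l f i l.
Proof.
move=> f0; rewrite (bigD1 i) //= (bigD1 l) //= -addrA lerDl addr_ge0 ?sumr_ge0 // => i' _.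
by rewrite sumr_ge0.
Qed.

(** The Lipschitz bound is used twice: for the partial derivatives of [F], giving the factor in [v],
    and then for the function [H] of [u] alone, giving the factor in [u]. *)
Lemma second_difference (F : 'rV[R]_(n + n) -> R) (U : set 'rV[R]_(n + n)) (u0 v0 : 'rV[R]_n) :
  nbhs (row_mx u0 v0) U -> Ck_on 2 U F ->
  exists r M : R, [/\ 0 < r, 0 <= M & forall u u' v v',
    `|u - u0| < r -> `|u' - u0| < r -> `|v - v0| < r -> `|v' - v0| < r ->
    `|F (row_mx u v) - F (row_mx u' v) - (F (row_mx u v') - F (row_mx u' v'))| <=
      M * `|u - u'| * `|v - v'|].
Proof.
set w0 := row_mx u0 v0 => nU [_ F1].
have Uw0 : U w0 by exact: nbhs_singleton nU.
pose D i := 'D_(delta_mx 0 i) F; pose D2 i l := 'D_(delta_mx 0 l) (D i).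
have [B [B0 hB]] : exists B : R, 0 <= B /\
    \forall w \near w0, forall i l, `|D2 i l w| <= B.
  pose B := \sum_i \sum_l (`|D2 i l w0| + 1); exists B; split.
    by apply: sumr_ge0 => i _; apply: sumr_ge0 => l _; rewrite addr_ge0.
  have h i l : \forall w \near w0, `|D2 i l w| <= B.
    have [_ [_ F2]] := F1 i; have [_ [cD _]] := F2 l.
    have h : \forall w \near w0, `|D2 i l w| <= `|D2 i l w0| + 1.
      by apply: (@cvgr_norm_le _ _ _ _ _ _ _ (cD _ Uw0)); rewrite ltrDl.
    apply: (@filterS _ _ _ _ _ _ h) => w /le_trans; apply.
    exact (@le_double_sum (n + n) (fun i l => `|D2 i l w0| + 1) i l
      (fun i' l' => addr_ge0 (normr_ge0 _) ler01)).
  have h1 i : \forall w \near w0, forall l, `|D2 i l w| <= B.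
    exact: (@filter_forall _ _ (fun l w => `|D2 i l w| <= B) _ _ (h i)).
  exact: (@filter_forall _ _ (fun i w => forall l, `|D2 i l w| <= B) _ _ h1).
have [r r0 hr] : exists2 r : R, 0 < r & forall w, `|w - w0| < r ->
    U w /\ forall i l, `|D2 i l w| <= B.
  have [r r0 hr] := (nbhs_ballP w0 _).1 (filterI nU hB); exists r => // w ww.
  by apply: hr; rewrite -ball_normE /= distrC.
have lipD i : forall w w', `|w - w0| < r -> `|w' - w0| < r ->
    `|D i w - D i w'| <= (n + n)%:R * B * `|w - w'|.
  apply: partial_lipschitz r0 _ => w ww l; have [Uw hw] := hr _ ww; split; last exact: hw.
  by have [_ [_ F2]] := F1 i; have [/(_ w Uw) ? _] := F2 l.
exists r, (n%:R * ((n + n)%:R * B)); split=> // [|u u' v v' hu hu' hv hv'].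
  by rewrite !mulr_ge0.
pose H u := F (row_mx u v) - F (row_mx u v').
apply: (@le_trans _ _ (n%:R * ((n + n)%:R * B * `|v - v'|) * `|u - u'|)).
  have -> : F (row_mx u v) - F (row_mx u' v) - (F (row_mx u v') - F (row_mx u' v')) =
    H u - H u' by rewrite /H; ring.
  apply: partial_lipschitz r0 _ _ _ hu hu' => z hz i.
  have [Uz _] := hr _ (row_mx_norm_lt hz hv); have [Uz' _] := hr _ (row_mx_norm_lt hz hv').
  have [dF _] := F1 (lshift n i).
  have d1 := is_derive_row_mx (dF _ Uz); have d2 := is_derive_row_mx (dF _ Uz').
  have [d3 ->] := is_deriveB d1 d2; split => //.
  apply: le_trans (lipD _ _ _ (row_mx_norm_lt hz hv) (row_mx_norm_lt hz hv')) _.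
  by apply: ler_wpM2l; [rewrite mulr_ge0 | exact: row_mx_norm_r].
by rewrite le_eqVlt; apply/orP; left; apply/eqP; ring.
Qed.

End MixedEstimate.

(** * Coordinates near the identity *)

Section LocalGroup.
Context {R : realType} {n : nat} {G : topGroupType}.

(** [lc_est] says that multiplication is addition up to a mixed second-order term; the estimates for
    powers rest on it. *)
Record local_coords (psi : 'rV[R]_n -> G) (kap : G -> 'rV[R]_n) (r M : R) : Prop :=
    LocalCoords {
  lc_r0 : 0 < r ;
  lc_M0 : 0 <= M ;
  lc_psi0 : psi 0 = 1%g ;
  lc_psi_cont : forall u, `|u| < r -> {for u, continuous psi} ;
  lc_kap_cont : {for 1%g, continuous kap} ;
  lc_kapK : \forall x \near 1%g, psi (kap x) = x ;
  lc_psiK : forall u, `|u| < r -> kap (psi u) = u ;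
  lc_mul : forall u v, `|u| < r -> `|v| < r ->
    psi (kap (psi u * psi v)%g) = (psi u * psi v)%g ;
  lc_est : forall u u' v v', `|u| < r -> `|u'| < r -> `|v| < r -> `|v'| < r ->
    `|kap (psi u * psi v)%g - kap (psi u' * psi v')%g - (u - u') - (v - v')| <=
      M * (`|u - u'| * `|v| + `|u'| * `|v - v'|) }.

Lemma within_open_at {T U : topologicalType} (A : set T) (f : T -> U) x :
  open A -> {within A, continuous f} -> A x -> {for x, continuous f}.
Proof. by move=> oA; rewrite continuous_open_subspace // => h Ax; apply: h; rewrite inE. Qed.

Lemma lie_local_coords : lie_group R n G -> exists psi kap r M, local_coords psi kap r M.
Proof.
move=> [hG _ [At [[chA cov _] smul _]]].
have [a Aa a1] : (\bigcup_(c in At) chart_dom c) (1%g : G) by rewrite cov.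
have [oD oI mK cm ci] := chA a Aa.
pose c0 := chart_map a 1%g; pose iv := chart_inv a; pose mp := chart_map a.
have iv0 : iv c0 = 1%g by apply: mK; rewrite inE.
have Ic0 : chart_img a c0 by exists 1%g.
have ivK u : chart_img a u -> mp (iv u) = u.
  by move=> [x Dx <-]; rewrite /iv /mp mK // inE.
have ivD u : chart_img a u -> chart_dom a (iv u).
  by move=> [x Dx <-]; rewrite /iv mK // inE.
have civ u : chart_img a u -> {for u, continuous iv} by exact: within_open_at.
pose U := [set w : 'rV[R]_(n + n) | [/\ chart_img a (lsubmx w), chart_img a (rsubmx w) &
  chart_dom a (chart_inv a (lsubmx w) * chart_inv a (rsubmx w))%g]].
pose Fm (w : 'rV[R]_(n + n)) := mp (iv (lsubmx w) * iv (rsubmx w))%g.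
have sm : smooth_on U Fm := smul a a a Aa Aa Aa.
pose w0 := row_mx c0 c0.
have cl : (lsubmx : 'rV[R]_(n + n) -> 'rV[R]_n) @ w0 --> c0.
  have E : lsubmx w0 = c0 by exact: row_mxKl.
  by rewrite -[X in _ --> X]E; exact: continuous_lsubmx.
have cr : (rsubmx : 'rV[R]_(n + n) -> 'rV[R]_n) @ w0 --> c0.
  have E : rsubmx w0 = c0 by exact: row_mxKr.
  by rewrite -[X in _ --> X]E; exact: continuous_rsubmx.
have nU : nbhs w0 U.
  have nI : nbhs c0 (chart_img a) by apply: open_nbhs_nbhs.
  have nD : nbhs (1%g : G) (chart_dom a) by apply: open_nbhs_nbhs.
  have cmul : (fun w => iv (lsubmx w) * iv (rsubmx w))%g @ w0 --> (1%g : G).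
    rewrite -iv0.
    have c1 : (fun w : 'rV[R]_(n + n) => iv (lsubmx w)) @ w0 --> iv c0.
      refine (cvg_at_comp cl (civ _ Ic0)).
    have c2 : (fun w : 'rV[R]_(n + n) => iv (rsubmx w)) @ w0 --> iv c0.
      refine (cvg_at_comp cr (civ _ Ic0)).
    have E : iv c0 = (iv c0 * iv c0)%g by rewrite iv0 mulg1.
    by rewrite [X in _ --> X]E; exact (cvgMg c1 c2).
  have h1 : nbhs w0 (fun w => chart_img a (lsubmx w)) := cl _ nI.
  have h2 : nbhs w0 (fun w => chart_img a (rsubmx w)) := cr _ nI.
  have h3 : nbhs w0 (fun w => chart_dom a (iv (lsubmx w) * iv (rsubmx w))%g) := cmul _ nD.
  by apply: filterS (filterI (filterI h1 h2) h3) => w [[]].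
have hj (j : 'I_n) : exists rM : R * R, [/\ 0 < rM.1, 0 <= rM.2 & forall u u' v v',
    `|u - c0| < rM.1 -> `|u' - c0| < rM.1 -> `|v - c0| < rM.1 -> `|v' - c0| < rM.1 ->
    `|Fm (row_mx u v) 0 j - Fm (row_mx u' v) 0 j - (Fm (row_mx u v') 0 j - Fm (row_mx u' v') 0 j)| <=
      rM.2 * `|u - u'| * `|v - v'|].
  by have [r [M h]] := second_difference nU (sm 2%N j); exists (r, M).
have [rM hrM] := choice hj.
have nball (r : R) (A : set 'rV[R]_(n + n)) : nbhs w0 A -> exists2 r : R, 0 < r &
    forall u v, `|u| < r -> `|v| < r -> A (row_mx (c0 + u) (c0 + v)).
  move=> nA; have [e e0 he] := (nbhs_ballP w0 A).1 nA; exists e => // u v hu hv; apply: he.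
  rewrite -ball_normE /= distrC; apply: row_mx_norm_lt; by rewrite addrAC subrr add0r.
have [r1 r10 hr1] := nball 0 U nU.
pose r2 := \big[Num.min/r1]_j (rM j).1.
have r20 : 0 < r2 by rewrite /r2; apply: lt_bigmin => // j _; have [] := hrM j.
have r2r1 : r2 <= r1 by exact: bigmin_le_id.
have r2j j : r2 <= (rM j).1 by exact: bigmin_le_cond.
pose M := \sum_j (rM j).2.
have Mj j : (rM j).2 <= M.
  by rewrite /M (bigD1 j) //= lerDl sumr_ge0 // => i _; have [] := hrM i.
have M0 : 0 <= M by apply: sumr_ge0 => i _; have [] := hrM i.
pose psi u := iv (c0 + u); pose kap x := mp x - c0.
have FmE u v : Fm (row_mx (c0 + u) (c0 + v)) = mp (psi u * psi v)%g.
  by rewrite /Fm row_mxKl row_mxKr.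
have psi0 : psi 0 = 1%g by rewrite /psi addr0.
have Iu u : `|u| < r2 -> chart_img a (c0 + u).
  move=> hu; have [|] := hr1 u 0 (lt_le_trans hu r2r1); first by rewrite normr0.
  by rewrite row_mxKl.
have kpsi u : `|u| < r2 -> kap (psi u) = u.
  move=> hu; have h := ivK _ (Iu _ hu).
  by rewrite /kap /psi h addrAC subrr add0r.
have sd u u' v v' : `|u| < r2 -> `|u'| < r2 -> `|v| < r2 -> `|v'| < r2 ->
    `|mp (psi u * psi v)%g - mp (psi u' * psi v)%g -
      (mp (psi u * psi v')%g - mp (psi u' * psi v')%g)| <= M * `|u - u'| * `|v - v'|.
  move=> hu hu' hv hv'; apply: row_norm_le; first by rewrite !mulr_ge0.
  move=> j; rewrite -!FmE !mxE; have [_ _ h] := hrM j.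
  have ad w : `|w| < r2 -> `|c0 + w - c0| < (rM j).1.
    by move=> hw; rewrite addrAC subrr add0r; exact: lt_le_trans (r2j j).
  apply: le_trans (h _ _ _ _ (ad _ hu) (ad _ hu') (ad _ hv) (ad _ hv')) _.
  have E (x y : 'rV[R]_n) : c0 + x - (c0 + y) = x - y by rewrite opprD addrACA subrr add0r.
  by rewrite !E; do 2 apply: ler_wpM2r => //.
exists psi, kap, r2, M; split; [exact: r20|exact: M0|exact: psi0| | | |exact: kpsi| |].
- move=> u hu; have h : (fun w => c0 + w) @ u --> c0 + u.
    exact (cvgD (cvg_cst c0) (@cvg_id_at _ u)).
  refine (cvg_at_comp h (civ _ (Iu _ hu))).
- have h := within_open_at oD cm a1.
  exact (cvgB h (cvg_cst c0)).
- have : nbhs (1%g : G) (chart_dom a) by apply: open_nbhs_nbhs.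
  by apply: filterS => x Dx; rewrite /psi /kap addrC subrK; apply: mK; rewrite inE.
- move=> u v hu hv; rewrite /psi /kap subrKC; apply: mK; rewrite inE.
  have [_ _] := hr1 u v (lt_le_trans hu r2r1) (lt_le_trans hv r2r1).
  by rewrite row_mxKl row_mxKr.
- move=> u u' v v' hu hu' hv hv'.
  have h0 : `|0 : 'rV[R]_n| < r2 by rewrite normr0.
  have s1 := sd u u' v 0 hu hu' hv h0.
  have s2 := sd u' 0 v v' hu' h0 hv hv'.
  move: s1 s2; rewrite psi0 !mulg1 !mul1g !subr0 => s1 s2.
  have E x : `|x| < r2 -> mp (psi x) = x + c0.
    by move=> hx; have h := kpsi _ hx; rewrite -{2}h /kap subrK.
  (* The deviation from addition splits into two mixed differences, one with 0 in the second slot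
     and one with 0 in the first, where the coordinates of the product are exact. *)
  have -> : kap (psi u * psi v)%g - kap (psi u' * psi v')%g - (u - u') - (v - v') =
      (mp (psi u * psi v)%g - mp (psi u' * psi v)%g - (mp (psi u) - mp (psi u'))) +
      (mp (psi u' * psi v)%g - mp (psi v) - (mp (psi u' * psi v')%g - mp (psi v'))).
    rewrite !E // /kap; apply/rowP => j; rewrite !mxE; ring.
  apply: le_trans (ler_normD _ _) _; rewrite mulrDr !mulrA.
  exact: lerD.
Qed.

End LocalGroup.

(** * The exponential map *)

Section Squeeze.
Context {R : realType}.

Lemma cvg_norm_bound {V : normedModType R} {T : Type} {F : set_system T} {FF : Filter F}
    (f : T -> V) (l : V) (g : T -> R) :
  (\forall x \near F, `|f x - l| <= g x) -> g @ F --> 0 -> f @ F --> l.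
Proof.
move=> hfg hg; apply/cvgrPdist_lt => e e0.
have h : \forall x \near F, `|g x| < e.
  by apply: (@cvgr_norm_lt _ _ _ _ _ _ _ hg); rewrite normr0.
apply: (@filterS _ _ _ _ _ _ (filterI hfg h)) => x [/= h1 h2].
by rewrite distrC; apply: le_lt_trans h1 _; exact: le_lt_trans (ler_norm _) h2.
Qed.

Lemma cvg_eq_near {T : Type} {U : topologicalType} {F : set_system T} {FF : Filter F}
    (f g : T -> U) (l : U) :
  (\forall x \near F, f x = g x) -> f @ F --> l -> g @ F --> l.
Proof.
move=> h fl A Al; apply: (@filterS _ _ _ _ _ _ (filterI h (fl A Al))) => x [/= <-]; exact: id.
Qed.

Lemma le_harmonic_limit (x a b : R) : (forall k : nat, x <= a + b * k.+1%:R^-1) -> x <= a.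
Proof.
move=> h; have hc : (fun k : nat => a + b * k.+1%:R^-1) @ \oo --> a.
  have h1 : (fun k : nat => b * k.+1%:R^-1) @ \oo --> b * (0 : R).
    by apply: cvgZr; exact: cvg_harmonic.
  have h2 := cvgD (cvg_cst a) h1; rewrite mulr0 addr0 in h2; exact: h2.
by apply: (cvgr_to_ge hc); apply: nearW.
Qed.

Lemma cvg_scale_near {V : normedModType R} (b : nat -> R) (s : R) (v : V) :
  (forall q, `|b q - s| <= q.+1%:R^-1) -> (fun q => b q *: v) @ \oo --> s *: v.
Proof.
move=> h; have hb : b @ \oo --> s.
  apply: (cvg_norm_bound (g := fun q : nat => q.+1%:R^-1)); first exact: nearW.
  exact: cvg_harmonic.
by refine (cvgZr_tmp hb).
Qed.

Lemma cvg_div_harmonic {V : normedModType R} (v : V) :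
  (fun q : nat => q.+1%:R^-1 *: v) @ \oo --> (0 : V).
Proof.
have h : (fun q : nat => q.+1%:R^-1 *: v) @ \oo --> (0 : R) *: v.
  by apply: cvg_scale_near => q; rewrite subr0 ger0_norm // invr_ge0.
by rewrite scale0r in h.
Qed.

Lemma lim_unique {T : topologicalType} {I : Type} {F : set_system I} {FF : ProperFilter F}
    (f : I -> T) (x y : T) : hausdorff_space T -> f @ F --> x -> f @ F --> y -> x = y.
Proof. by move=> hT fx fy; exact: (cvg_unique hT fx fy). Qed.

Definition floorseq (s : R) (q : nat) : nat := Num.truncn (s * q.+1%:R).

Lemma floorseqP (s : R) (q : nat) : 0 <= s ->
  `|q.+1%:R^-1 * (floorseq s q)%:R - s| <= q.+1%:R^-1.
Proof.
move=> s0; have q0 : 0 < q.+1%:R :> R by [].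
have sq0 : 0 <= s * q.+1%:R by rewrite mulr_ge0.
have /andP[h1 h2] := Num.Theory.truncn_itv sq0.
have -> : q.+1%:R^-1 * (floorseq s q)%:R - s = ((floorseq s q)%:R - s * q.+1%:R) / q.+1%:R.
  by field; rewrite gt_eqF.
rewrite normrM (ger0_norm (_ : 0 <= q.+1%:R^-1)); last by rewrite invr_ge0 ltW.
rewrite -[leRHS]mul1r; apply: ler_wpM2r; first by rewrite invr_ge0 ltW.
rewrite -/(floorseq s q) in h1 h2; move: h2; rewrite -natr1 => h2.
by rewrite ler_norml; apply/andP; split; lra.
Qed.

End Squeeze.

(** * Limits of powers near the identity *)

Section LocalExponential.
Context {R : realType} {n : nat} {G : topGroupType}.
Variables (psi : 'rV[R]_n -> G) (kap : G -> 'rV[R]_n) (r M : R).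
Hypothesis hG : hausdorff_space G.
Hypothesis H : local_coords psi kap r M.
Implicit Types (u v w x y : 'rV[R]_n) (m i k : nat).

(** The first bound keeps powers of total length at most [dl] inside the chart; the second makes the
    error factor [2 * M * dl] at most [1 / 8]. *)
Let dl : R := Num.min (r / 8) (16 * (M + 1))^-1.

Let r0 := lc_r0 H.
Let M0 := lc_M0 H.

Let dl0 : 0 < dl.
Proof.
rewrite lt_min; apply/andP; split; first by apply: divr_gt0 => //; exact: r0.
by rewrite invr_gt0 mulr_gt0 // ltr_wpDl //; exact: M0.
Qed.

Let dlr : 8 * dl <= r.
Proof. have : dl <= r / 8 by rewrite ge_min lexx. by lra. Qed.

Let dlM : 16 * (M * dl) <= 1.
Proof.
have h : dl <= (16 * (M + 1))^-1 by rewrite ge_min lexx orbT.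
have h1 : 0 < 16 * (M + 1) by rewrite mulr_gt0 // ltr_wpDl //; exact: M0.
have h2 : dl * (16 * (M + 1)) <= 1 by rewrite -ler_pdivlMr // div1r.
have := dl0; nra.
Qed.

Let pw m u := kap (psi u ^+ m)%g.

Let kap1 : kap 1%g = 0.
Proof. by rewrite -(lc_psi0 H) (lc_psiK H) // normr0. Qed.

(** One more factor adds an error proportional to the length reached so far, and these errors add up
    to a quadratic one. The length bound is the comparison with [u' = 0]. *)
Let pw_main m : forall u u' (rho : R), `|u| <= rho -> `|u'| <= rho -> m%:R * rho <= dl ->
  [/\ psi (pw m u) = (psi u ^+ m)%g, `|pw m u| <= 2 * (m%:R * rho) &
   `|pw m u - pw m u' - m%:R *: (u - u')| <= 2 * M * (m%:R * rho) * (m%:R * `|u - u'|)].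
Proof.
elim: m => [|m ih] u u' rho hu hu' hm.
  rewrite /pw !expg0 kap1 (lc_psi0 H) !mul0r !mulr0 subrr scale0r subr0 normr0.
  by split.
have rho0 : 0 <= rho by apply: le_trans hu.
have m0 : 0 <= m%:R :> R by [].
have hm' : m%:R * rho <= dl.
  by apply: le_trans hm; rewrite ler_wpM2r // ler_nat.
have rr : rho <= dl.
  by apply: le_trans hm; rewrite -natr1 mulrDl mul1r lerDr mulr_ge0.
have [p1 p2 _] := ih u u' rho hu hu' hm'.
have lr x : `|x| <= 2 * dl -> `|x| < r.
  by move=> hx; have := dl0; have := dlr; lra.
have hp : `|pw m u| < r by apply: lr; lra.
have hur : `|u| < r by apply: lr; have := dl0; lra.
have E v : psi (pw m v) = (psi v ^+ m)%g -> pw m.+1 v = kap (psi (pw m v) * psi v)%g.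
  by move=> h; rewrite /pw h expgSr.
have est z : `|z| <= rho -> `|pw m.+1 u - pw m.+1 z - m.+1%:R *: (u - z)| <=
    2 * M * (m.+1%:R * rho) * (m.+1%:R * `|u - z|).
  move=> hz; have [_ _ p3] := ih u z rho hu hz hm'.
  have [q1 q2 _] := ih z u rho hz hu hm'.
  have hq : `|pw m z| < r by apply: lr; lra.
  have hzr : `|z| < r by apply: lr; have := dl0; lra.
  have e := lc_est H hp hq hur hzr; rewrite -!E // in e.
  set De := `|u - z| in p3 e *; have De0 : 0 <= De by exact: normr_ge0.
  have b1 : `|pw m u - pw m z| <= 2 * (m%:R * De).
    have -> : pw m u - pw m z = (pw m u - pw m z - m%:R *: (u - z)) + m%:R *: (u - z).
      by rewrite subrK.
    apply: le_trans (ler_normD _ _) _; rewrite normrZ ger0_norm // -/De.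
    suff : 2 * M * (m%:R * rho) * (m%:R * De) <= m%:R * De by lra.
    rewrite -[leRHS]mul1r; apply: ler_wpM2r; first by rewrite mulr_ge0.
    have : M * (m%:R * rho) <= M * dl by rewrite ler_wpM2l.
    by have := dlM; lra.
  have -> : pw m.+1 u - pw m.+1 z - m.+1%:R *: (u - z) =
      (pw m.+1 u - pw m.+1 z - (pw m u - pw m z) - (u - z)) +
      (pw m u - pw m z - m%:R *: (u - z)).
    by rewrite -natr1 scalerDl scale1r; apply/rowP => j; rewrite !mxE; ring.
  apply: le_trans (ler_normD _ _) _.
  have e' : M * (`|pw m u - pw m z| * `|u| + `|pw m z| * De) <=
      M * (2 * (m%:R * De) * rho + 2 * (m%:R * rho) * De).
    apply: ler_wpM2l => //; apply: lerD; first exact: ler_pM.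
    exact: ler_wpM2r.
  have := le_trans e e'; rewrite -[m.+1%:R]natr1.
  have : 0 <= M * rho * De by rewrite !mulr_ge0.
  have -> : 2 * M * ((m%:R + 1) * rho) * ((m%:R + 1) * De) =
    2 * M * (m%:R * rho) * (m%:R * De) + M * (2 * (m%:R * De) * rho + 2 * (m%:R * rho) * De)
    + 2 * (M * rho * De) by ring.
  lra.
split; first by rewrite E // (lc_mul H) // p1 -expgSr.
  have pz : pw m.+1 0 = 0 by rewrite /pw (lc_psi0 H) expg1n kap1.
  have := est 0; rewrite normr0 pz !subr0 => /(_ rho0) h.
  have -> : pw m.+1 u = (pw m.+1 u - m.+1%:R *: u) + m.+1%:R *: u by rewrite subrK.
  apply: le_trans (ler_normD _ _) _; rewrite normrZ ger0_norm //.
  have mS0 : 0 <= m.+1%:R :> R by [].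
  have h1 : m.+1%:R * `|u| <= m.+1%:R * rho by rewrite ler_wpM2l.
  have h2 : M * (m.+1%:R * rho) <= M * dl by rewrite ler_wpM2l.
  suff : 2 * M * (m.+1%:R * rho) * (m.+1%:R * `|u|) <= m.+1%:R * `|u| by lra.
  rewrite -[leRHS]mul1r; apply: ler_wpM2r; first by rewrite mulr_ge0.
  by have := dlM; lra.
exact: est.
Qed.

Let pwE m u : m%:R * `|u| <= dl -> psi (pw m u) = (psi u ^+ m)%g.
Proof. by move=> h; have [] := pw_main (lexx `|u|) (lexx `|u|) h. Qed.

Let pw0 m : pw m 0 = 0.
Proof. by rewrite /pw (lc_psi0 H) expg1n kap1. Qed.

Let pw_le m u : m%:R * `|u| <= dl ->
  `|pw m u - m%:R *: u| <= 2 * M * (m%:R * `|u|) * (m%:R * `|u|) /\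
  `|pw m u| <= 2 * (m%:R * `|u|).
Proof.
move=> h; have := pw_main (lexx `|u|) _ h; move=> /(_ 0); rewrite normr0 => /(_ (normr_ge0 u)).
by rewrite pw0 !subr0 => -[_ ? ?].
Qed.

(** The [l]-th power of the finer step differs from [v / m] by a quadratic error in [v / m], and
    taking [m]-th powers enlarges a difference by a factor of at most [2 * m]. An error of order
    [1 / m] remains, so the powers form a Cauchy sequence. *)
Let pw_refine m l v : (0 < m)%N -> (0 < l)%N -> 2 * `|v| <= dl ->
  `|pw (m * l) ((m * l)%:R^-1 *: v) - pw m (m%:R^-1 *: v)| <= 4 * M * (`|v| * `|v|) / m%:R.
Proof.
move=> m0 l0 hv; set w := (m * l)%:R^-1 *: v.
have mR : 0 < m%:R :> R by rewrite ltr0n.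
have lR : 0 < l%:R :> R by rewrite ltr0n.
have nw : l%:R * `|w| = `|v| / m%:R.
  by rewrite normrZ normfV ger0_norm // natrM; field; rewrite !gt_eqF.
have vm : `|v| / m%:R <= `|v|.
  by rewrite ler_pdivrMr // ler_peMr // ler1n.
have hl : l%:R * `|w| <= dl by rewrite nw; have := normr_ge0 v; lra.
have -> : pw (m * l) w = pw m (pw l w) by rewrite /pw -/(pw l w) pwE // -expgnA mulnC.
have [h1 h2] := pw_le hl; rewrite nw in h1 h2.
have E : l%:R *: w = m%:R^-1 *: v.
  by rewrite scalerA natrM; congr (_ *: _); field; rewrite !gt_eqF.
rewrite E in h1.
have nv : `|m%:R^-1 *: v| = `|v| / m%:R by rewrite normrZ normfV ger0_norm // mulrC.
pose rho := 2 * (`|v| / m%:R).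
have vm0 : 0 <= `|v| / m%:R by rewrite divr_ge0.
have hr1 : `|m%:R^-1 *: v| <= rho by rewrite nv /rho; lra.
have hr2 : m%:R * rho <= dl.
  by rewrite /rho; have -> : m%:R * (2 * (`|v| / m%:R)) = 2 * `|v| by field; rewrite gt_eqF.
have [_ _ h3] := pw_main h2 hr1 hr2.
have mr : m%:R * rho = 2 * `|v| by rewrite /rho; field; rewrite gt_eqF.
rewrite mr in h3.
set y := pw l w in h1 h2 h3 *; set z := m%:R^-1 *: v in h1 hr1 h3 *.
have -> : pw m y - pw m z = (pw m y - pw m z - m%:R *: (y - z)) + m%:R *: (y - z).
  by rewrite subrK.
apply: le_trans (ler_normD _ _) _; rewrite normrZ ger0_norm //.
have h4 : m%:R * `|y - z| <= 2 * M * (`|v| * `|v|) / m%:R.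
  have := ler_wpM2l (ltW mR) h1.
  by have -> : m%:R * (2 * M * (`|v| / m%:R) * (`|v| / m%:R)) = 2 * M * (`|v| * `|v|) / m%:R
    by field; rewrite gt_eqF.
have h5 : 2 * M * (2 * `|v|) * (m%:R * `|y - z|) <= m%:R * `|y - z|.
  rewrite -[leRHS]mul1r; apply: ler_wpM2r; first by rewrite mulr_ge0 // ltW.
  have : M * (2 * `|v|) <= M * dl by rewrite ler_wpM2l.
  by have := dlM; lra.
have -> : 4 * M * (`|v| * `|v|) / m%:R = 2 * (2 * M * (`|v| * `|v|) / m%:R) by field; rewrite gt_eqF.
lra.
Qed.

Let cc v := 4 * M * (`|v| * `|v|).
Let cc0 v : 0 <= cc v. Proof. by rewrite /cc !mulr_ge0. Qed.

Let seqv v k := pw k.+1 (k.+1%:R^-1 *: v).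

Let seqv_dist v k l : 2 * `|v| <= dl -> `|seqv v k - seqv v l| <= cc v / k.+1%:R + cc v / l.+1%:R.
Proof.
move=> hv; have h1 := @pw_refine k.+1 l.+1 v isT isT hv.
have h2 := @pw_refine l.+1 k.+1 v isT isT hv; rewrite mulnC in h2.
have -> : seqv v k - seqv v l = (pw (k.+1 * l.+1) ((k.+1 * l.+1)%:R^-1 *: v) - seqv v l) -
  (pw (k.+1 * l.+1) ((k.+1 * l.+1)%:R^-1 *: v) - seqv v k).
  by rewrite opprB [RHS]addrC subrKA.
by apply: le_trans (ler_normB _ _) _; rewrite addrC; exact: lerD.
Qed.

Let exp0_exists v : exists e : 'rV[R]_n, 2 * `|v| <= dl ->
  forall k, `|seqv v k - e| <= cc v * k.+1%:R^-1.
Proof.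
have [hv|nhv] := pselect (2 * `|v| <= dl); last by exists 0.
have : cvg (seqv v @ \oo).
  apply: cauchy_cvg; apply: cauchy_exP => e e0.
  have hh : (fun k : nat => cc v * k.+1%:R^-1) @ \oo --> (0 : R).
    have h1 : (fun k : nat => cc v * k.+1%:R^-1) @ \oo --> cc v * (0 : R).
      by apply: cvgZr; exact: cvg_harmonic.
    by rewrite mulr0 in h1.
  have e2 : 0 < e / 2 by rewrite divr_gt0.
  have h : \forall k \near \oo, `|cc v * k.+1%:R^-1| < e / 2.
    by apply: (@cvgr_norm_lt _ _ _ _ _ _ _ hh); rewrite normr0.
  have [k _ hk] := h.
  exists (seqv v k); exists k => // l kl; rewrite -ball_normE /=.
  apply: le_lt_trans (seqv_dist k l hv) _.
  rewrite [ltRHS]splitr; apply: ltrD; first exact: le_lt_trans (ler_norm _) (hk k (leqnn k)).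
  exact: le_lt_trans (ler_norm _) (hk l kl).
move=> /cvg_ex [e he]; exists e => _ k.
apply: (@le_harmonic_limit _ _ _ 0) => q; rewrite mul0r addr0.
have hc : (fun l => `|seqv v k - seqv v l| - cc v * l.+1%:R^-1) @ \oo -->
    `|seqv v k - e| - cc v * (0 : R).
  apply: cvgB; last by apply: cvgZr; exact: cvg_harmonic.
  by apply: cvg_norm; apply: cvgB => //; exact: cvg_cst.
have : `|seqv v k - e| - cc v * (0 : R) <= cc v / k.+1%:R.
  by apply: (cvgr_to_le hc); apply: nearW => l; rewrite lerBlDr; exact: seqv_dist.
by rewrite mulr0 subr0.
Qed.

Let exp0 v := projT1 (cid (exp0_exists v)).

Let exp0P v k : 2 * `|v| <= dl -> `|seqv v k - exp0 v| <= cc v * k.+1%:R^-1.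
Proof. by move=> hv; exact: (projT2 (cid (exp0_exists v)) hv). Qed.

Let exp0_lip u v (rho : R) : `|u| <= rho -> `|v| <= rho -> 2 * rho <= dl ->
  `|exp0 u - exp0 v - (u - v)| <= 2 * M * rho * `|u - v|.
Proof.
move=> hu hv hr; apply: (@le_harmonic_limit _ _ _ (cc u + cc v)) => k.
have k0 : 0 < k.+1%:R :> R by [].
have hu2 : 2 * `|u| <= dl by lra.
have hv2 : 2 * `|v| <= dl by lra.
have h1 := exp0P k hu2; have h2 := exp0P k hv2.
have hn w : `|w| <= rho -> `|k.+1%:R^-1 *: w| <= k.+1%:R^-1 * rho.
  by move=> hw; rewrite normrZ normfV ger0_norm // ler_wpM2l // invr_ge0.
have rho0 : 0 <= rho by apply: le_trans hu.
have E1 : k.+1%:R * (k.+1%:R^-1 * rho) = rho by rewrite mulrA divff ?mul1r // gt_eqF.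
have [|_ _ h3] := pw_main (m := k.+1) (hn u hu) (hn v hv); first by rewrite E1; lra.
rewrite E1 -scalerBr scalerA divff ?gt_eqF // scale1r normrZ mulrA in h3.
rewrite normfV ger0_norm // divff ?gt_eqF // mul1r in h3.
have -> : exp0 u - exp0 v - (u - v) =
   (seqv u k - seqv v k - (u - v)) - (seqv u k - exp0 u) + (seqv v k - exp0 v).
  by apply/rowP => j; rewrite !mxE; ring.
apply: le_trans (ler_normD _ _) _; apply: le_trans (lerD (ler_normB _ _) (lexx _)) _.
rewrite [(cc u + cc v) * _]mulrDl; move: h1 h2 h3; rewrite /seqv.
by set a := cc u * _; set b := cc v * _; lra.
Qed.

Let exp00 : exp0 0 = 0.
Proof.
have h0 : 2 * `|0 : 'rV[R]_n| <= dl by rewrite normr0 mulr0; have := dl0; lra.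
have := exp0P 0%N h0; rewrite /seqv scaler0 pw0 sub0r normrN /cc normr0 !mulr0 mul0r.
by rewrite normr_le0 => /eqP.
Qed.

Let exp0_near v : 2 * `|v| <= dl -> `|exp0 v - v| <= 2 * M * `|v| * `|v|.
Proof.
move=> hv; have := @exp0_lip v 0 `|v| (lexx _) _ hv; rewrite normr0 exp00 !subr0.
by apply.
Qed.

Let exp0_small u v (rho : R) : `|u| <= rho -> `|v| <= rho -> 2 * rho <= dl ->
  8 * `|exp0 u - exp0 v - (u - v)| <= `|u - v|.
Proof.
move=> hu hv hr; have h := exp0_lip hu hv hr.
have : 16 * M * rho * `|u - v| <= 1 * `|u - v|.
  apply: ler_wpM2r => //; have : M * (2 * rho) <= M * dl by rewrite ler_wpM2l.
  by have := dlM; lra.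
lra.
Qed.

Let exp0_norm v : 2 * `|v| <= dl -> `|exp0 v| <= 2 * `|v|.
Proof.
move=> hv; have := @exp0_small v 0 `|v| (lexx _) _ hv; rewrite normr0 exp00 !subr0.
move=> /(_ (normr_ge0 _)) h.
have -> : exp0 v = (exp0 v - v) + v by rewrite subrK.
apply: le_trans (ler_normD _ _) _; have := normr_ge0 v; lra.
Qed.

Let exp0_cont v : 2 * `|v| < dl -> {for v, continuous exp0}.
Proof.
move=> hv; apply: (cvg_norm_bound (g := fun u => 2 * `|u - v|)); last first.
  have h1 : (fun u => 2 * `|u - v|) @ v --> 2 * `|v - v|.
    have hs : (fun u => u - v) @ v --> v - v.
      by refine (cvgB (@cvg_id_at _ v) _); exact (cvg_cst _).
    have h : (fun u => `|u - v|) @ v --> `|v - v| by refine (cvg_norm hs).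
    by refine (cvgMl_tmp h).
  by rewrite subrr normr0 mulr0 in h1.
have hb : \forall u \near v, `|u| < dl / 2.
  by apply: (@cvgr_norm_lt _ _ _ _ _ _ _ (@cvg_id_at _ v)); lra.
apply: (@filterS _ _ _ _ _ _ hb) => u hu.
have := @exp0_small u v (dl / 2) (ltW hu) _ _ => h.
have {}h : 8 * `|exp0 u - exp0 v - (u - v)| <= `|u - v| by apply: h; lra.
have -> : exp0 u - exp0 v = (exp0 u - exp0 v - (u - v)) + (u - v) by rewrite subrK.
apply: le_trans (ler_normD _ _) _; have := normr_ge0 (u - v); lra.
all: exact: nbhs_filter.
Qed.

Let pw_star i w : 2 * (i%:R * `|w|) <= dl ->
  `|pw i w - exp0 (i%:R *: w)| <= 4 * M * (i%:R * `|w|) * `|w|.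
Proof.
case: i => [|i] h; first by rewrite /pw expg0 kap1 scale0r exp00 subrr normr0 mul0r mulr0 mul0r.
have i0 : 0 < i.+1%:R :> R by [].
have hv : 2 * `|i.+1%:R *: w| <= dl by rewrite normrZ ger0_norm.
have := exp0P i hv; rewrite /seqv /cc scalerA mulVf ?gt_eqF // scale1r normrZ ger0_norm //.
move=> h1; apply: le_trans h1 _; rewrite le_eqVlt; apply/orP; left; apply/eqP.
by field; rewrite gt_eqF.
Qed.

Definition lexp v := psi (exp0 v).

Let lexp_r v : 2 * `|v| <= dl -> `|exp0 v| < r.
Proof.
move=> hv; apply: le_lt_trans (exp0_norm hv) _; apply: le_lt_trans hv _.
by have := dlr; have := dl0; lra.
Qed.

Let lexp_cont v : 2 * `|v| < dl -> {for v, continuous lexp}.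
Proof.
move=> hv; have h := exp0_cont hv.
refine (cvg_at_comp (h : exp0 @ v --> exp0 v) _); apply: (lc_psi_cont H).
by apply: lexp_r; exact: ltW.
Qed.

(** The one-parameter law, inverses and the product formula all follow by a suitable choice of the
    sequences: only the limit of [i q] times [w q] matters. *)
Lemma lexp_seq (w : nat -> 'rV[R]_n) (i : nat -> nat) v : 2 * `|v| < dl ->
  w @ \oo --> (0 : 'rV[R]_n) -> (fun q => (i q)%:R *: w q) @ \oo --> v ->
  (fun q => psi (w q) ^+ (i q))%g @ \oo --> lexp v.
Proof.
move=> hv w0 iw.
have hb : \forall q \near \oo, `|(i q)%:R *: w q| < dl / 2.
  by apply: (@cvgr_norm_lt _ _ _ _ _ _ _ iw); lra.
have hE : \forall q \near \oo, psi (pw (i q) (w q)) = (psi (w q) ^+ i q)%g.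
  apply: (@filterS _ _ _ _ _ _ hb) => q; rewrite normrZ ger0_norm // => hq.
  by rewrite pwE //; have := dl0; lra.
refine (cvg_eq_near hE _).
suff h : (fun q => pw (i q) (w q)) @ \oo --> exp0 v.
  refine (cvg_at_comp h _); apply: (lc_psi_cont H); apply: lexp_r; exact: ltW.
have h1 : (fun q => exp0 ((i q)%:R *: w q)) @ \oo --> exp0 v.
  refine (cvg_at_comp iw (exp0_cont hv)).
have h2 : (fun q => pw (i q) (w q) - exp0 ((i q)%:R *: w q)) @ \oo --> (0 : 'rV[R]_n).
  apply: (cvg_norm_bound (g := fun q => 4 * M * dl * `|w q|)).
    apply: (@filterS _ _ _ _ _ _ hb) => q; rewrite normrZ ger0_norm // subr0 => hq.
    apply: le_trans (pw_star _) _; first by lra.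
    apply: ler_wpM2r => //; apply: ler_wpM2l; first by rewrite mulr_ge0.
    by have := dl0; lra.
  have h3 : (fun q => 4 * M * dl * `|w q|) @ \oo --> 4 * M * dl * `|0 : 'rV[R]_n|.
    by apply: cvgZr; apply: cvg_norm.
  by rewrite normr0 mulr0 in h3.
by refine (cvg_sub0 h2 h1).
Qed.

(** Exponents add for powers of a single element, and the integer parts of [s * q.+1] approximate
    the real time [s]. *)
Let lexpD_pos s t v : 0 <= s -> 0 <= t -> 2 * ((s + t) * `|v|) < dl ->
  lexp ((s + t) *: v) = (lexp (s *: v) * lexp (t *: v))%g.
Proof.
move=> s0 t0 hst.
have v0 := normr_ge0 v.
have hn a : 0 <= a -> 2 * `|a *: v| = 2 * (a * `|v|) by move=> a0; rewrite normrZ ger0_norm.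
have hs : 2 * `|s *: v| < dl by rewrite hn //; nra.
have ht : 2 * `|t *: v| < dl by rewrite hn //; nra.
have hst' : 2 * `|(s + t) *: v| < dl by rewrite hn // addr_ge0.
pose w (q : nat) := q.+1%:R^-1 *: v.
have w0 : w @ \oo --> (0 : 'rV[R]_n) by exact (cvg_div_harmonic v).
have hc a : 0 <= a -> (fun q => (floorseq a q)%:R *: w q) @ \oo --> a *: v.
  move=> a0; have h : (fun q => (q.+1%:R^-1 * (floorseq a q)%:R) *: v) @ \oo --> a *: v.
    by apply: cvg_scale_near => q; exact: floorseqP.
  by refine (cvg_eq_near _ h); apply: nearW => q; rewrite scalerA mulrC.
have h1 := lexp_seq hs w0 (hc s s0).
have h2 := lexp_seq ht w0 (hc t t0).
have hc3 : (fun q => (floorseq s q + floorseq t q)%:R *: w q) @ \oo --> (s + t) *: v.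
  rewrite scalerDl; have h : (fun q => (floorseq s q)%:R *: w q + (floorseq t q)%:R *: w q)
    @ \oo --> s *: v + t *: v by refine (cvgD (hc s s0) (hc t t0)).
  by refine (cvg_eq_near _ h); apply: nearW => q; rewrite natrD scalerDl.
have h3 := lexp_seq hst' w0 hc3.
refine (lim_unique hG h3 _); refine (cvg_eq_near _ (cvgMg h1 h2)); apply: nearW => q.
by rewrite expgnDr.
Qed.

Let lexp0 : lexp 0 = 1%g.
Proof. by rewrite /lexp exp00 (lc_psi0 H). Qed.

Let cvg_kap : {for 1%g, continuous kap}. Proof. exact: lc_kap_cont H. Qed.

Let small_r : \forall u \near (0 : 'rV[R]_n), `|u| < r.
Proof.
have h : (fun u : 'rV[R]_n => u) @ (0 : 'rV[R]_n) --> (0 : 'rV[R]_n) by exact: cvg_id_at.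
by apply: (@cvgr_norm_lt _ _ _ _ _ _ _ h); rewrite ?normr0 //; exact: r0.
Qed.

(** To first order the inverse of [psi u] has coordinate [- u], by the estimate for a product equal
    to 1. *)
Let lexpV v : 2 * `|v| < dl -> lexp (- v) = (lexp v)^-1%g.
Proof.
move=> hv; have hnv : 2 * `|- v| < dl by rewrite normrN.
pose u (q : nat) := q.+1%:R^-1 *: v.
pose w (q : nat) := kap (psi (u q))^-1%g.
have u0 : u @ \oo --> (0 : 'rV[R]_n) by exact (cvg_div_harmonic v).
have p0 : {for 0, continuous psi} by apply: (lc_psi_cont H); rewrite normr0.
have hpu : (fun q => (psi (u q))^-1%g) @ \oo --> 1%g.
  rewrite -[X in _ --> X]invg1 -(lc_psi0 H); refine (cvgVg (cvg_at_comp u0 p0)).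
have w0 : w @ \oo --> (0 : 'rV[R]_n) by rewrite -kap1; refine (cvg_at_comp hpu cvg_kap).
have hw : \forall q \near \oo, psi (w q) = (psi (u q))^-1%g by exact: (hpu _ (lc_kapK H)).
have hur : \forall q \near \oo, `|u q| < r by exact: (u0 _ small_r).
have hwr : \forall q \near \oo, `|w q| < r by exact: (w0 _ small_r).
have hcv : (fun q => q.+1%:R *: w q) @ \oo --> - v.
  apply: (cvg_norm_bound (g := fun q => M * `|v| * `|w q|)); last first.
    have h : (fun q => `|w q|) @ \oo --> `|0 : 'rV[R]_n| by refine (cvg_norm w0).
    have h3 : (fun q => M * `|v| * `|w q|) @ \oo --> M * `|v| * `|0 : 'rV[R]_n|.
      by refine (cvgMl_tmp h).
    by rewrite normr0 mulr0 in h3.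
  apply: (@filterS _ _ _ _ _ _ (filterI hw (filterI hur hwr))) => q [/= e1 [e2 e3]].
  have z0 : `|0 : 'rV[R]_n| < r by rewrite normr0.
  have := lc_est H e2 z0 e3 e3.
  rewrite e1 mulgV kap1 (lc_psi0 H) mul1g -e1 (lc_psiK H) // !subrr !subr0 normr0 mulr0 addr0.
  have q0 : 0 < q.+1%:R :> R by [].
  move=> h; have -> : q.+1%:R *: w q - - v = - (q.+1%:R *: (0 - w q - u q)).
    rewrite sub0r -scalerN opprB opprK scalerDr /u scalerA mulfV ?gt_eqF // scale1r.
    by rewrite opprK addrC.
  rewrite normrN normrZ ger0_norm //; apply: le_trans (ler_wpM2l (ltW q0) h) _.
  rewrite /u normrZ normfV ger0_norm // le_eqVlt; apply/orP; left; apply/eqP.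
  by field; rewrite gt_eqF.
have h1 := lexp_seq hnv w0 hcv.
have hcu : (fun q => q.+1%:R *: u q) @ \oo --> v.
  refine (cvg_eq_near _ (cvg_cst v)); apply: nearW => q.
  by rewrite scalerA mulfV ?scale1r // gt_eqF.
have h2 := lexp_seq hv u0 hcu.
refine (lim_unique hG h1 _); refine (cvg_eq_near _ (cvgVg h2)).
by apply: (@filterS _ _ _ _ _ _ hw) => q ->; rewrite expVgn.
Qed.

Let lexpD s t v : 2 * ((`|s| + `|t|) * `|v|) < dl ->
  lexp ((s + t) *: v) = (lexp (s *: v) * lexp (t *: v))%g.
Proof.
wlog s0 : s t v / 0 <= s => [hw|].
  have [s0|s0] := leP 0 s; first exact: hw.
  move=> h; have := hw (- s) (- t) (- v); rewrite !normrN -opprD !scaleNr !scalerN !opprK.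
  by apply => //; rewrite oppr_ge0 ltW.
have v0 := normr_ge0 v.
have [t0|t0] := leP 0 t.
  by rewrite !ger0_norm //; exact: lexpD_pos.
rewrite (ger0_norm s0) (ltr0_norm t0) => h.
have nt : 2 * `|t *: v| < dl by rewrite normrZ ltr0_norm //; nra.
have [st|st] := leP 0 (s + t).
  have := @lexpD_pos (s + t) (- t) v st _ _; rewrite addrK => ->; last first.
  - by nra.
  - by rewrite oppr_ge0 ltW.
  by rewrite scaleNr lexpV // -mulgA mulVg mulg1.
have nst : 2 * `|(s + t) *: v| < dl by rewrite normrZ ltr0_norm //; nra.
have := @lexpD_pos (- (s + t)) s v _ s0 _; rewrite opprD addrAC addNr add0r => e.
have {}e : lexp (- t *: v) = (lexp ((- s - t) *: v) * lexp (s *: v))%g.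
  by apply: e; [lra | nra].
move: e; rewrite -opprD !scaleNr !lexpV // => e.
by rewrite -[lexp (t *: v)]invgK e invgM invgK mulVKg.
Qed.

(** Trotter's product formula: the coordinate of the short product is the sum up to a mixed term,
    which still tends to 0 after multiplication by [q.+1]. *)
Let lexp_mul u v : 4 * (`|u| + `|v|) < dl ->
  (fun q : nat => (lexp (q.+1%:R^-1 *: u) * lexp (q.+1%:R^-1 *: v)) ^+ q.+1)%g @ \oo -->
  lexp (u + v).
Proof.
move=> huv; have u0 := normr_ge0 u; have v0 := normr_ge0 v.
have huv' : 2 * `|u + v| < dl by have := ler_normD u v; lra.
pose a z (q : nat) := exp0 (q.+1%:R^-1 *: z).
have e0c : {for 0, continuous exp0} by apply: exp0_cont; rewrite normr0 mulr0.
have a0 z : a z @ \oo --> (0 : 'rV[R]_n).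
  by rewrite -[0 in X in _ --> X]exp00; refine (cvg_at_comp (cvg_div_harmonic z) e0c).
pose w (q : nat) := kap (psi (a u q) * psi (a v q))%g.
have p0 : {for 0, continuous psi} by apply: (lc_psi_cont H); rewrite normr0.
have w0 : w @ \oo --> (0 : 'rV[R]_n).
  rewrite -kap1 -[X in kap X]mulg1 -(lc_psi0 H).
  refine (cvg_at_comp (cvgMg (cvg_at_comp (a0 u) p0) (cvg_at_comp (a0 v) p0)) _).
  by rewrite (lc_psi0 H) mulg1.
have har z : \forall q \near \oo, `|a z q| < r by exact: (a0 z _ small_r).
have hqa z : 2 * `|z| < dl -> (fun q => q.+1%:R *: a z q) @ \oo --> z.
  move=> hz; apply: (cvg_norm_bound (g := fun q : nat => (2 * M * `|z| * `|z|) * q.+1%:R^-1)).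
    apply: nearW => q; have q0 : 0 < q.+1%:R :> R by [].
    have hz' : 2 * `|q.+1%:R^-1 *: z| <= dl.
      rewrite normrZ normfV ger0_norm //; apply: le_trans (ltW hz).
      rewrite ler_pM2l // ler_piMl // invf_le1 // ler1n //.
    have h := exp0_near hz'.
    have -> : q.+1%:R *: a z q - z = q.+1%:R *: (a z q - q.+1%:R^-1 *: z).
      by rewrite scalerBr scalerA mulfV ?scale1r // gt_eqF.
    rewrite normrZ ger0_norm //; apply: le_trans (ler_wpM2l (ltW q0) h) _.
    rewrite normrZ normfV ger0_norm // le_eqVlt; apply/orP; left; apply/eqP.
    by field; rewrite gt_eqF.
  have h1 : (fun q : nat => (2 * M * `|z| * `|z|) * q.+1%:R^-1) @ \oo -->
    (2 * M * `|z| * `|z|) * (0 : R) by apply: cvgZr; exact: cvg_harmonic.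
  by rewrite mulr0 in h1.
have hcv : (fun q => q.+1%:R *: w q) @ \oo --> u + v.
  have hu2 : 2 * `|u| < dl by lra.
  have hv2 : 2 * `|v| < dl by lra.
  have hs : (fun q => q.+1%:R *: a u q + q.+1%:R *: a v q) @ \oo --> u + v.
    by refine (cvgD (hqa u hu2) (hqa v hv2)).
  suff hd : (fun q => q.+1%:R *: w q - (q.+1%:R *: a u q + q.+1%:R *: a v q)) @ \oo -->
    (0 : 'rV[R]_n) by refine (cvg_sub0 hd hs).
  apply: (cvg_norm_bound (g := fun q => M * (`|q.+1%:R *: a u q| * `|a v q|))); last first.
    have h1 : (fun q => `|q.+1%:R *: a u q|) @ \oo --> `|u| by refine (cvg_norm (hqa u hu2)).
    have h2 : (fun q => `|a v q|) @ \oo --> `|0 : 'rV[R]_n| by refine (cvg_norm (a0 v)).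
    have h3 : (fun q => M * (`|q.+1%:R *: a u q| * `|a v q|)) @ \oo -->
      M * (`|u| * `|0 : 'rV[R]_n|) by refine (cvgMl_tmp (cvgM h1 h2)).
    by rewrite normr0 !mulr0 in h3.
  apply: (@filterS _ _ _ _ _ _ (filterI (har u) (har v))) => q [/= e1 e2].
  have z0 : `|0 : 'rV[R]_n| < r by rewrite normr0.
  have q0 : 0 < q.+1%:R :> R by [].
  have := lc_est H e1 z0 e2 z0; rewrite (lc_psi0 H) mulg1 kap1 !subr0 normr0 mul0r addr0 => h.
  rewrite -scalerDr -scalerBr opprD addrA !normrZ !ger0_norm // -mulrA mulrCA.
  exact: (ler_wpM2l (ltW q0) h).
have h1 := lexp_seq huv' w0 hcv.
refine (cvg_eq_near _ h1).
apply: (@filterS _ _ _ _ _ _ (filterI (har u) (har v))) => q [/= e1 e2].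
by rewrite /w (lc_mul H).
Qed.

Let exp0_inj u v : 2 * `|u| <= dl -> 2 * `|v| <= dl -> exp0 u = exp0 v -> u = v.
Proof.
move=> hu hv e; have h1 : `|u| <= dl / 2 by lra.
have h2 : `|v| <= dl / 2 by lra.
have := exp0_small h1 h2; rewrite e subrr sub0r normrN => h.
have {}h : 8 * `|u - v| <= `|u - v| by apply: h; lra.
apply/eqP; rewrite -subr_eq0 -normr_le0; lra.
Qed.

(* A point minimizing the distance from [exp0 v] to [y] on a ball is moved closer to [y] by the
   Newton-like step [v + (y - exp0 v)]. *)
Let exp0_surj y : 8 * `|y| < dl -> exists2 v, `|v| <= 4 * `|y| & exp0 v = y.
Proof.
move=> hy; have y0 := normr_ge0 y.
pose B : set 'rV[R]_n := [set v | `|v| <= 4 * `|y|].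
have cB : compact B.
  apply: bounded_closed_compact.
    exists (4 * `|y|); split; first exact: num_real.
    by move=> z hz v hv; apply: le_trans hv (ltW hz).
  have -> : B = (fun v : 'rV[R]_n => `|v|) @^-1` [set x | x <= 4 * `|y|] by [].
  by apply: closed_comp; [move=> v _; exact: norm_continuous | exact: closed_le].
have B0 : B !=set0 by exists 0; rewrite /B /= normr0 mulr_ge0.
have hB v : B v -> 2 * `|v| < dl by rewrite /B /= => hv; lra.
have cf : {within B, continuous (fun v => `|exp0 v - y|)}.
  apply: continuous_in_subspaceT => v /set_mem /hB hv.
  have h : (fun u => exp0 u - y) @ v --> exp0 v - y.
    by refine (cvgB (exp0_cont hv : exp0 @ v --> exp0 v) _); exact (cvg_cst _).
  by refine (cvg_norm h).
have [v /set_mem Bv hmin] := compact_EVT_min B0 cB cf.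
have hv := hB v Bv.
have h0 : `|exp0 v - y| <= `|y|.
  by have := hmin 0; rewrite exp00 sub0r normrN; apply; rewrite inE /B /= normr0 mulr_ge0.
have v4 : `|v| <= dl / 2 by lra.
have h8 : 8 * `|exp0 v - v| <= `|v|.
  have := @exp0_small v 0 (dl / 2) v4; rewrite normr0 exp00 !subr0; apply; [lra|lra].
have bv : 7 * `|v| <= 16 * `|y|.
  have : `|v| <= `|exp0 v - v| + `|exp0 v - y| + `|y|.
    have e1 : v = - (exp0 v - v) + (exp0 v - y) + y by rewrite opprB subrKA subrK.
    rewrite {1}e1; apply: le_trans (ler_normD _ _) _; apply: lerD => //.
    by apply: le_trans (ler_normD _ _) _; rewrite normrN.
  lra.
exists v => //; apply/eqP; rewrite -subr_eq0 -normr_le0.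
pose v' := v - (exp0 v - y).
have Bv' : `|v'| <= 4 * `|y| by apply: le_trans (ler_normB _ _) _; lra.
have hm := hmin v'; rewrite inE in hm; have {}hm := hm Bv'.
have v'4 : `|v'| <= dl / 2 by lra.
have := exp0_small v'4 v4.
have -> : v' - v = - (exp0 v - y) by rewrite /v' addrAC subrr sub0r.
have -> : exp0 v' - exp0 v - - (exp0 v - y) = exp0 v' - y by rewrite opprK addrA subrK.
rewrite normrN => h; have {}h : 8 * `|exp0 v' - y| <= `|exp0 v - y| by apply: h; lra.
have := normr_ge0 (exp0 v - y); lra.
Qed.

Lemma local_exponential : exists (ex : 'rV[R]_n -> G) (lg : G -> 'rV[R]_n) (d : R),
  [/\ 0 < d,
      forall v, `|v| < d -> {for v, continuous ex},
      forall s t v, (`|s| + `|t|) * `|v| < d -> ex ((s + t) *: v) = (ex (s *: v) * ex (t *: v))%g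
    & [/\ {for 1%g, continuous lg}, \forall z \near 1%g, ex (lg z) = z,
          forall v, `|v| < d -> lg (ex v) = v
        & forall u v, `|u| + `|v| < d ->
  (fun q : nat => (ex (q.+1%:R^-1 *: u) * ex (q.+1%:R^-1 *: v)) ^+ q.+1)%g @ \oo -->
  ex (u + v)]].
Proof.
have hlg z : exists v, 8 * `|kap z| < dl -> `|v| <= 4 * `|kap z| /\ exp0 v = kap z.
  have [h|nh] := pselect (8 * `|kap z| < dl); last by exists 0.
  by have [v h1 h2] := exp0_surj h; exists v.
have [lg lgP] := choice hlg.
have hk : kap @ 1%g --> (0 : 'rV[R]_n) by rewrite -kap1; exact cvg_kap.
have near8 : \forall z \near 1%g, 8 * `|kap z| < dl.
  have h : \forall z \near 1%g, `|kap z| < dl / 8.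
    by apply: (@cvgr_norm_lt _ _ _ _ _ _ _ hk); rewrite normr0 divr_gt0 // dl0.
  by apply: (@filterS _ _ _ _ _ _ h) => z hx; lra.
have d0 : 0 < dl / 16 by rewrite divr_gt0 // dl0.
exists lexp, lg, (dl / 16); split => //.
- by move=> v hv; apply: lexp_cont; have := normr_ge0 v; lra.
- move=> s t v h; apply: lexpD; set z := _ * `|v| in h *.
  have : 0 <= z by rewrite mulr_ge0 // addr_ge0.
  lra.
have lgex v : `|v| < dl / 16 -> lg (lexp v) = v.
  move=> hv; have v0 := normr_ge0 v.
  have hv2 : 2 * `|v| <= dl by lra.
  have e : kap (lexp v) = exp0 v by rewrite /lexp (lc_psiK H) //; exact: lexp_r.
  have h2 := exp0_norm hv2.
  have [|h3 h4] := lgP (lexp v); first by rewrite e; lra.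
  by apply: exp0_inj => //; [rewrite e in h3; lra | rewrite h4].
split=> //.
- have e1 : lg 1%g = 0 by rewrite -lexp0 lgex // normr0.
  suff h : lg @ 1%g --> (0 : 'rV[R]_n) by move: h; rewrite -e1.
  apply: (cvg_norm_bound (g := fun z => 4 * `|kap z|)).
    by apply: (@filterS _ _ _ _ _ _ near8) => z hx; rewrite subr0; have [] := lgP z hx.
  have h1 : (fun z => `|kap z|) @ 1%g --> `|0 : 'rV[R]_n| by refine (cvg_norm hk).
  have h2 : (fun z => 4 * `|kap z|) @ 1%g --> 4 * `|0 : 'rV[R]_n| by refine (cvgMl_tmp h1).
  by rewrite normr0 mulr0 in h2.
- apply: (@filterS _ _ _ _ _ _ (filterI near8 (lc_kapK H))) => z [/= h1 h2].
  by have [_ e] := lgP z h1; rewrite /lexp e.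
- by move=> u v h; apply: lexp_mul; have := normr_ge0 u; have := normr_ge0 v; lra.
Qed.

End LocalExponential.

Lemma cvgXg {G : topGroupType} {T : Type} {F : set_system T} {FF : Filter F}
    (f : T -> G) (a : G) (k : nat) :
  f @ F --> a -> (fun x => f x ^+ k)%g @ F --> (a ^+ k)%g.
Proof.
move=> fa; elim: k => [|k ih].
  rewrite expg0; have -> : (fun x => f x ^+ 0)%g = cst 1%g by apply/funext => x; rewrite expg0.
  exact: cvg_cst.
rewrite expgS; have -> : (fun x => f x ^+ k.+1)%g = (fun x => f x * f x ^+ k)%g.
  by apply/funext => x; rewrite expgS.
by refine (cvgMg fa ih).
Qed.

(** * The global exponential map *)

Section GroupExponential.
Context {R : realType} {n : nat} {G : topGroupType}.

Record group_exp (ex : 'rV[R]_n -> G) (lg : G -> 'rV[R]_n) (d : R) : Prop := GroupExp {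
  ge_d0 : 0 < d ;
  ge_cont : continuous ex ;
  geD : forall s t v, ex ((s + t) *: v) = (ex (s *: v) * ex (t *: v))%g ;
  ge_lg_cont : {for 1%g, continuous lg} ;
  ge_lgK : \forall x \near 1%g, ex (lg x) = x ;
  ge_exK : forall v, `|v| < d -> lg (ex v) = v ;
  ge_mul : forall u v, `|u| < d -> `|v| < d ->
    (fun q : nat => (ex (q.+1%:R^-1 *: u) * ex (q.+1%:R^-1 *: v)) ^+ q.+1)%g @ \oo -->
    ex (u + v) }.

(** The value at [v] is a power of the local exponential at [v] divided by a large integer. Two
    admissible integers give the same value, since their product refines both. *)
Lemma lie_group_exp : lie_group R n G -> exists ex lg d, group_exp ex lg d.
Proof.
move=> lieG; have hG : hausdorff_space G by case: lieG.
have [psi [kap [r [M lc]]]] := lie_local_coords lieG.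
have [lex [lg [d [d0 lcont lD [lgc lgK exK lmul]]]]] := local_exponential hG lc.
have lX (v : 'rV[R]_n) (k : nat) : k%:R * `|v| < d -> lex (k%:R *: v) = (lex v ^+ k)%g.
  elim: k => [|k ih] hk.
    have h0 : lex 0 = (lex 0 * lex 0)%g.
      have := lD 0 0 v; rewrite addr0 scale0r; apply.
      by rewrite normr0 addr0 mul0r.
    by rewrite scale0r expg0; apply: (mulgI (lex 0)); rewrite -h0 mulg1.
  have v0 := normr_ge0 v; have k0 : 0 <= k%:R :> R by [].
  rewrite -natr1 in hk *; rewrite lD ?ih ?scale1r ?expgSr //; first by nra.
  by rewrite normr1 ger0_norm.
pose ok (v : 'rV[R]_n) (k : nat) := `|v| < k.+1%:R * d.
pose kk (v : 'rV[R]_n) := (Num.truncn (`|v| / d)).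
have okk v : ok v (kk v).
  rewrite /ok /kk -ltr_pdivrMr //.
  by have /andP[_ h] := Num.Theory.truncn_itv (divr_ge0 (normr_ge0 v) (ltW d0)).
pose pe k (v : 'rV[R]_n) := (lex (k.+1%:R^-1 *: v) ^+ k.+1)%g.
have peE v k l : ok v k -> ok v l -> pe k v = pe l v.
  have h k1 l1 : ok v k1 -> pe k1 v = (lex ((k1.+1 * l1.+1)%:R^-1 *: v) ^+ (k1.+1 * l1.+1))%g.
    move=> hk; have k10 : 0 < k1.+1%:R :> R by [].
    have l10 : 0 < l1.+1%:R :> R by [].
    have e : k1.+1%:R^-1 *: v = l1.+1%:R *: ((k1.+1 * l1.+1)%:R^-1 *: v).
      by rewrite scalerA natrM; congr (_ *: _); field; rewrite !gt_eqF.
    rewrite /pe e lX; first by rewrite -expgnA mulnC.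
    rewrite -(ger0_norm (ltW l10)) -normrZ -e normrZ normfV ger0_norm ?ltW //.
    by rewrite mulrC ltr_pdivrMr // mulrC.
  by move=> hk hl; rewrite (h k l hk) (h l k hl) mulnC.
pose ex (v : 'rV[R]_n) := pe (kk v) v.
have exE v k : ok v k -> ex v = pe k v by move=> h; apply: peE.
have ok0 v : `|v| < d -> ok v 0%N by rewrite /ok mul1r.
have ex0 v : `|v| < d -> ex v = lex v by move=> h; rewrite (exE v 0%N (ok0 v h)) /pe invr1 scale1r expg1.
exists ex, lg, (d / 2); split => //.
- by rewrite divr_gt0.
- move=> v; set k := kk v.
  have hE : \forall u \near v, pe k u = ex u.
    have h : \forall u \near v, `|u| < k.+1%:R * d.
      by apply: (@cvgr_norm_lt _ _ _ _ _ _ _ (@cvg_id_at _ v)); exact: okk.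
    by apply: (@filterS _ _ _ _ _ _ h) => u hu; rewrite (exE u k).
  refine (cvg_eq_near hE _).
  suff h : (fun u : 'rV[R]_n => lex (k.+1%:R^-1 *: u)) @ v --> lex (k.+1%:R^-1 *: v).
    by refine (cvgXg h).
  have hs : (fun u : 'rV[R]_n => k.+1%:R^-1 *: u) @ v --> k.+1%:R^-1 *: v.
    by refine (cvgZl_tmp (@cvg_id_at _ v)).
  refine (cvg_at_comp hs (lcont _ _)).
  by rewrite normrZ normfV ger0_norm // mulrC ltr_pdivrMr // mulrC; exact: okk.
- move=> s t v.
  pose w := (`|s| + `|t|) *: v.
  pose k := kk w.
  have nw : `|w| = (`|s| + `|t|) * `|v| by rewrite normrZ ger0_norm // addr_ge0.
  have okw : `|w| < k.+1%:R * d := okk w.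
  have v0 := normr_ge0 v; have s0 := normr_ge0 s; have t0 := normr_ge0 t.
  have ok1 a : `|a| <= `|s| + `|t| -> ok (a *: v) k.
    move=> ha; apply: le_lt_trans okw; rewrite nw normrZ; exact: ler_wpM2r.
  rewrite (exE _ k) ?ok1 ?ler_normD // (exE (s *: v) k) ?ok1 ?lerDl // (exE (t *: v) k) ?ok1 ?lerDr //.
  rewrite /pe !scalerA; have k0 : 0 < k.+1%:R :> R by [].
  have hk a : k.+1%:R^-1 * a *: v = a *: (k.+1%:R^-1 *: v) by rewrite scalerA mulrC.
  have hb : (`|s| + `|t|) * `|k.+1%:R^-1 *: v| < d.
    rewrite normrZ normfV (ger0_norm (ltW k0)) mulrCA -nw mulrC ltr_pdivrMr // mulrC.
    exact: okw.
  rewrite !hk lD // expgMn // /commute -lD // addrC lD //.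
  by rewrite [`|t| + _]addrC.
- have h : \forall z \near 1%g, `|lg z| < d.
    apply: (@cvgr_norm_lt _ _ _ _ _ _ _ (lgc : lg @ 1%g --> lg 1%g)).
    have := lX 0 0%N; rewrite mul0r scale0r expg0 => <- //.
    by rewrite exK ?normr0.
  by apply: (@filterS _ _ _ _ _ _ (filterI h lgK)) => z [/= h1 h2]; rewrite ex0.
- move=> v hv; have v0 := normr_ge0 v.
  have hv' : `|v| < d by lra.
  by rewrite ex0 // exK.
- move=> u v hu hv; have huv : `|u| + `|v| < d by lra.
  rewrite ex0; last by apply: le_lt_trans (ler_normD _ _) huv.
  have := lmul u v huv => h; refine (cvg_eq_near _ h); apply: nearW => q.
  have hq (z : 'rV[R]_n) : `|z| < d / 2 -> `|q.+1%:R^-1 *: z| < d.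
    move=> hz; have z0 := normr_ge0 z.
    rewrite normrZ normfV ger0_norm //; apply: (@le_lt_trans _ _ `|z|); last by lra.
    by rewrite ler_piMl // invf_le1 // ler1n.
  by rewrite !ex0 //; exact: hq.
Qed.

End GroupExponential.

(** * Monodromy of local cocycles *)

Section ClampPaths.
Context {R : realType}.

(** Paths and homotopies are constrained on the unit interval only; composing with [clamp] makes
    them continuous everywhere. *)
Definition clamp (t : R) : R := Num.max 0 (Num.min 1 t).

Lemma clamp_itv t : clamp t \in `[0, 1].
Proof. by rewrite in_itv /= /clamp le_max lexx /= ge_max ler01 ge_min lexx. Qed.

Lemma clamp_id t : t \in `[0, 1] -> clamp t = t.
Proof.
by rewrite in_itv /= => /andP[t0 t1]; rewrite /clamp (min_idPr t1) (max_idPr t0).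
Qed.

Lemma clamp0 : clamp 0 = 0. Proof. by rewrite clamp_id // in_itv /= lexx ler01. Qed.
Lemma clamp1 : clamp 1 = 1. Proof. by rewrite clamp_id // in_itv /= lexx ler01. Qed.

Lemma clamp_cont : continuous clamp.
Proof.
move=> t; apply: continuous_max; first exact: cvg_cst.
by apply: continuous_min; [exact: cvg_cst | exact: cvg_id].
Qed.

Lemma within_comp {S T U : topologicalType} (A : set T) (f : T -> U) (g : S -> T) :
  {within A, continuous f} -> continuous g -> (forall s, A (g s)) -> continuous (f \o g).
Proof.
move=> cf cg gA s W Wf.
have hW : within A (nbhs (g s)) (f @^-1` W).
  by rewrite (nbhs_subspace_in (gA s)); exact: (cf (g s) W Wf).
have h2 : nbhs s (g @^-1` (fun z => A z -> W (f z))) := cg s _ hW.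
by apply: (@filterS _ _ _ _ _ _ h2) => z /= hz; apply: hz.
Qed.

End ClampPaths.

Lemma locally_constant {T : topologicalType} {K : Type} (f : T -> K) :
  connected [set: T] -> (forall x, \forall y \near x, f y = f x) -> forall x y, f x = f y.
Proof.
move=> cT hf x y.
pose B := [set z | f z = f y].
have oB : open B.
  rewrite openE => z Bz; rewrite /interior; apply: (@filterS _ _ _ _ _ _ (hf z)) => u.
  by rewrite /B /= => ->.
have cB : closed B.
  move=> z hz; have [u [/= Bu e]] := hz _ (hf z).
  by rewrite /B /= -e.
have -> : f x = f y; last by [].
have : B x by rewrite (cT B) //; [exists y | exists B; rewrite ?setTI | exists B; rewrite ?setTI].
by [].
Qed.

(** * Local cocycles and their primitives on normed spaces *)

Section Cocycles.
Context {R : realType} {H : groupType}.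

(** A flat connection in discrete form: [H] carries no topology, and [tau] is meaningful only for
    nearby pairs. A trivialization is a global primitive of it. *)
Definition local_cocycle (Z : topologicalType) (tau : Z -> Z -> H) :=
  forall z0 : Z, exists2 W : set Z, nbhs z0 W &
    forall a b c, W a -> W b -> W c -> (tau a b * tau b c)%g = tau a c.

Definition trivializes (Z : topologicalType) (tau : Z -> Z -> H) (L : Z -> H) :=
  forall z0 : Z, exists2 W : set Z, nbhs z0 W &
    forall a b, W a -> W b -> L b = (L a * tau a b)%g.

Lemma local_cocycle_id (Z : topologicalType) (tau : Z -> Z -> H) (z : Z) :
  local_cocycle tau -> tau z z = 1%g.
Proof.
move=> /(_ z) [W /nbhs_singleton Wz h]; apply: (mulgI (tau z z)).
by rewrite mulg1 h.
Qed.

Lemma local_cocycle_comp (Z Y : topologicalType) (tau : Z -> Z -> H) (f : Y -> Z) :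
  continuous f -> local_cocycle tau -> local_cocycle (fun a b => tau (f a) (f b)).
Proof.
move=> cf h y; have [W Wy hW] := h (f y).
by exists (f @^-1` W); [exact: cf | move=> a b c; exact: hW].
Qed.

Lemma trivializes_comp (Z Y : topologicalType) (tau : Z -> Z -> H) (L : Z -> H) (f : Y -> Z) :
  continuous f -> trivializes tau L -> trivializes (fun a b => tau (f a) (f b)) (L \o f).
Proof.
move=> cf h y; have [W Wy hW] := h (f y).
by exists (f @^-1` W); [exact: cf | move=> a b; exact: hW].
Qed.

Lemma trivializes_unique (Z : topologicalType) (tau : Z -> Z -> H) (L L' : Z -> H) (x y : Z) :
  connected [set: Z] -> trivializes tau L -> trivializes tau L' ->
  ((L x)^-1 * L y = (L' x)^-1 * L' y)%g.
Proof.
move=> cZ hL hL'.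
have e : (L' x * (L x)^-1 = L' y * (L y)^-1)%g.
  apply: (@locally_constant _ _ (fun z => L' z * (L z)^-1)%g cZ) => z.
  have [W Wz hW] := hL z; have [W' W'z hW'] := hL' z.
  have Wzz := nbhs_singleton Wz; have W'zz := nbhs_singleton W'z.
  apply: (@filterS _ _ _ _ _ _ (filterI Wz W'z)) => u [Wu W'u].
  by rewrite (hW z u) // (hW' z u) // invgM mulgA mulgK.
have -> : L' y = (L' x * (L x)^-1 * L y)%g by rewrite e -mulgA mulVg mulg1.
by rewrite -!mulgA mulKg.
Qed.

Fixpoint hol (Z : Type) (tau : Z -> Z -> H) (f : nat -> Z) (k : nat) : H :=
  if k is k'.+1 then (hol tau f k' * tau (f k') (f k))%g else 1%g.

Lemma holD (Z : Type) (tau : Z -> Z -> H) (f : nat -> Z) (a b : nat) :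
  hol tau f (a + b) = (hol tau f a * hol tau (fun i => f (a + i)%N) b)%g.
Proof.
elim: b => [|b ih]; first by rewrite addn0 mulg1.
by rewrite addnS /= ih mulgA addnS.
Qed.

Section Star.
Context {V : normedModType R}.
Variable tau : V -> V -> H.
Hypothesis htau : local_cocycle tau.
Implicit Types (p q : V) (dl : R) (m k : nat).

Let good dl p := forall t, t \in `[0, 1] -> forall a b c,
  `|a - t *: p| < dl -> `|b - t *: p| < dl -> `|c - t *: p| < dl ->
  (tau a b * tau b c)%g = tau a c.

Let good_exists p : exists2 dl, 0 < dl & good dl p.
Proof.
pose P (z : R * R) := forall a b c,
  `|a - z.1 *: p| < z.2 -> `|b - z.1 *: p| < z.2 -> `|c - z.1 *: p| < z.2 ->
  (tau a b * tau b c)%g = tau a c.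
have h : \forall dl \near 0, forall t, `[0, 1]%classic t -> P (t, dl).
  apply: compact_near_all; first exact: segment_compact.
  move=> t _; have [W Wt hW] := htau (t *: p).
  have /(nbhs_ballP _ W).1 [e /= e0 he] := Wt.
  have e2 : 0 < e / 2 by rewrite divr_gt0.
  have h1 : \forall z \near (t, 0 : R), `|z.1 *: p - t *: p| < e / 2 /\ z.2 < e / 2.
    have c1 : (fun z : R * R => z.1 *: p - t *: p) @ (t, 0 : R) --> (0 : V).
      rewrite -[X in _ --> X](subrr (t *: p)); refine (cvgB _ (cvg_cst _)).
      by refine (cvgZr_tmp _); exact: cvg_fst.
    have n1 : \forall z \near (t, 0 : R), `|z.1 *: p - t *: p| < e / 2.
      by apply: (@cvgr_norm_lt _ _ _ _ _ _ _ c1); rewrite normr0.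
    have c2 : (fun z : R * R => z.2) @ (t, 0 : R) --> (0 : R) by exact: cvg_snd.
    have n2 : \forall z \near (t, 0 : R), z.2 < e / 2 by exact: (cvgr_lt _ c2).
    exact: filterI.
  apply: (@filterS _ _ _ _ _ _ h1) => z [h2 h3] a b c ha hb hc.
  have hh u : `|u - z.1 *: p| < z.2 -> W u.
    move=> hu; apply: he; rewrite -ball_normE /= distrC.
    have -> : u - t *: p = (u - z.1 *: p) + (z.1 *: p - t *: p) by rewrite addrA subrK.
    by apply: le_lt_trans (ler_normD _ _) _; lra.
  by apply: hW; apply: hh.
have /(nbhs_ballP _ _).1 [e /= e0 he] := h.
have e2 : 0 < e / 2 by rewrite divr_gt0.
exists (e / 2) => // t; have := he (e / 2); rewrite -ball_normE /= sub0r normrN ger0_norm ?ltW //.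
move=> h1 tt; apply: h1; [lra | exact: tt].
Qed.

Let pts p k : nat -> V := fun i => (i%:R / k%:R) *: p.
Let LM p k := hol tau (pts p k) k.
Let fine dl p k := `|p| < dl * k%:R.

Let frac_itv (i k : nat) : (i <= k)%N -> (i%:R / k%:R : R) \in `[0, 1].
Proof.
move=> ik; rewrite in_itv /= divr_ge0 //=; case: k ik => [|k] ik; first by rewrite invr0 mulr0.
by rewrite ler_pdivrMr // mul1r ler_nat.
Qed.

Let LM_refine dl p k l : (0 < k)%N -> (0 < l)%N -> good dl p -> fine dl p k ->
  LM p (k * l) = LM p k.
Proof.
move=> k0 l0 gd fk; have k0R : 0 < k%:R :> R by rewrite ltr0n.
have l0R : 0 < l%:R :> R by rewrite ltr0n.
rewrite /LM; suff h m : (m <= k)%N -> hol tau (pts p (k * l)) (m * l) = hol tau (pts p k) m.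
  exact: h.
elim: m => [|m ih] mk //; rewrite mulSn addnC holD ih /=; last exact: ltnW.
congr (_ * _)%g.
have E i : pts p (k * l) (m * l + i) = (m%:R / k%:R) *: p + (i%:R / (k%:R * l%:R)) *: p.
  by rewrite /pts -scalerDl natrD !natrM; congr (_ *: _); field; rewrite !gt_eqF.
have Em : pts p k m = pts p (k * l) (m * l + 0).
  by rewrite E mul0r scale0r addr0.
have Em1 : pts p k m.+1 = pts p (k * l) (m * l + l).
  by rewrite E /pts -scalerDl -natr1; congr (_ *: _); field; rewrite !gt_eqF.
rewrite Em Em1.
have near_m i : (i <= l)%N -> `|pts p (k * l) (m * l + i) - (m%:R / k%:R) *: p| < dl.
  move=> il; rewrite E addrAC subrr add0r normrZ ger0_norm; last by rewrite divr_ge0 // mulr_ge0.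
  apply: (@le_lt_trans _ _ (`|p| / k%:R)); last by rewrite ltr_pdivrMr.
  rewrite [leRHS]mulrC; apply: ler_wpM2r => //.
  rewrite ler_pdivrMr ?mulr_gt0 // mulrA mulVf ?gt_eqF // mul1r ler_nat //.
have tm := frac_itv (ltnW mk).
have h i : (i <= l)%N -> hol tau (fun j => pts p (k * l) (m * l + j)) i =
    tau (pts p (k * l) (m * l + 0)) (pts p (k * l) (m * l + i)).
  elim: i => [|i ihi] il; first by rewrite local_cocycle_id.
  rewrite /= ihi; last exact: ltnW.
  by apply: (gd _ tm); apply: near_m => //; exact: ltnW.
exact: h.
Qed.

Let LM_indep dl dl' p k l : (0 < k)%N -> (0 < l)%N -> good dl p -> fine dl p k ->
  good dl' p -> fine dl' p l -> LM p k = LM p l.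
Proof.
move=> k0 l0 gd fk gd' fl; rewrite -(LM_refine k0 l0 gd fk) mulnC.
exact: LM_refine gd' fl.
Qed.

Let fine_exists dl p : 0 < dl -> exists2 k, (0 < k)%N & fine dl p k.
Proof.
move=> d0; exists (Num.truncn (`|p| / dl)).+1 => //; rewrite /fine mulrC -ltr_pdivrMr //.
by have /andP[_ h] := Num.Theory.truncn_itv (divr_ge0 (normr_ge0 p) (ltW d0)).
Qed.

(** The primitive at [p] is the product of [tau] along a fine subdivision of the segment from 0 to
    [p]. A Lebesgue number of the segment makes it independent of the subdivision, and a single
    subdivision serves all points near [p0], so that neighbouring products differ by one factor. *)
Lemma star_trivialize : exists L, trivializes tau L.
Proof.
have hL p : exists h, forall dl k, (0 < k)%N -> good dl p -> fine dl p k -> LM p k = h.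
  have [dl d0 gd] := good_exists p; have [k k0 fk] := fine_exists p d0.
  by exists (LM p k) => dl' l l0 gd' fl; exact: LM_indep gd' fl gd fk.
have [L LP] := choice hL; exists L => p0.
have [dl d0 gd] := good_exists p0.
(* A third of the Lebesgue number leaves room for a displacement of the endpoint and for one mesh
   step. *)
have d3 : 0 < dl / 3 by rewrite divr_gt0.
have [k k0 fk] : exists2 k, (0 < k)%N & `|p0| + dl < dl / 3 * k%:R.
  exists (Num.truncn ((`|p0| + dl) / (dl / 3))).+1 => //; rewrite mulrC -ltr_pdivrMr //.
  have h0 : 0 <= (`|p0| + dl) / (dl / 3) by rewrite divr_ge0 ?addr_ge0 // ltW.
  by have /andP[_ h] := Num.Theory.truncn_itv h0.
have k0R : 0 < k%:R :> R by rewrite ltr0n.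
exists (ball p0 (dl / 3)); first exact: nbhsx_ballx.
have close p t : ball p0 (dl / 3) p -> t \in `[0, 1] -> `|t *: p - t *: p0| < dl / 3.
  rewrite -ball_normE /= distrC in_itv /= => hp /andP[t0 t1]; rewrite -scalerBr normrZ ger0_norm //.
  by apply: le_lt_trans hp; rewrite ler_piMl.
have gp p : ball p0 (dl / 3) p -> good (dl / 3) p.
  move=> hp t tt a b c.
  have hu u : `|u - t *: p| < dl / 3 -> `|u - t *: p0| < dl.
    move=> hu; have -> : u - t *: p0 = (u - t *: p) + (t *: p - t *: p0) by rewrite addrA subrK.
    by apply: le_lt_trans (ler_normD _ _) _; have := close p t hp tt; lra.
  by move=> /hu ha /hu hb /hu hc; exact: (gd t tt).
have np p : ball p0 (dl / 3) p -> `|p| < `|p0| + dl.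
  rewrite -ball_normE /= distrC => hp; have -> : p = (p - p0) + p0 by rewrite subrK.
  by apply: le_lt_trans (ler_normD _ _) _; lra.
have fp p : ball p0 (dl / 3) p -> fine (dl / 3) p k.
  by move=> /np hp; apply: lt_trans hp fk.
move=> a b ha hb; rewrite -(LP a _ k k0 (gp a ha) (fp a ha)) -(LP b _ k k0 (gp b hb) (fp b hb)).
suff h m : (m <= k)%N -> hol tau (pts b k) m = (hol tau (pts a k) m * tau (pts a k m) (pts b k m))%g.
  by have := h k (leqnn k); rewrite -/(LM a k) -/(LM b k) /pts divff ?gt_eqF // !scale1r.
elim: m => [|m ih] mk; first by rewrite /pts mul0r !scale0r local_cocycle_id //= mulg1.
rewrite /= ih; last exact: ltnW.
have tm := frac_itv (ltnW mk); have tm1 := frac_itv mk.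
have c0 p : ball p0 (dl / 3) p -> `|pts p k m - (m%:R / k%:R) *: p0| < dl.
  by move=> hp; apply: lt_trans (close _ _ hp tm) _; lra.
have c1 p : ball p0 (dl / 3) p -> `|pts p k m.+1 - (m%:R / k%:R) *: p0| < dl.
  move=> hp; have -> : pts p k m.+1 - (m%:R / k%:R) *: p0 =
      (pts p k m.+1 - (m.+1%:R / k%:R) *: p0) + k%:R^-1 *: p0.
    rewrite -addrA; congr (_ + _); rewrite -scaleNr -[in RHS]scaleNr -scalerDl; congr (_ *: _).
    by rewrite -natr1; field; rewrite gt_eqF.
  apply: le_lt_trans (ler_normD _ _) _.
  have : `|k%:R^-1 *: p0| < dl / 3.
    rewrite normrZ normfV ger0_norm // mulrC ltr_pdivrMr //; apply: lt_trans fk.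
    by rewrite ltrDl.
  by have := close _ _ hp tm1; rewrite /pts; lra.
rewrite -!mulgA; congr (_ * _)%g.
by rewrite (gd _ tm) ?c0 ?c1 // (gd _ tm) ?c0 ?c1.
Qed.

End Star.
End Cocycles.

(** * Monodromy on a simply connected group *)

Section GroupCocycle.
Context {R : realType} {n : nat} {G : topGroupType} {H : groupType}.
Context {ex : 'rV[R]_n -> G} {lg : G -> 'rV[R]_n} {d : R}.
Hypothesis hE : group_exp ex lg d.
Hypothesis sc : simply_connected R G.

Lemma ge_ex0 : ex 0 = 1%g.
Proof.
have := geD hE 0 0 0; rewrite addr0 scaler0 => h.
by apply: (mulgI (ex 0)); rewrite mulg1 -h.
Qed.

Let connR : connected [set: R].
Proof. by apply/connected_intervalP => x y _ _ z _. Qed.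

Let clamped (c : R -> G) (x y : G) := [/\ continuous c, c 0 = x & c 1 = y].

Let path_clamped x y : exists c, clamped c x y.
Proof.
have [_ /(_ x y) [a [ca a0 a1]] _] := sc.
exists (a \o clamp); split; rewrite /= ?clamp0 ?clamp1 //.
by apply: (within_comp ca (@clamp_cont R)) => t; exact: clamp_itv.
Qed.

Let square_lift (tau : G -> G -> H) (S : R * R -> G) : local_cocycle tau -> continuous S ->
  (forall s, S (s, 0) = S (0, 0)) ->
  exists2 L : R * R -> H, trivializes (fun a b => tau (S a) (S b)) L &
    forall s, L (s, 0) = L (0, 0).
Proof.
move=> ht cS hS.
have [L hL] := star_trivialize (local_cocycle_comp cS ht).
exists L => // s; apply: (@locally_constant _ _ (fun s => L (s, 0)) connR) => {}s.
have [W Ws hW] := hL (s, 0).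
have c1 : (fun u : R => (u, 0 : R)) @ s --> (s, 0 : R).
  by refine (cvg_pair_at _ _); [exact: cvg_id | exact: cvg_cst].
have Wn : \forall u \near s, W (u, 0) := c1 _ Ws.
apply: (@filterS _ _ _ _ _ _ Wn) => u /= Wu.
by rewrite (hW _ _ (nbhs_singleton Ws) Wu) /= !hS local_cocycle_id // mulg1.
Qed.

Let line_cont (s : R) : continuous (fun t : R => (s, t)).
Proof. by move=> t; refine (cvg_pair_at _ _); [exact: cvg_cst | exact: cvg_id]. Qed.

(** Two paths from 1 to [z] differ by the loop [c * c0^-1]. A contraction of this loop, multiplied
    back by [c0], is a square joining the two paths with both ends fixed, across which the holonomy
    is locally constant. *)
Let hol_path (tau : G -> G -> H) z : local_cocycle tau ->
  exists h : H, forall (c : R -> G) (L : R -> H), clamped c 1%g z -> trivializes (fun a b => tau (c a) (c b)) L ->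
    ((L 0)^-1 * L 1%R)%g = h.
Proof.
move=> ht; have [c0 [cc0 c00 c01]] := path_clamped 1%g z.
have [L0 hL0] := star_trivialize (local_cocycle_comp cc0 ht).
exists ((L0 0)^-1 * L0 1%R)%g => c L [cc c_0 c_1] hL.
pose q (t : R) := (c t * (c0 t)^-1)%g.
have cq : continuous q by move=> t; refine (cvgMg (cc t) (cvgVg (cc0 t))).
have [_ _ /(_ 1%g q)] := sc.
case; first by split; rewrite /q ?c_0 ?c00 ?c_1 ?c01 ?mulgV //; apply: continuous_subspaceT.
move=> K [cK K0 K1].
pose S (z : R * R) := (K (clamp z.1, clamp z.2) * c0 (clamp z.2))%g.
have cS : continuous S.
  move=> u; refine (cvgMg _ _).
    have ck : continuous (K \o (fun z : R * R => (clamp z.1, clamp z.2))).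
      apply: (within_comp cK) => [w|w]; last by split; exact: clamp_itv.
      by refine (cvg_pair_at _ _); refine (cvg_at_comp _ (@clamp_cont R _));
        [exact: cvg_fst | exact: cvg_snd].
    exact: ck.
  refine (cvg_at_comp _ (cc0 _)).
  refine (cvg_at_comp _ (@clamp_cont R _)); exact: cvg_snd.
have I0 : (0 : R) \in `[0, 1] by rewrite in_itv /= lexx ler01.
have S0 s : S (s, 0) = 1%g.
  rewrite /S /= clamp0; have [-> _] := K1 _ (clamp_itv s).
  by rewrite /q c_0 c00 invg1 !mulg1.
have [LS hLS LS0] := square_lift ht cS (fun s => etrans (S0 s) (esym (S0 0))).
have S1 t : S (0, t) = c (clamp t).
  rewrite /S /= clamp0; have [-> _] := K0 _ (clamp_itv t).
  by rewrite /q mulgVK.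
have S2 t : S (1, t) = c0 (clamp t).
  by rewrite /S /= clamp1; have [_ ->] := K0 _ (clamp_itv t); rewrite mul1g.
have S3 s : S (s, 1) = z.
  rewrite /S /= clamp1; have [_ ->] := K1 _ (clamp_itv s).
  by rewrite /q c_1 c01 mulgV mul1g.
have e1 := @trivializes_unique _ R _ _ _ 0 1 connR (trivializes_comp (@clamp_cont R) hL)
  (_ : trivializes (fun a b => tau (c (clamp a)) (c (clamp b))) (fun t => LS (0, t))).
have e2 := @trivializes_unique _ R _ _ _ 0 1 connR (trivializes_comp (@clamp_cont R) hL0)
  (_ : trivializes (fun a b => tau (c0 (clamp a)) (c0 (clamp b))) (fun t => LS (1, t))).
rewrite /= !clamp0 !clamp1 in e1 e2; rewrite e1; last first.
  have := trivializes_comp (@line_cont 0) hLS; congr trivializes.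
  by apply/funext => a; apply/funext => b; rewrite !S1.
rewrite e2; last first.
  have := trivializes_comp (@line_cont 1) hLS; congr trivializes.
  by apply/funext => a; apply/funext => b; rewrite !S2.
rewrite (LS0 1); congr (_ * _)%g.
apply: (@locally_constant _ _ (fun s => LS (s, 1)) connR) => s.
have [W Ws hW] := hLS (s, 1).
have c1 : (fun u : R => (u, 1 : R)) @ s --> (s, 1 : R).
  by refine (cvg_pair_at _ _); [exact: cvg_id | exact: cvg_cst].
have Wn : \forall u \near s, W (u, 1) := c1 _ Ws.
apply: (@filterS _ _ _ _ _ _ Wn) => u /= Wu.
by rewrite (hW _ _ (nbhs_singleton Ws) Wu) /= !S3 local_cocycle_id // mulg1.
Qed.

(** For nearby [a] and [b = a * ex v], paths from 1 to the points [a * ex (s *: v)] fill a square.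
    As [s] varies the holonomy changes by [tau] along the short curve from [a] to [b], which stays
    inside one neighbourhood where the cocycle identity holds. *)
Lemma group_trivialize (tau : G -> G -> H) :
  local_cocycle tau -> exists F : G -> H, trivializes tau F.
Proof.
move=> ht; have cex : continuous ex := ge_cont hE.
have [F FP] := choice (fun z => hol_path z ht); exists F => z0.
have [W Wz0 hW] := ht z0.
have : \forall u \near (z0, 0 : 'rV[R]_n), forall s, `[0, 1]%classic s ->
    W (u.1 * ex (s *: u.2))%g.
  apply: (@compact_near_all R (G * 'rV[R]_n)%type `[0, 1]%classic (z0, 0)
    (fun z => W (z.2.1 * ex (z.1 *: z.2.2))%g)).
    exact: segment_compact.
  move=> s _.
  have hc : (fun z : R * (G * 'rV[R]_n) => z.2.1 * ex (z.1 *: z.2.2))%g @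
      (s, (z0, 0 : 'rV[R]_n)) --> (z0 * ex (s *: 0))%g.
    have h2 : (fun z : R * (G * 'rV[R]_n) => z.2) @ (s, (z0, 0 : 'rV[R]_n)) --> (z0, 0 : 'rV[R]_n).
      exact: cvg_snd.
    refine (cvgMg _ _).
      by refine (cvg_at_comp h2 _); exact: cvg_fst.
    refine (cvg_at_comp _ (cex _)).
    refine (cvgZ _ _); first exact: cvg_fst.
    by refine (cvg_at_comp h2 _); exact: cvg_snd.
  apply: hc; by rewrite scaler0 ge_ex0 mulg1.
case=> -[U1 U2] /= [U1z U20] hU.
have lg1 : lg 1%g = 0 by rewrite -ge_ex0 (ge_exK hE) // normr0 (ge_d0 hE).
have hP : \forall x \near 1%g, U2 (lg x) /\ ex (lg x) = x.
  apply: filterI; last exact: (ge_lgK hE).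
  by apply: (ge_lg_cont hE); rewrite lg1.
have hq : (fun z : G * G => z.1^-1 * z.2)%g @ (z0, z0) --> (z0^-1 * z0)%g.
  by refine (cvgMg (cvgVg _) _); [exact: cvg_fst | exact: cvg_snd].
rewrite mulVg in hq.
have [[V1 V2] /= [V1z V2z] hV] := hq _ hP.
exists (W `&` U1 `&` (V1 `&` V2)); first by do !apply: filterI.
move=> a b [[Wa U1a] [V1a _]] [_ [_ V2b]].
have [U2v exv] := hV (a, b) (conj V1a V2b).
set v := lg _ in U2v exv; rewrite /= in exv.
have hWs s : s \in `[0, 1] -> W (a * ex (s *: v))%g by move=> si; exact: (hU (a, v) (conj U1a U2v) s si).
have [c [cc c0 c1]] := path_clamped 1%g a.
pose S (z : R * R) := (c z.2 * ex ((clamp z.1 * clamp z.2) *: v))%g.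
have cS : continuous S.
  move=> u; refine (cvgMg _ _).
    by refine (cvg_at_comp _ (cc _)); exact: cvg_snd.
  refine (cvg_at_comp _ (cex _)); refine (cvgZr_tmp _); refine (cvgM _ _).
    by refine (cvg_at_comp _ (@clamp_cont R _)); exact: cvg_fst.
  by refine (cvg_at_comp _ (@clamp_cont R _)); exact: cvg_snd.
have S0 s : S (s, 0) = 1%g by rewrite /S /= clamp0 mulr0 scale0r ge_ex0 c0 mulg1.
have [LS hLS LS0] := square_lift ht cS (fun s => etrans (S0 s) (esym (S0 0))).
have S1 s : S (s, 1) = (a * ex (clamp s *: v))%g by rewrite /S /= clamp1 mulr1 c1.
have line s : clamped (fun t => S (s, t)) 1%g (S (s, 1)).
  by split=> // t; refine (cvg_at_comp (@line_cont s t) (cS _)).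
have eF s : F (S (s, 1)) = ((LS (s, 0%R))^-1 * LS (s, 1%R))%g.
  rewrite (FP (S (s, 1)) (fun t => S (s, t)) (fun t => LS (s, t)) (line s)) //.
  exact: (trivializes_comp (@line_cont s) hLS).
have Sa : S (0, 1) = a by rewrite S1 clamp0 scale0r ge_ex0 mulg1.
have Sb : S (1, 1) = b by rewrite S1 clamp1 scale1r exv mulVKg.
rewrite -{1}Sa -{1}Sb !eF (LS0 1) -mulgA; congr (_ * _)%g.
have WS s : W (S (s, 1)) by rewrite S1; apply: hWs; exact: clamp_itv.
have e : (LS (0%R, 1%R) * (tau a (S (0%R, 1%R)))^-1 = LS (1%R, 1%R) * (tau a (S (1%R, 1%R)))^-1)%g.
  apply: (@locally_constant _ _ (fun s => LS (s, 1%R) * (tau a (S (s, 1%R)))^-1)%g connR) => s.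
  have [W1 Ws hW1] := hLS (s, 1).
  have c2 : (fun u : R => (u, 1 : R)) @ s --> (s, 1 : R).
    by refine (cvg_pair_at _ _); [exact: cvg_id | exact: cvg_cst].
  have Wn : \forall u \near s, W1 (u, 1) := c2 _ Ws.
  apply: (@filterS _ _ _ _ _ _ Wn) => u /= Wu.
  rewrite (hW1 _ _ (nbhs_singleton Ws) Wu) -(hW _ _ _ Wa (WS s) (WS u)).
  by rewrite invgM mulgA mulgK.
rewrite Sa Sb local_cocycle_id // invg1 mulg1 in e.
by rewrite e -mulgA mulVg mulg1.
Qed.

End GroupCocycle.

(** * Existence of Malcev bases *)

Section Span.
Context {R : realType} {n : nat}.
Implicit Types (S : set 'rV[R]_n) (u v : 'rV[R]_n).

Lemma span_rows S : exists m (B : 'M[R]_(m, n)),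
  [/\ row_free B, forall i, S (row i B) & forall v, S v -> (v <= B)%MS].
Proof.
apply: contrapT => hS.
suff h k : exists m (B : 'M[R]_(m, n)), [/\ (k <= m)%N, row_free B & forall i, S (row i B)].
  have [m [B [km fB _]]] := h n.+1.
  by have := leq_trans km (leq_trans (_ : m <= \rank B)%N (rank_leq_col B));
    rewrite row_leq_rank fB ltnn => /(_ isT).
elim: k => [|k [m [B [km fB sB]]]].
  exists 0%N, (0 : 'M[R]_(0, n)); split => //; last by case.
  by rewrite -row_leq_rank.
have [v Sv nv] : exists2 v, S v & ~ (v <= B)%MS.
  apply: contrapT => h; apply: hS; exists m, B; split => // v Sv.
  by apply: contrapT => nv; apply: h; exists v.
exists (m + 1)%N, (col_mx B v); split.
- by rewrite addn1 ltnS.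
- have e : \rank B = m by apply/eqP.
  have h1 : (\rank B < \rank (col_mx B v))%N.
    rewrite -addsmxE; apply: rank_ltmx; rewrite /ltmx addsmxSl /=; apply/negP => h.
    by apply: nv; apply: submx_trans h; exact: addsmxSr.
  by rewrite -row_leq_rank; apply: leq_trans h1; rewrite e addn1.
- move=> i; case: (splitP i) => j ij.
    by have -> : i = lshift 1 j by [apply: val_inj]; rewrite rowKu.
  by have -> : i = rshift m j by [apply: val_inj]; rewrite rowKd row_id.
Qed.

Lemma separating_functional m (B : 'M[R]_(m, n)) v : ~ (v <= B)%MS ->
  exists w : 'cV[R]_n, B *m w = 0 /\ (v *m w) 0 0 = 1.
Proof.
move=> /negP; rewrite submxE => h.
have [j hj] : exists j, (v *m cokermx B) 0 j != 0.
  apply: contrapT => hn; move/negP: h; apply; apply/eqP/rowP => j; rewrite [RHS]mxE.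
  by apply: contrapT => /eqP hj; apply: hn; exists j.
have := mulmx_coker B; move: (cokermx B) hj => C hj hC.
exists (((v *m C) 0 j)^-1 *: col j C); split.
  by rewrite -scalemxAr colE mulmxA hC mul0mx scaler0.
by rewrite -scalemxAr colE mulmxA -colE mxE [X in _ * X]mxE mulVf.
Qed.

Lemma functional_bound (w : 'cV[R]_n) : exists2 C, 0 <= C & forall v, `|(v *m w) 0 0| <= C * `|v|.
Proof.
exists (\sum_j `|w j 0|); first by apply: sumr_ge0.
move=> v; rewrite mxE; apply: le_trans (ler_norm_sum _ _ _) _; rewrite mulr_suml.
by apply: ler_sum => j _; rewrite normrM mulrC; apply: ler_wpM2l => //; exact: row_coord_le.
Qed.

End Span.

(** * Tangent spaces modulo a closed subgroup *)

Section Coset.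
Context {R : realType} {n : nat} {G : topGroupType}.
Hypothesis hG : hausdorff_space G.

Lemma closed_retract (N : set G) (r : G -> G) : continuous r -> (forall x, N (r x)) ->
  (forall x, N x -> r x = x) -> closed N.
Proof.
move=> cr rN rid p clp; have -> : p = r p; last exact: rN.
apply: hG => A B Ap Brp.
have [y [Ny [Ay By]]] := clp _ (filterI Ap (cr p _ Brp)).
by exists y; split => //; rewrite -(rid y Ny).
Qed.

Lemma closed_one : closed [set 1%g : G].
Proof.
move=> p clp; apply: hG => A B Ap B1.
have [y [/= -> Ay]] := clp _ Ap; exists 1%g; split => //; exact: nbhs_singleton.
Qed.

Lemma closure_subgroup (B : set G) : is_subgroup B -> is_subgroup (closure B).
Proof.
move=> sB; apply/is_subgroupP; split; first by apply: subset_closure; exact: is_subgroup1.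
move=> x y cx cy A Axy.
have hc : (fun z : G * G => z.1 * z.2^-1)%g @ (x, y) --> (x * y^-1)%g.
  by refine (cvgMg _ (cvgVg _)); [exact: cvg_fst | exact: cvg_snd].
have [[U V] /= [Ux Vy] hUV] := hc _ Axy.
have [a [Ba Ua]] := cx _ Ux; have [b [Bb Vb]] := cy _ Vy.
exists (a * b^-1)%g; split; last exact: (hUV (a, b)).
by apply: is_subgroupM => //; exact: is_subgroupV.
Qed.

(** Closed subgroups are taken so that limit formulas hold modulo this one. *)
Definition comm_closure (N : set G) : set G := fun x => forall B : set G,
  closed B -> is_subgroup B -> (forall y g, N y -> B [~ y, g]%g) -> B x.

(** Otherwise [N] lies in the closure of every term of the lower central series, by induction, and
    the last term is trivial and closed. *)
Lemma comm_closure_proper (N : set G) : is_nilpotent G ->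
  N `<=` comm_closure N -> N `<=` [set 1%g].
Proof.
move=> [k hk] NA; have h j : N `<=` closure (@lower_central G j).
  elim: j => [|j ih] x Nx; first exact: subset_closure.
  apply: (NA x Nx); [exact: closed_closure | apply: closure_subgroup; exact: lower_central_subgroup |].
  move=> y g Ny A Ayg.
  have hc : (fun z : G => [~ z, g])%g @ y --> [~ y, g]%g.
    have e z : [~ z, g]%g = (z^-1 * (g^-1 * z * g))%g by rewrite commgEl /conjg !mulgA.
    rewrite e; have -> : (fun z : G => [~ z, g])%g = (fun z => z^-1 * (g^-1 * z * g))%g.
      by apply/funext => z; exact: e.
    refine (cvgMg (cvgVg (@cvg_id_at _ y)) _).
    by refine (cvgMg (cvgMg _ (@cvg_id_at _ y)) _); exact: cvg_cst.
  have [z [Lz Az]] := ih y Ny _ (hc _ Ayg).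
  by exists [~ z, g]%g; split => //; exact: lower_central_comm.
move=> x /(h k); rewrite hk => hx; exact: closed_one.
Qed.

Context {ex : 'rV[R]_n -> G} {lg : G -> 'rV[R]_n} {d : R}.
Hypothesis hE : group_exp ex lg d.
Implicit Types (u v w : 'rV[R]_n).

Let cex : continuous ex := ge_cont hE.

Lemma ge_exX v k : ex (k%:R *: v) = (ex v ^+ k)%g.
Proof.
elim: k => [|k ih]; first by rewrite scale0r (ge_ex0 hE) expg0.
by rewrite -natr1 (geD hE) ih scale1r expgSr.
Qed.

Lemma ge_exV v : ex (- v) = (ex v)^-1%g.
Proof.
apply: (mulgI (ex v)); rewrite mulgV -{1}[v]scale1r -scaleN1r -(geD hE).
by rewrite subrr scale0r (ge_ex0 hE).
Qed.

Lemma ge_ex_root v k : ex v = (ex (k.+1%:R^-1 *: v) ^+ k.+1)%g.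
Proof. by rewrite -ge_exX scalerA mulfV ?scale1r // pnatr_eq0. Qed.

Definition tangent (N : set G) : set 'rV[R]_n := [set v | forall t : R, N (ex (t *: v))].

Lemma tangent_ex (N : set G) v : tangent N v -> N (ex v).
Proof. by move=> /(_ 1); rewrite scale1r. Qed.

Lemma tangentZ (N : set G) a v : tangent N v -> tangent N (a *: v).
Proof. by move=> h t; rewrite scalerA; exact: h. Qed.

Variables N A : set G.
Hypotheses (sN : is_subgroup N) (sA : is_subgroup A) (AN : A `<=` N) (cA : closed A).
Hypothesis comA : forall x y, N x -> N y -> A [~ x, y]%g.

Let NM x y : N x -> N y -> N (x * y)%g. Proof. exact: is_subgroupM. Qed.
Let NX x k : N x -> N (x ^+ k)%g.
Proof.
move=> Nx; elim: k => [|k ih]; first by rewrite expg0; exact: is_subgroup1.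
by rewrite expgS; exact: NM.
Qed.
Let AJ x y : A x -> N y -> A (x ^ y)%g.
Proof.
move=> Ax Ny; have -> : (x ^ y = x * [~ x, y])%g by rewrite commgEl mulVKg.
by apply: is_subgroupM => //; apply: comA => //; exact: AN.
Qed.
Let eqA x y := A (x^-1 * y)%g.
Let eqA_refl x : eqA x x. Proof. by rewrite /eqA mulVg; exact: is_subgroup1. Qed.
Let eqA_sym x y : eqA x y -> eqA y x.
Proof. by move=> h; have := is_subgroupV sA h; rewrite /eqA invgM invgK. Qed.
Let eqA_trans x y z : eqA x y -> eqA y z -> eqA x z.
Proof.
move=> h1 h2; have := is_subgroupM sA h1 h2; rewrite /eqA.
by rewrite -[(x^-1 * y * _)%g]mulgA mulVKg.
Qed.
Let eqAM x x' y y' : N y -> eqA x x' -> eqA y y' -> eqA (x * y)%g (x' * y')%g.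
Proof.
move=> Ny h1 h2; rewrite /eqA.
have -> : ((x * y)^-1 * (x' * y') = (x^-1 * x') ^ y * (y^-1 * y'))%g.
  by rewrite /conjg invgM !mulgA mulgK.
by apply: is_subgroupM => //; exact: AJ.
Qed.
Let eqAC x y : N x -> N y -> eqA (x * y)%g (y * x)%g.
Proof.
move=> Nx Ny; have := comA Ny Nx; rewrite /eqA commgEl /conjg invgM.
by rewrite !mulgA.
Qed.
Let eqAX x y k : N x -> N y -> eqA x y -> eqA (x ^+ k)%g (y ^+ k)%g.
Proof.
by move=> Nx Ny h; elim: k => [|k ih]; [exact: eqA_refl | rewrite !expgSr; exact: eqAM].
Qed.
Let eqA_powM x y k : N x -> N y -> eqA ((x * y) ^+ k)%g (x ^+ k * y ^+ k)%g.
Proof.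
move=> Nx Ny; elim: k => [|k ih]; first by rewrite !expg0 mulg1; exact: eqA_refl.
have Nxk := NX k Nx; have Nyk := NX k Ny.
rewrite !expgSr; apply: (eqA_trans (eqAM (NM Nx Ny) ih (eqA_refl _))).
have -> : (x ^+ k * y ^+ k * (x * y) = x ^+ k * ((y ^+ k * x) * y))%g by rewrite !mulgA.
have -> : (x ^+ k * x * (y ^+ k * y) = x ^+ k * ((x * y ^+ k) * y))%g by rewrite !mulgA.
apply: eqAM => //; first by apply: NM => //; exact: NM.
by apply: eqAM => //; exact: eqAC.
Qed.

Let tangentD_small u v : `|u| < d -> `|v| < d -> tangent N u -> tangent N v ->
  eqA (ex u * ex v)%g (ex (u + v)).
Proof.
move=> hu hv tu tv; have Nu := tangent_ex tu; have Nv := tangent_ex tv.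
have h := ge_mul hE hu hv.
have hc : (fun q : nat => (ex u * ex v)^-1 * (ex (q.+1%:R^-1 *: u) * ex (q.+1%:R^-1 *: v)) ^+ q.+1)%g
    @ \oo --> ((ex u * ex v)^-1 * ex (u + v))%g.
  by refine (cvgMg _ h); exact: cvg_cst.
apply: (closed_cvg _ cA _ _ hc); apply: nearW => q.
by apply: eqA_sym; rewrite (ge_ex_root u q) (ge_ex_root v q); exact: eqA_powM.
Qed.

(** Modulo [A] the group [N] is abelian, so powers distribute over products and Trotter's formula
    has a constant left side; [A] is closed, so the limit may be taken. Long vectors are scaled down
    and recovered by powers. *)
Lemma tangentD_mod u v : tangent N u -> tangent N v -> A ((ex u * ex v)^-1 * ex (u + v))%g.
Proof.
move=> tu tv; have d0 := ge_d0 hE.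
have [k hk] : exists k, `|u| < d * k.+1%:R /\ `|v| < d * k.+1%:R.
  pose z := `|u| + `|v|; have z0 : 0 <= z / d by rewrite divr_ge0 ?addr_ge0 // ltW.
  exists (Num.truncn (z / d)); have /andP[_] := Num.Theory.truncn_itv z0.
  rewrite ltr_pdivrMr // mulrC => h.
  by split; apply: le_lt_trans h; rewrite /z ?lerDl ?lerDr.
have small w : `|w| < d * k.+1%:R -> `|k.+1%:R^-1 *: w| < d.
  by move=> hw; rewrite normrZ normfV ger0_norm // mulrC ltr_pdivrMr.
have h := tangentD_small (small _ hk.1) (small _ hk.2) (tangentZ _ tu) (tangentZ _ tv).
rewrite -scalerDr in h.
have Nu : N (ex (k.+1%:R^-1 *: u)) by exact: tu.
have Nv : N (ex (k.+1%:R^-1 *: v)) by exact: tv.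
have Nuv : N (ex (k.+1%:R^-1 *: (u + v))).
  have /AN h1 := h; have := NM (NM Nu Nv) h1; by rewrite mulVKg.
have h2 := eqAX k.+1 (NM Nu Nv) Nuv h; rewrite -ge_ex_root in h2.
apply: eqA_trans h2; apply: eqA_sym.
by rewrite (ge_ex_root u k) (ge_ex_root v k); exact: eqA_powM.
Qed.

Lemma tangentD u v : tangent N u -> tangent N v -> tangent N (u + v).
Proof.
move=> tu tv t; have /AN h := tangentD_mod (tangentZ t tu) (tangentZ t tv).
rewrite scalerDr; have := NM (NM (tu t) (tv t)) h; by rewrite mulVKg.
Qed.

Lemma tangentB_mod u v : tangent N u -> tangent N v -> A ((ex v)^-1 * ex u)%g -> A (ex (u - v)).
Proof.
move=> tu tv h.
have tnv : tangent N (- v) by rewrite -scaleN1r; exact: tangentZ.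
have h1 : eqA (ex u * ex (- v))%g (ex (u - v)) := tangentD_mod tu tnv.
have h2 : A (ex u * ex (- v))%g.
  have := AJ h (tangent_ex tnv); rewrite /conjg ge_exV invgK !mulgA mulgV mul1g.
  by [].
by have := is_subgroupM sA h2 h1; rewrite mulVKg.
Qed.

End Coset.

(** The monodromy lemma expects values in a multiplicatively written group. *)
Definition additive_group (V : zmodType) : Type := V.
HB.instance Definition _ (V : zmodType) := Choice.on (additive_group V).
HB.instance Definition _ (V : zmodType) := isGroup.Build (additive_group V)
  (@addrA V) (@add0r V) (@addr0 V) (@addNr V) (@addrN V).

(** * Splitting off one character *)

Section MalcevStep.
Context {R : realType} {n : nat} {G : topGroupType}.
Hypothesis hG : hausdorff_space G.
Hypothesis sc : simply_connected R G.
Hypothesis conn : connected [set: G].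
Hypothesis nil : is_nilpotent G.
Context {ex : 'rV[R]_n -> G} {lg : G -> 'rV[R]_n} {d : R}.
Hypothesis hE : group_exp ex lg d.
Implicit Types (u v w : 'rV[R]_n) (x y g z : G) (N A : set G) (r : G -> G).

Notation tangent := (@tangent _ _ _ ex).

(** The retraction stands in for simple connectedness of [N]: cocycles on [N] are pulled back to the
    whole group. [nr_lg] says that [N] is a union of one-parameter subgroups near 1. *)
Record normal_retract N r : Prop := NormalRetract {
  nr_sub : is_subgroup N ;
  nr_J : forall x g, N x -> N (x ^ g)%g ;
  nr_cont : continuous r ;
  nr_in : forall x, N (r x) ;
  nr_id : forall x, N x -> r x = x ;
  nr_lg : \forall x \near 1%g, N x -> tangent N (lg x) }.

Definition malcev_step N N' (chi : G -> R) (e : R -> G) : Prop :=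
  [/\ continuous chi, forall x y, N x -> N y -> chi (x * y)%g = chi x + chi y,
      forall x, N' x <-> N x /\ chi x = 0, forall x g, N x -> N' [~ x, g]%g &
  [/\ continuous e, forall s t, e (s + t) = (e s * e t)%g, forall t, N (e t) &
      forall t, chi (e t) = t]].

Let cex : continuous ex := ge_cont hE.

Let conn_const {K : Type} (f : G -> K) :
  (forall x, \forall y \near x, f y = f x) -> forall x y, f x = f y.
Proof. exact: locally_constant. Qed.

Section Step.
Variables (N : set G) (r : G -> G).
Hypothesis hN : normal_retract N r.
Hypothesis N1 : ~ (N `<=` [set 1%g]).

Let A := comm_closure N.
Let sN : is_subgroup N := nr_sub hN.
Let cN : closed N := closed_retract hG (nr_cont hN) (nr_in hN) (nr_id hN).
Let rN : forall x, N (r x) := nr_in hN.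
Let rid : forall x, N x -> r x = x := nr_id hN.
Let cr : continuous r := nr_cont hN.

Let Ncomm x g : N x -> N [~ x, g]%g.
Proof.
move=> Nx; rewrite commgEl; apply: is_subgroupM => //; last exact: (nr_J hN).
exact: is_subgroupV.
Qed.
Let AN : A `<=` N. Proof. by move=> x Ax; apply: (Ax N cN sN) => y g; exact: Ncomm. Qed.
Let sA : is_subgroup A.
Proof.
apply/is_subgroupP; split; first by move=> B _ sB _; exact: is_subgroup1.
move=> x y Ax Ay B cB sB hB; apply: is_subgroupM => //; first exact: Ax.
by apply: is_subgroupV => //; exact: Ay.
Qed.
Let cA : closed A.
Proof.
move=> p clp B cB sB hB; apply: (cB p) => U Up.
by have [y [Ay Uy]] := clp U Up; exists y; split => //; apply: (Ay B cB sB hB).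
Qed.
Let comA x g : N x -> A [~ x, g]%g. Proof. by move=> Nx B _ _; apply. Qed.
Let comA' x y : N x -> N y -> A [~ x, y]%g. Proof. by move=> Nx _; exact: comA. Qed.

Let tD u v : tangent N u -> tangent N v -> tangent N (u + v).
Proof. exact: (tangentD hE sN sA AN cA comA'). Qed.
Let tB u v : tangent N u -> tangent N v -> tangent N (u - v).
Proof. by move=> tu tv; apply: tD => //; rewrite -scaleN1r; exact: tangentZ. Qed.
Let tDA u v : tangent N u -> tangent N v -> A ((ex u * ex v)^-1 * ex (u + v))%g.
Proof. exact: (tangentD_mod hE sN sA AN cA comA'). Qed.
Let tBA u v : tangent N u -> tangent N v -> A ((ex v)^-1 * ex u)%g -> A (ex (u - v)).
Proof. exact: (tangentB_mod hE sN sA AN cA comA'). Qed.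

(** An additive subgroup of the tangent space, possibly not a linear subspace; hence the later
    restriction to its small elements. *)
Let K : set 'rV[R]_n := [set v | tangent N v /\ A (ex v)].

Let ex0 : ex 0 = 1%g := ge_ex0 hE.
Let A1 : A 1%g. Proof. exact: is_subgroup1. Qed.
Let t0 : tangent N 0. Proof. by move=> t; rewrite scaler0 ex0; exact: is_subgroup1. Qed.
Let KD u v : K u -> K v -> K (u + v).
Proof.
move=> [tu Au] [tv Av]; split; first exact: tD.
have := is_subgroupM sA (is_subgroupM sA Au Av) (tDA tu tv); by rewrite mulVKg.
Qed.
Let KN v : K v -> K (- v).
Proof.
move=> [tv Av]; split; first by rewrite -scaleN1r; exact: tangentZ.
by rewrite (ge_exV hE); exact (is_subgroupV sA Av).
Qed.
Let K0 : K 0. Proof. by split => //; rewrite ex0. Qed.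
Let Kint (a : int) v : K v -> K (a%:~R *: v).
Proof.
move=> Kv; have hn (m : nat) : K (m%:R *: v).
  elim: m => [|m ih]; first by rewrite scale0r.
  by rewrite -natr1 scalerDl scale1r; exact: KD.
by case: a => m; [apply: (hn m) | rewrite NegzE mulrNz scaleNr; apply: KN; apply: (hn m.+1)].
Qed.

Let KB (l : nat) := [set v | K v /\ `|v| < l.+1%:R^-1].

(* If [K] spanned the tangent space at every scale, rounding coordinates to integers would make it
   dense in that space, hence equal to it. *)
Let K_full : (forall l v, tangent N v -> exists2 v', K v' & `|v - v'| <= n%:R * l.+1%:R^-1) -> False.
Proof.
move=> hK; have tA v : tangent N v -> A (ex v).
  move=> tv; have hc (l : nat) : exists v', K v' /\ `|v - v'| <= n%:R * l.+1%:R^-1.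
    by have [v' h1 h2] := hK l v tv; exists v'.
  have [f fP] := choice hc.
  have fv : f @ \oo --> v.
    apply: (cvg_norm_bound (g := fun l : nat => n%:R * l.+1%:R^-1)).
      by apply: nearW => l; rewrite distrC; exact: (fP l).2.
    have h1 : (fun l : nat => n%:R * l.+1%:R^-1) @ \oo --> n%:R * (0 : R).
      by apply: cvgZr; exact: cvg_harmonic.
    by rewrite mulr0 in h1.
  apply: (closed_cvg _ cA _ _ (cvg_at_comp fv (@cex v))).
  by apply: nearW => l; exact: (fP l).1.2.
apply: N1; apply: (comm_closure_proper hG nil) => x Nx; rewrite -/A -(rid Nx).
have A' : \forall y \near 1%g, N y -> A y.
  apply: (@filterS _ _ _ _ _ _ (filterI (ge_lgK hE) (nr_lg hN))) => y [/= e h] /h ty.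
  by rewrite -e; exact: tA.
have -> : A (r x) = A (r 1%g).
  apply: (conn_const (f := fun y => A (r y))) => y.
  have hq : (fun z => (r y)^-1 * r z)%g @ y --> ((r y)^-1 * r y)%g.
    by refine (cvgMg _ (@cr y)); exact: cvg_cst.
  rewrite mulVg in hq; have hn : \forall z \near y, N ((r y)^-1 * r z)%g -> A ((r y)^-1 * r z)%g.
    exact: (hq _ A').
  apply: (@filterS _ _ _ _ _ _ hn) => z hz.
  have {}hz : A ((r y)^-1 * r z)%g.
    by apply: hz; apply: is_subgroupM => //; apply: is_subgroupV.
  apply/propext; split => h.
    have := is_subgroupM sA h (is_subgroupV sA hz); by rewrite invgM invgK mulVKg.
  by have := is_subgroupM sA h hz; rewrite mulVKg.
by rewrite rid //; exact: is_subgroup1.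
Qed.

(** At some scale the small elements of [K] do not span the tangent space, since otherwise integer
    combinations of them would approximate every tangent vector. A tangent vector outside their span
    is then separated from them. *)
Let functional : exists (w : 'cV[R]_n) v0 (rho : R), [/\ 0 < rho, tangent N v0, (v0 *m w) 0 0 = 1 &
  forall v, K v -> `|v| < rho -> (v *m w) 0 0 = 0].
Proof.
apply: contrapT => hn; apply: K_full => l v tv.
have [m [B [fB sB hB]]] := span_rows (KB l).
have mn : (m <= n)%N by move: fB; rewrite -row_leq_rank => h; exact: leq_trans h (rank_leq_col B).
have [/submxP [c vc]|nv] := pselect (v <= B)%MS; last first.
  exfalso; apply: hn; have [w [Bw vw]] := separating_functional nv.
  exists w, v, l.+1%:R^-1; split => //.
  by move=> u Ku hu; have /submxP [b ->] := hB u (conj Ku hu); rewrite -mulmxA Bw mulmx0 mxE.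
pose fl (a : R) : int := Num.floor a.
have e b : b *m B = \sum_i b 0 i *: row i B.
  by rewrite [LHS]mulmx_sum_row.
exists (\sum_i (fl (c 0 i))%:~R *: row i B).
  by apply: (big_ind K) => // i _; apply: Kint; exact (sB i).1.
rewrite vc e -sumrB; apply: le_trans (ler_norm_sum _ _ _) _.
apply: (@le_trans _ _ (\sum_(i < m) l.+1%:R^-1)).
  apply: ler_sum => i _; rewrite -scalerBl normrZ -[leRHS]mul1r.
  apply: ler_pM => //; last exact: ltW (sB i).2.
  have /andP[h1 h2] := floor_itv (c 0 i); move: h2; rewrite intrD => h2.
  by rewrite /fl ger0_norm ?subr_ge0 //; lra.
rewrite sumr_const card_ord -[leLHS]mulr_natl; apply: ler_wpM2r; first by rewrite invr_ge0.
by rewrite ler_nat.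
Qed.

(** Read through the logarithm, the functional is multiplicative on [N] near 1, because
    [lg (x * y) - lg x - lg y] is a small element of [K]. Pulled back by the retraction it is a
    local cocycle, and its primitive is a global character whose kernel is the next subgroup. *)
Lemma malcev_step_exists : exists N' r' chi e, [/\ malcev_step N N' chi e, normal_retract N' r' &
  exists2 v0, tangent N v0 & ~ tangent N' v0].
Proof.
have [w [v0 [rho [rho0 tv0 lv0 lK]]]] := functional.
pose ell v : R := (v *m w) 0 0.
have ellD u v : ell (u + v) = ell u + ell v by rewrite /ell mulmxDl mxE.
have ellZ a v : ell (a *: v) = a * ell v by rewrite /ell -scalemxAl mxE.
have ellB u v : ell (u - v) = ell u - ell v by rewrite ellD -scaleN1r ellZ mulN1r.
have ell0 : ell 0 = 0 by rewrite -[0 in LHS](scale0r 0) ellZ mul0r.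
pose lam x : R := ell (lg x).
have lg1 : lg 1%g = 0 by rewrite -ex0 (ge_exK hE) // normr0 (ge_d0 hE).
have lam1 : lam 1%g = 0 by rewrite /lam lg1.
have clg : lg @ 1%g --> (0 : 'rV[R]_n) by rewrite -lg1; exact (ge_lg_cont hE).
have clam : lam @ 1%g --> (0 : R).
  have [C C0 hC] := functional_bound w.
  apply: (cvg_norm_bound (g := fun x => C * `|lg x|)).
    by apply: nearW => x; rewrite subr0; exact: hC.
  have h1 : (fun x => `|lg x|) @ 1%g --> `|0 : 'rV[R]_n| by refine (cvg_norm clg).
  have h2 : (fun x => C * `|lg x|) @ 1%g --> C * `|0 : 'rV[R]_n| by refine (cvgMl_tmp h1).
  by rewrite normr0 mulr0 in h2.
(* Three logarithms enter the error, so each may use a third of [rho]. *)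
pose P x := [/\ `|lg x| < rho / 3, ex (lg x) = x & N x -> tangent N (lg x)].
have P1 : \forall x \near 1%g, P x.
  have h : \forall x \near 1%g, `|lg x| < rho / 3.
    by apply: (@cvgr_norm_lt _ _ _ _ _ _ _ clg); rewrite normr0 divr_gt0.
  apply: (@filterS _ _ _ _ _ _ (filterI h (filterI (ge_lgK hE) (nr_lg hN)))).
  by move=> x [/= ? [? ?]].
have lamM x y : P x -> P y -> P (x * y)%g -> N x -> N y -> lam (x * y)%g = lam x + lam y.
  move=> [p1 p2 p3] [q1 q2 q3] [s1 s2 s3] Nx Ny.
  have Nxy : N (x * y)%g by exact: is_subgroupM.
  apply/eqP; rewrite -subr_eq0 -ellD -ellB; apply/eqP; apply: lK; last first.
    apply: le_lt_trans (ler_normB _ _) _; have := ler_normD (lg x) (lg y); lra.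
  have tx := p3 Nx; have ty := q3 Ny; have txy := s3 Nxy; have txy' := tD tx ty.
  split; first exact: tB.
  apply: tBA => //; have := is_subgroupV sA (tDA tx ty).
  by rewrite p2 q2 s2 invgM invgK.
have lamE x y : P x -> P y -> N x -> N y -> A (x^-1 * y)%g -> lam y = lam x.
  move=> [p1 p2 p3] [q1 q2 q3] Nx Ny hA.
  apply/eqP; rewrite -subr_eq0 -ellB; apply/eqP; apply: lK; last first.
    by apply: le_lt_trans (ler_normB _ _) _; lra.
  have tx := p3 Nx; have ty := q3 Ny; split; first exact: tB.
  by apply: tBA => //; rewrite p2 q2.
pose tau x y : additive_group R := lam ((r x)^-1 * r y)%g.
have Ndiv x y : N x -> N y -> N (x^-1 * y)%g.
  by move=> Nx Ny; apply: is_subgroupM => //; exact: is_subgroupV.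
have htau : local_cocycle tau.
  move=> z.
  have hq : (fun u : G * G => (r u.1)^-1 * r u.2)%g @ (z, z) --> ((r z)^-1 * r z)%g.
    refine (cvgMg (cvgVg (cvg_at_comp _ (@cr z))) (cvg_at_comp _ (@cr z))).
      exact: cvg_fst.
    exact: cvg_snd.
  rewrite mulVg in hq; have [[U V] /= [Uz Vz] hUV] := hq _ P1.
  exists (U `&` V); first exact: filterI.
  move=> a b c [Ua Va] [Ub Vb] [Uc Vc]; rewrite /tau.
  have e : ((r a)^-1 * r c = ((r a)^-1 * r b) * ((r b)^-1 * r c))%g by rewrite -mulgA mulVKg.
  have hab : P ((r a)^-1 * r b)%g by exact: (hUV (a, b)).
  have hbc : P ((r b)^-1 * r c)%g by exact: (hUV (b, c)).
  have hac : P ((r a)^-1 * r c)%g by exact: (hUV (a, c)).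
  rewrite e in hac *; exact/esym/(lamM _ _ hab hbc hac (Ndiv _ _ (rN a) (rN b)) (Ndiv _ _ (rN b) (rN c))).
have [F hF] := group_trivialize hE sc htau.
pose chi x : R := (F (r x) : R) - (F 1%g : R).
have r1 : r 1%g = 1%g by apply: rid; exact: is_subgroup1.
have chi1 : chi 1%g = 0 by rewrite /chi r1 subrr.
have chi_loc z : N z -> \forall b \near z, N b -> chi b = chi z + lam (z^-1 * b)%g.
  move=> Nz; have [W Wz hW] := hF z.
  apply: (@filterS _ _ _ _ _ _ Wz) => b Wb Nb.
  rewrite /chi !rid //; have := hW z b (nbhs_singleton Wz) Wb; rewrite /tau !rid // => ->.
  by rewrite [LHS]addrAC.
have cchi : continuous chi.
  move=> a; have Nra := rN a.
  have h : \forall b \near a, chi b = chi a + lam ((r a)^-1 * r b)%g.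
    have h1 : \forall b \near a, N (r b) -> chi (r b) = chi (r a) + lam ((r a)^-1 * r b)%g.
      exact: (@cr a _ (chi_loc _ Nra)).
    apply: (@filterS _ _ _ _ _ _ h1) => b /(_ (rN b)).
    by rewrite /chi !(rid (rN _)).
  have hq : (fun b => (r a)^-1 * r b)%g @ a --> 1%g.
    by rewrite -(mulVg (r a)); refine (cvgMg _ (@cr a)); exact: cvg_cst.
  have hl : (fun b => chi a + lam ((r a)^-1 * r b)%g) @ a --> chi a.
    rewrite -[X in _ --> X]addr0; refine (cvgD _ _); first exact: cvg_cst.
    by move=> U /clam hU; exact: (hq _ hU).
  refine (cvg_eq_near _ hl); apply: (@filterS _ _ _ _ _ _ h) => b ->; exact: erefl.
have chi_r x : chi (r x) = chi x by rewrite /chi (rid (rN x)).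
have chiM x y : N x -> N y -> chi (x * y)%g = chi x + chi y.
  move=> Nx Ny; suff h : chi (x * r y)%g - chi (r y) = chi (x * r 1%g)%g - chi (r 1%g).
    by move: h; rewrite (rid Ny) r1 mulg1 chi1 subr0 => <-; rewrite subrK.
  apply: (conn_const (f := fun y => chi (x * r y)%g - chi (r y))) => z.
  have Nxz : N (x * r z)%g by exact: is_subgroupM.
  have c1 : (fun b => x * r b)%g @ z --> (x * r z)%g by refine (cvgMg _ (@cr z)); exact: cvg_cst.
  have h1 := c1 _ (chi_loc _ Nxz); have h2 := @cr z _ (chi_loc _ (rN z)).
  apply: (@filterS _ _ _ _ _ _ (filterI (h1 : nbhs z _) (h2 : nbhs z _))) => b [/= e1 e2].
  rewrite e1; last exact: is_subgroupM.
  rewrite e2 //; have -> : ((x * r z)^-1 * (x * r b) = (r z)^-1 * r b)%g.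
    by rewrite invgM -mulgA mulKg.
  by rewrite opprD addrACA subrr addr0.
have chi_near : \forall x \near 1%g, N x -> chi x = lam x.
  have := chi_loc _ (is_subgroup1 sN); apply: filterS => x h /h.
  by rewrite chi1 add0r invg1 mul1g.
(* Near 1 an element and its conjugate differ by a commutator in [A], which the functional does not
   see; connectedness spreads this to all of [N]. *)
have chiJ x g : N x -> chi (x ^ g)%g = chi x.
  move=> Nx; suff h : chi ((r x) ^ g)%g - chi (r x) = chi ((r 1%g) ^ g)%g - chi (r 1%g).
    by move: h; rewrite (rid Nx) r1 conj1g subrr => /eqP; rewrite subr_eq0 => /eqP.
  apply: (conn_const (f := fun y => chi ((r y) ^ g)%g - chi (r y))) => z.
  pose Q y := [/\ P y, P (y ^ g)%g, N y -> chi y = lam y & N (y ^ g)%g -> chi (y ^ g)%g = lam (y ^ g)%g].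
  have Q1 : \forall y \near 1%g, Q y.
    have cj : (fun y => y ^ g)%g @ 1%g --> 1%g.
      have e : (fun y => y ^ g)%g = (fun y => g^-1 * (y * g))%g by [].
      rewrite e; have {2}-> : 1%g = (g^-1 * (1 * g))%g by rewrite mul1g mulVg.
      refine (cvgMg _ (cvgMg (@cvg_id_at _ 1%g) _)); exact: cvg_cst.
    have h1 := cj _ P1; have h2 := cj _ chi_near.
    apply: (@filterS _ _ _ _ _ _ (filterI (filterI P1 (h1 : nbhs 1%g _))
      (filterI chi_near (h2 : nbhs 1%g _)))).
    by move=> y [[/= ? ?] [? ?]].
  have hq : (fun b => (r z)^-1 * r b)%g @ z --> 1%g.
    by rewrite -(mulVg (r z)); refine (cvgMg _ (@cr z)); exact: cvg_cst.
  have h := hq _ Q1.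
  apply: (@filterS _ _ _ _ _ _ (h : nbhs z _)) => b /=.
  set y := (_ * _)%g => -[py pyg cy cyg].
  have Ny : N y by exact: Ndiv.
  have Nyg : N (y ^ g)%g by exact: (nr_J hN).
  have -> : r b = (r z * y)%g by rewrite /y mulVKg.
  rewrite conjMg (chiM _ _ (nr_J hN g (rN z)) Nyg) (chiM _ _ (rN z) Ny).
  have -> : chi (y ^ g)%g = chi y.
    by rewrite cy // cyg //; apply: lamE => //; rewrite -commgEl; exact: comA.
  by rewrite opprD addrACA subrr addr0.
have chi_ex v t : tangent N v -> chi (ex (t *: v)) = t * ell v.
  move=> tv.
  have small : \forall s \near (0 : R), chi (ex (s *: v)) = s * ell v.
    have c0 : (fun s : R => s *: v) @ (0 : R) --> (0 : 'rV[R]_n).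
      by rewrite -[X in _ --> X](scale0r v); refine (cvgZr_tmp _); exact: cvg_id.
    have h1 : \forall s \near (0 : R), `|s *: v| < d.
      by apply: (@cvgr_norm_lt _ _ _ _ _ _ _ c0); rewrite normr0 (ge_d0 hE).
    have c1 : (fun s : R => ex (s *: v)) @ (0 : R) --> 1%g.
      by rewrite -ex0; exact (cvg_at_comp c0 (@cex 0)).
    have h2 := c1 _ chi_near.
    apply: (@filterS _ _ _ _ _ _ (filterI h1 (h2 : nbhs (0 : R) _))) => s [/= e1 ->] //.
    by rewrite /lam (ge_exK hE) // ellZ.
  have connR : connected [set: R] by apply/connected_intervalP => ? ? _ _ ? _.
  suff h : chi (ex (t *: v)) - t * ell v = chi (ex ((0 : R) *: v)) - 0 * ell v.
    by move: h; rewrite scale0r ex0 chi1 mul0r subrr => /eqP; rewrite subr_eq0 => /eqP.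
  refine (@locally_constant _ _ (fun t : R => chi (ex (t *: v)) - t * ell v) connR _ t 0) => s.
  have cs : (fun b : R => b - s) @ s --> (0 : R).
    by rewrite -(subrr s); refine (cvgB (@cvg_id_at _ s) _); exact: cvg_cst.
  have h := cs _ small.
  apply: (@filterS _ _ _ _ _ _ (h : nbhs s _)) => b /= hb.
  have -> : ex (b *: v) = (ex (s *: v) * ex ((b - s) *: v))%g by rewrite -(geD hE) addrC subrK.
  rewrite chiM //; rewrite hb; ring.
pose N' : set G := fun x => N x /\ chi x = 0.
pose e t := ex (t *: v0).
have eD s t : e (s + t) = (e s * e t)%g by exact: (geD hE).
have chie t : chi (e t) = t by rewrite /e chi_ex // /ell lv0 mulr1.
have ce : continuous e.
  move=> t; refine (cvg_at_comp _ (@cex _)); refine (cvgZr_tmp _); exact: cvg_id.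
have Ne t : N (e t) by exact: tv0.
have chiV x : N x -> chi (x^-1)%g = - chi x.
  move=> Nx; apply/eqP; rewrite -addr_eq0 -chiM ?mulVg ?chi1 //; exact: is_subgroupV.
(* The left factor cancels the character, which pushes the old retraction into the kernel. *)
exists N', (fun x => e (- chi (r x)) * r x)%g, chi, e; split.
- split=> // x g Nx; split; first exact: Ncomm.
  rewrite commgEl chiM ?chiV ?chiJ //; [by rewrite addNr | exact: is_subgroupV | exact: (nr_J hN)].
- split.
  + apply/is_subgroupP; split; first by split; [exact: is_subgroup1 | exact: chi1].
    move=> x y [Nx cx] [Ny cy]; have NVy := is_subgroupV sN Ny.
    by split; [exact: is_subgroupM | rewrite chiM // chiV // cx cy subrr].
  + by move=> x g [Nx cx]; split; [exact: (nr_J hN) | rewrite chiJ].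
  + move=> x; refine (cvgMg _ (@cr x)); refine (cvg_at_comp _ (@ce _)); refine (cvgN _).
    exact (cvg_at_comp (@cr x) (@cchi _)).
  + by move=> x; split; [exact: is_subgroupM | rewrite chiM // chie addNr].
  + by move=> x [Nx cx]; rewrite rid // cx oppr0 /e scale0r ex0 mul1g.
  + apply: (@filterS _ _ _ _ _ _ (filterI (nr_lg hN) chi_near)) => x [/= h1 h2] [Nx cx] t.
    have tx := h1 Nx; split; first exact: tx.
    by rewrite chi_ex // -/(lam x) -h2 // cx mulr0.
- exists v0 => // /(_ 1) []; rewrite -/(e 1) chie => _ /eqP; by rewrite oner_eq0.
Qed.

End Step.
Let tangent_rank N r : normal_retract N r -> exists m (B : 'M[R]_(m, n)),
  row_free B /\ forall v, tangent N v <-> (v <= B)%MS.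
Proof.
move=> hN; have [m [B [fB sB hB]]] := span_rows (tangent N); exists m, B; split=> // v.
split=> [|/submxP [c ->]]; first exact: hB.
have sN := nr_sub hN.
rewrite mulmx_sum_row; apply: (big_ind (tangent N)) => [|u u' tu tu'|i _].
- by move=> t; rewrite scaler0 (ge_ex0 hE); exact: is_subgroup1.
- have cN := closed_retract hG (nr_cont hN) (nr_in hN) (nr_id hN).
  have cm x y : N x -> N y -> N [~ x, y]%g.
    move=> Nx Ny; rewrite commgEl; apply: is_subgroupM => //; last exact: (nr_J hN).
    exact: is_subgroupV.
  exact: (tangentD hE sN sN (fun x (h : N x) => h) cN cm).
- by apply: tangentZ; exact: sB.
Qed.

(** The rank of the tangent space is the induction measure: each step loses the direction [v0]. *)
Let chain m : forall N r (B : 'M[R]_(m, n)), normal_retract N r -> row_free B ->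
  (forall v, tangent N v <-> (v <= B)%MS) ->
  exists k (Ns : nat -> set G) (chi : nat -> G -> R) (e : nat -> R -> G),
    [/\ Ns 0%N = N, Ns k = [set 1%g] &
     forall j, (j < k)%N -> malcev_step (Ns j) (Ns j.+1) (chi j) (e j)].
Proof.
elim/ltn_ind: m => m ih N r B hN fB hB.
have [N1|N1] := pselect (N `<=` [set 1%g]).
  exists 0%N, (fun _ => N), (fun _ _ => 0), (fun _ _ => 1%g); split => //.
  by apply/seteqP; split => // x ->; exact: is_subgroup1 (nr_sub hN).
have [N' [r' [chi [e [st hN' [v0 tv0 ntv0]]]]]] := malcev_step_exists hN N1.
have [m' [B' [fB' hB']]] := tangent_rank hN'.
have N'N : N' `<=` N by have [_ _ h _ _] := st; move=> x /h [].
have lt : (m' < m)%N.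
  have e1 : \rank B = m by apply/eqP.
  have e2 : \rank B' = m' by apply/eqP.
  rewrite -e1 -e2; apply: rank_ltmx; apply/andP; split.
    apply/row_subP => i; apply/hB => t; apply: N'N.
    by have /hB' h : (row i B' <= B')%MS by [exact: row_sub]; exact: h.
  by apply/negP => h; apply: ntv0; apply/hB'; apply: submx_trans h; apply/hB.
have [k [Ns [chis [es [h0 hk hs]]]]] := ih m' lt N' r' B' hN' fB' hB'.
exists k.+1, (fun j => if j is j'.+1 then Ns j' else N),
  (fun j => if j is j'.+1 then chis j' else chi), (fun j => if j is j'.+1 then es j' else e).
by split => // -[|j] jk; [rewrite h0 | exact: hs].
Qed.

Lemma malcev_basis_exists : exists k (Ns : nat -> set G) (chi : nat -> G -> R) (e : nat -> R -> G),
  malcev k Ns chi e.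
Proof.
have hN : normal_retract setT id.
  split => //; [by apply/is_subgroupP | by move=> x; exact: cvg_id |].
  by apply: nearW.
have [m [B [fB hB]]] := tangent_rank hN.
have [k [Ns [chi [e [h0 hk hs]]]]] := chain hN fB hB.
exists k, Ns, chi, e; split => //.
- by move=> j /hs [].
- by move=> j x y /hs [_ h _ _ _]; exact: h.
- by move=> j x /hs [_ _ h _ _]; exact: h.
- by move=> j x g /hs [_ _ _ h _]; exact: h.
- by move=> j /hs [_ _ _ _ []].
- by move=> j s t /hs [_ _ _ _ [_ h _ _]]; exact: h.
- by move=> j t /hs [_ _ _ _ [_ _ h _]]; exact: h.
- by move=> j t /hs [_ _ _ _ [_ _ _ h]]; exact: h.
Qed.

End MalcevStep.

Theorem malcev_exists (R : realType) (n : nat) (G : topGroupType) : nilpotent_model R n G ->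
  exists k (N : nat -> set G) (chi : nat -> G -> R) (e : nat -> R -> G), malcev k N chi e.
Proof.
move=> [lieG conn sc nil]; have hG : hausdorff_space G by case: lieG.
have [ex [lg [d hE]]] := lie_group_exp lieG.
exact: (malcev_basis_exists hG sc conn nil hE).
Qed.

(** * One-parameter subgroups and coordinates of the second kind *)

Section Coordinates.
Context {R : realType} {G : topGroupType}.
Context {k : nat} {N : nat -> set G} {chi : nat -> G -> R} {e : nat -> R -> G}.
Hypothesis H : malcev k N chi e.

Let NM j x y : (j <= k)%N -> N j x -> N j y -> N j (x * y)%g.
Proof. by move=> /(malcev_normal H) [_ h _ _]; exact: h. Qed.
Let N1 j : (j <= k)%N -> N j 1%g. Proof. by case/(malcev_normal H). Qed.

Lemma malcev_subset_le i j x : (i <= j)%N -> (j <= k)%N -> N j x -> N i x.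
Proof.
move=> ij jk; rewrite -(subnK ij) in jk *; elim: (j - i)%N jk => [|m ih] // jk Nx.
by apply: ih; [exact: ltnW | exact: (malcev_subset H) Nx].
Qed.

Lemma malcev_power_cong j x s m : (j < k)%N ->
  cong (N := N) j.+1 ((x * e j s) ^+ m)%g (x ^+ m * e j (s *+ m))%g.
Proof.
move=> jk; have jk' : (j.+1 <= k)%N by [].
elim: m => [|m ih].
  by rewrite !expg0 mulr0n (malcev_e0 H) // mulg1; exact: (cong_refl H).
rewrite !expgSr mulrS addrC (malcev_eD H) //.
apply: (cong_trans H jk' (congM H jk' ih (cong_refl H _ jk'))).
have -> : (x ^+ m * e j (s *+ m) * (x * e j s) = x ^+ m * ((e j (s *+ m) * x) * e j s))%g.
  by rewrite !mulgA.
have -> : (x ^+ m * x * (e j (s *+ m) * e j s) = x ^+ m * ((x * e j (s *+ m)) * e j s))%g.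
  by rewrite !mulgA.
apply: (congM H jk' (cong_refl H _ jk') (congM H jk' _ (cong_refl H _ jk'))).
set y := e j _; have Ny : N j y by exact: (malcev_eN H).
have [_ _ NV _] := malcev_normal H jk'; have := NV _ (malcev_comm H x jk Ny).
by rewrite /cong commgEl /conjg !invgM !invgK !mulgA.
Qed.

Definition one_param (sg : R -> G) := continuous sg /\ forall s t, sg (s + t) = (sg s * sg t)%g.

Lemma one_param0 sg : one_param sg -> sg 0 = 1%g.
Proof. by move=> [_ h]; apply: (mulgI (sg 0)); rewrite -h addr0 mulg1. Qed.

Lemma one_paramX sg t m : one_param sg -> sg (t *+ m) = (sg t ^+ m)%g.
Proof.
move=> hs; elim: m => [|m ih]; first by rewrite mulr0n one_param0.
by rewrite mulrS hs.2 ih expgS.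
Qed.

Lemma one_param_through {n : nat} {ex : 'rV[R]_n -> G} {lg d} (x : G) :
  group_exp ex lg d -> exists2 sg, one_param sg & sg 1 = x.
Proof.
move=> hE; have cex : continuous ex := ge_cont hE.
suff h j : (j <= k)%N -> exists2 sg, one_param sg & cong (N := N) j (sg 1) x.
  by have [sg s1 s2] := h k (leqnn k); exists sg => //; exact: (cong_bot H).
elim: j => [_|j ih jk].
  exists (fun _ => 1%g); last by rewrite /cong (malcev_top H).
  by split; [move=> t; exact: cvg_cst | move=> s t; rewrite mulg1].
have [sg hs s1] := ih (ltnW jk).
pose s := chi j ((sg 1%R)^-1 * x)%g.
have cx : cong (N := N) j.+1 (sg 1%R * e j s)%g x.
  rewrite /cong invgM -mulgA -(malcev_eNeg H) //.
  have Ns := malcev_eN H (- s) jk.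
  by apply/(malcev_ker H _ jk); split; [exact: NM (ltnW jk) _ _ | rewrite (malcev_chiM H) // (malcev_chie H) // addNr].
pose iv (m : nat) : R := m.+1%:R^-1.
have c0 : iv @ \oo --> (0 : R) by exact: cvg_harmonic.
have c1 : (fun m => s * iv m) @ \oo --> (0 : R) by rewrite -[X in _ --> X](mulr0 s); exact: cvgZr.
have cp : (fun m : nat => sg (iv m) * e j (s * iv m)%R)%g @ \oo --> 1%g.
  rewrite -[X in _ --> X]mulg1 -{1}(one_param0 hs) -(malcev_e0 H jk).
  refine (cvgMg (cvg_at_comp c0 (hs.1 0)) (cvg_at_comp c1 _)).
  exact: (malcev_e_cont H jk).
have [m _ hm] := cp _ (ge_lgK hE); have {hm} := hm m (leqnn m) => /=.
set p := (_ * _)%g => hp; pose v := lg p.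
exists (fun t => ex (t *: (m.+1%:R *: v))).
  split; last by move=> a b; exact: (geD hE).
  by move=> t; refine (cvg_at_comp _ (@cex _)); refine (cvgZr_tmp _); exact: cvg_id.
rewrite scale1r (ge_exX hE) hp; apply: (cong_trans H jk _ cx).
have ivE a : (a * iv m) *+ m.+1 = a by rewrite -mulr_natr -mulrA mulVf ?mulr1 // pnatr_eq0.
have := malcev_power_cong (sg (iv m)) (s * iv m) m.+1 jk.
have iv1 : iv m *+ m.+1 = 1 by rewrite -[iv m]mul1r ivE.
by rewrite -(one_paramX _ _ hs) iv1 ivE.
Qed.

Fixpoint mprod (c : nat -> R) (m : nat) : G :=
  if m is m'.+1 then (mprod c m' * e m' (c m'))%g else 1%g.

(** What remains of [g] after its first [j] coordinates are stripped off on the left. *)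
Fixpoint mrest (g : G) (j : nat) : G :=
  if j is j'.+1 then (e j' (- chi j' (mrest g j')) * mrest g j')%g else g.

Definition mcoord (g : G) (j : nat) : R := chi j (mrest g j).

Lemma mrest_in g j : (j <= k)%N -> N j (mrest g j).
Proof.
elim: j => [_|j ih jk]; first by rewrite (malcev_top H).
have Nr := ih (ltnW jk); have Ne := malcev_eN H (- chi j (mrest g j)) jk.
apply/(malcev_ker H _ jk); split; first exact: NM (ltnW jk) Ne Nr.
by rewrite /= (malcev_chiM H) // (malcev_chie H) // addNr.
Qed.

Lemma mrest_bot g : mrest g k = 1%g.
Proof. by have := mrest_in g (leqnn k); rewrite (malcev_bot H). Qed.

Lemma mprod_mrest g j : (j <= k)%N -> (mprod (mcoord g) j * mrest g j)%g = g.
Proof.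
elim: j => [_|j ih jk]; first by rewrite mul1g.
rewrite /= (malcev_eNeg H) // -mulgA mulVKg; exact: ih (ltnW jk).
Qed.

Lemma mprod_mcoord g : mprod (mcoord g) k = g.
Proof. by have := mprod_mrest g (leqnn k); rewrite mrest_bot mulg1. Qed.

Lemma mprod_tail c i m : (i <= m)%N -> (m <= k)%N -> N i ((mprod c i)^-1 * mprod c m)%g.
Proof.
move=> im; rewrite -(subnK im); elim: (m - i)%N => [|l ih] lk.
  by rewrite add0n mulVg; exact: N1.
rewrite addSn /= mulgA; apply: NM; first exact: leq_trans (leq_addl l.+1 i) lk.
  exact: ih (ltnW lk).
apply: (malcev_subset_le (leq_addl l i) (ltnW lk)); exact: (malcev_eN H).
Qed.

Lemma mcoord_mprod c j : (j < k)%N -> mcoord (mprod c k) j = c j.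
Proof.
move=> jk; have key i : (i <= k)%N -> mrest (mprod c k) i = ((mprod c i)^-1 * mprod c k)%g.
  elim: i => [_|i ih ik]; first by rewrite invg1 mul1g.
  rewrite /= ih; last exact: ltnW.
  suff -> : chi i ((mprod c i)^-1 * mprod c k)%g = c i.
    by rewrite (malcev_eNeg H) // invgM mulgA.
  have t := mprod_tail c ik (leqnn k); have [Nt ct] := (malcev_ker H _ ik).1 t.
  have -> : ((mprod c i)^-1 * mprod c k = e i (c i) * ((mprod c i.+1)^-1 * mprod c k))%g.
    by rewrite /= invgM !mulgA mulgV mul1g.
  by rewrite (malcev_chiM H) // ?ct ?(malcev_chie H) ?addr0 //; exact: (malcev_eN H).
rewrite /mcoord key; last exact: ltnW.
have t := mprod_tail c jk (leqnn k); have [Nt ct] := (malcev_ker H _ jk).1 t.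
have -> : ((mprod c j)^-1 * mprod c k = e j (c j) * ((mprod c j.+1)^-1 * mprod c k))%g.
  by rewrite /= invgM !mulgA mulgV mul1g.
by rewrite (malcev_chiM H) // ?ct ?(malcev_chie H) ?addr0 //; exact: (malcev_eN H).
Qed.

Lemma mrest_cont j : (j <= k)%N -> continuous (fun g => mrest g j).
Proof.
elim: j => [_|j ih jk] g; first exact: cvg_id.
have c := ih (ltnW jk); refine (cvgMg _ (c g)).
have ce : continuous (e j) := malcev_e_cont H jk.
have cc : continuous (chi j) := malcev_chi_cont H jk.
refine (cvg_at_comp _ (ce _)); refine (cvgN _); exact (cvg_at_comp (c g) (cc _)).
Qed.

Lemma mcoord_cont j : (j < k)%N -> continuous (fun g => mcoord g j).
Proof.
move=> jk g; have c := mrest_cont (ltnW jk).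
have cc : continuous (chi j) := malcev_chi_cont H jk.
exact (cvg_at_comp (c g) (cc _)).
Qed.

Lemma mprod_cont {T : topologicalType} (c : T -> nat -> R) m : (m <= k)%N ->
  (forall j, (j < m)%N -> continuous (fun t => c t j)) -> continuous (fun t => mprod (c t) m).
Proof.
elim: m => [_ _|m ih mk hc] t; first exact: cvg_cst.
refine (cvgMg (ih (ltnW mk) _ t) _); first by move=> j jm; apply: hc; exact: ltnW.
have ce : continuous (e m) := malcev_e_cont H mk.
exact (cvg_at_comp (hc m (ltnSn m) t) (ce _)).
Qed.

Lemma mprod_ext c c' m : (forall j, (j < m)%N -> c j = c' j) -> mprod c m = mprod c' m.
Proof.
elim: m => [|m ih] h //=; rewrite ih; first by rewrite h.
by move=> j jm; apply: h; exact: ltnW.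
Qed.

Definition seq_of_row (c : 'rV[R]_k) (j : nat) : R := if insub j is Some i then c 0 i else 0.

Lemma malcev_coordinates : exists (kap : G -> 'rV[R]_k) (psi : 'rV[R]_k -> G),
  [/\ continuous kap, continuous psi, cancel kap psi & cancel psi kap].
Proof.
exists (fun g => \row_i mcoord g i), (fun c => mprod (seq_of_row c) k); split.
- move=> g; apply/cvgrPdist_lt => eps e0.
  have h (i : 'I_k) : \forall y \near g, `|mcoord g i - mcoord y i| < eps.
    by have /cvgrPdist_lt hc := @mcoord_cont i (ltn_ord i) g; exact: hc.
  have hf : \forall y \near g, forall i : 'I_k, `|mcoord g i - mcoord y i| < eps.
    exact: (@filter_forall _ _ (fun (i : 'I_k) y => `|mcoord g i - mcoord y i| < eps) _ _ h).
  apply: (@filterS _ _ _ _ _ _ hf) => y hy.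
  by apply: row_norm_lt => // i; rewrite !mxE; exact: hy.
- apply: mprod_cont => // j jk; rewrite /seq_of_row insubT => c; exact: coord_continuous.
- move=> g; rewrite -[RHS]mprod_mcoord; apply: mprod_ext => j jk.
  by rewrite /seq_of_row insubT mxE.
- move=> c; apply/rowP => i; rewrite mxE mcoord_mprod //.
  by rewrite /seq_of_row insubT //= => ?; congr (c 0 _); apply: val_inj.
Qed.

End Coordinates.

(** * Lifting through discrete quotients *)

Lemma quotient_cont (T Q : topologicalType) (p : T -> Q) : quotient_map p -> continuous p.
Proof. by move=> [_ h]; apply/continuousP => U /h. Qed.

Lemma quotient_surj (T Q : topologicalType) (p : T -> Q) y : quotient_map p -> exists x, p x = y.
Proof. by move=> [h _]; have [x _ <-] := h y I; exists x. Qed.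

Lemma line_constant (R : realType) (V : normedModType R) (K : Type) (f : V -> K) :
  (forall v, \forall u \near v, f u = f v) -> forall u v, f u = f v.
Proof.
move=> hf; suff h v : f v = f 0 by move=> u v; rewrite h [RHS]h.
have connR : connected [set: R] by apply/connected_intervalP => ? ? _ _ ? _.
have := @locally_constant _ _ (fun t : R => f (t *: v)) connR _ 1 0.
rewrite scale1r scale0r; apply => t.
have c : (fun s : R => s *: v) @ t --> t *: v by refine (cvgZr_tmp _); exact: cvg_id.
exact: (c _ (hf _)).
Qed.

Section DiscreteQuotient.
Context {R : realType} {G : topGroupType} {Y : topologicalType} {Gam : set G} {p : G -> Y}.
Hypothesis sG : is_subgroup Gam.
Hypothesis dG : discrete_subset Gam.
Hypothesis qp : quotient_map p.
Hypothesis pE : forall x y : G, p x = p y <-> Gam (x^-1 * y)%g.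

Lemma discrete_unit : \forall x \near 1%g, Gam x -> x = 1%g.
Proof.
have [_ [V V1 hV]] := dG (is_subgroup1 sG).
apply: (@filterS _ _ _ _ _ _ V1) => x Vx Gx.
by have : (V `&` Gam) x by []; rewrite hV.
Qed.

Lemma discrete_constant (T : topologicalType) (f : T -> G) : connected [set: T] ->
  continuous f -> (forall x, Gam (f x)) -> forall x y, f x = f y.
Proof.
move=> cT cf hf; apply: locally_constant => // x.
have c : (fun y => (f x)^-1 * f y)%g @ x --> 1%g.
  by rewrite -(mulVg (f x)); refine (cvgMg _ (cf x)); exact: cvg_cst.
have h : \forall y \near x, Gam ((f x)^-1 * f y)%g -> ((f x)^-1 * f y)%g = 1%g.
  exact: (c _ discrete_unit).
apply: (@filterS _ _ _ _ _ _ h) => y hy; apply: (mulgI (f x)^-1%g); rewrite mulVg hy //.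
by apply: is_subgroupM => //; exact: is_subgroupV.
Qed.

Lemma coset_nbhs x (U : set G) : nbhs x U -> nbhs (p x) (p @` U).
Proof.
move=> Ux; pose V := interior U.
have oV : open V by exact: open_interior.
have Vx : V x by [].
have VU : V `<=` U by exact: interior_subset.
suff oP : open (p @` V).
  have := open_nbhs_nbhs (conj oP (imageP p Vx)); apply: filterS => _ [z Vz <-].
  by exists z => //; exact: VU.
apply/(qp.2); rewrite openE => y /= [z Vz e]; rewrite /interior.
have hg : Gam (z^-1 * y)%g by apply/pE.
move: hg; set t := (z^-1 * y)%g => hg.
have et : (y * t^-1 = z)%g by rewrite /t invgM invgK mulVKg.
have c : (fun u => u * t^-1)%g @ y --> z.
  by rewrite -et; refine (cvgMg (@cvg_id_at _ y) _); exact: cvg_cst.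
have hV : nbhs z V by exact: open_nbhs_nbhs.
have hu : \forall u \near y, V (u * t^-1)%g := c _ hV.
apply: (@filterS _ _ _ _ _ _ hu) => u Vu; exists (u * t^-1)%g => //.
by apply/pE; rewrite invgM invgK mulgVK.
Qed.

Lemma coset_act (w x x' : G) : p x = p x' -> p (w * x)%g = p (w * x')%g.
Proof. by move=> /pE h; apply/pE; rewrite invgM -mulgA mulKg. Qed.

Hypothesis cY : compact [set: Y].

(** Around one point of [Y] this is the discreteness of [Gam], conjugated by a representative;
    compactness of [Y] makes the neighbourhood uniform. *)
Lemma uniform_injective : exists2 W : set G, nbhs 1%g W &
  forall x w w', W w -> W w' -> p (w * x)%g = p (w' * x)%g -> w = w'.
Proof.
pose P (z : Y * (G * G)) := forall x, p x = z.1 -> p (z.2.1 * x)%g = p (z.2.2 * x)%g -> z.2.1 = z.2.2.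
have : \forall w \near (1%g, 1%g) : G * G, forall y, [set: Y] y -> P (y, w).
  apply: compact_near_all => // y _; have [x <-] := quotient_surj y qp.
  have c : (fun z : G * (G * G) => z.1^-1 * z.2.1^-1 * z.2.2 * z.1)%g @ (x, (1%g, 1%g)) --> 1%g.
    have c1 : (fun z : G * (G * G) => z.1) @ (x, (1%g, 1%g)) --> x by exact: cvg_fst.
    have c2 : (fun z : G * (G * G) => z.2) @ (x, (1%g, 1%g)) --> (1%g, 1%g) by exact: cvg_snd.
    have c3 : (fun z : G * (G * G) => z.2.1) @ (x, (1%g, 1%g)) --> 1%g.
      by refine (cvg_at_comp c2 _); exact: cvg_fst.
    have c4 : (fun z : G * (G * G) => z.2.2) @ (x, (1%g, 1%g)) --> 1%g.
      by refine (cvg_at_comp c2 _); exact: cvg_snd.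
    have e1 : (x^-1 * 1^-1 * 1 * x)%g = 1%g by rewrite invg1 !mulg1 mulVg.
    rewrite -[X in _ --> X]e1.
    exact (cvgMg (cvgMg (cvgMg (cvgVg c1) (cvgVg c3)) c4) c1).
  have [[U1 U2] /= [U1x U21] hU] := c _ discrete_unit.
  exists (p @` U1, U2); first by split => //; exact: coset_nbhs.
  move=> [y' [w w']] [/= [u U1u <-] Uw] x' /= ex' hw.
  have e : p (w * u)%g = p (w' * u)%g.
    by rewrite -(coset_act w ex') -(coset_act w' ex').
  have := hU (u, (w, w')) (conj U1u Uw) => /= hu.
  have {}hu : (u^-1 * w^-1 * w' * u = 1)%g.
    by apply: hu; move/pE: e; rewrite invgM !mulgA.
  apply/esym/(mulgI w^-1%g); rewrite mulVg.
  by apply: (mulgI u^-1%g); apply: (mulIg u); rewrite mulg1 mulVg !mulgA.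
case=> -[W1 W2] /= [W11 W21] hW; exists (W1 `&` W2); first exact: filterI.
move=> x w w' [W1w _] [_ W2w'] e.
exact: (hW (w, w') (conj W1w W2w') (p x) I x erefl e).
Qed.

(** [sec] is an arbitrary pointwise lift. For nearby [v] and [v'] a unique small element carries
    [sec v] over [phi v']; its inverse is a local cocycle with values in the abstract group [G], and
    a primitive corrects the choice to a continuous lift. *)
Lemma lift_exists (V : normedModType R) (phi : V -> Y) : continuous phi ->
  exists F : V -> G, continuous F /\ forall v, p (F v) = phi v.
Proof.
move=> cphi; have [W W1 hW] := uniform_injective.
have [sec secP] := choice (fun v => quotient_surj (phi v) qp).
pose tauP (z : V * V) w := W w /\ phi z.2 = p (w * sec z.1)%g.
(* The value 1 is the default for pairs that no small element connects. *)
have tau_ex z : exists t, (exists w, tauP z w) -> tauP z t.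
  by have [[w hw]|h] := pselect (exists w, tauP z w); [exists w | exists 1%g].
have [tau0 tau0P] := choice tau_ex.
have tauE v v' w : W w -> phi v' = p (w * sec v)%g -> tau0 (v, v') = w.
  move=> Ww e; have [h1 h2] := tau0P (v, v') (ex_intro _ w (conj Ww e)).
  by apply: (hW (sec v)) => //; rewrite -h2.
pose tau v v' := (tau0 (v, v'))^-1%g.
have cq : (fun z : G * G => z.1 * z.2^-1)%g @ (1%g, 1%g) --> 1%g.
  have e1 : (1 * 1^-1)%g = 1%g :> G by rewrite invg1 mulg1.
  rewrite -[X in _ --> X]e1.
  by refine (cvgMg _ (cvgVg _)); [exact: cvg_fst | exact: cvg_snd].
have [[U1 U2] /= [U11 U21] hU] := cq _ W1.
pose U := U1 `&` U2; have U0 : nbhs 1%g U by exact: filterI.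
have UW a b : U a -> U b -> W (b * a^-1)%g.
  by move=> [_ Ua] [Ub _]; exact: (hU (b, a)).
(* near [v0], [phi v = p (a * sec v0)] with [a] close to 1, and then [tau v v' = a * b^-1] *)
have locn v0 (U' : set G) : nbhs 1%g U' -> \forall v \near v0, exists2 a, U' a & phi v = p (a * sec v0)%g.
  move=> hU'.
  have h : nbhs (sec v0) [set g | U' (g * (sec v0)^-1)%g].
    have c : (fun g => g * (sec v0)^-1)%g @ sec v0 --> 1%g.
      by rewrite -(mulgV (sec v0)); refine (cvgMg (@cvg_id_at _ _) _); exact: cvg_cst.
    exact: (c _ hU').
  have := coset_nbhs h; rewrite secP => h1.
  have hv : \forall v \near v0, (p @` [set g | U' (g * (sec v0)^-1)%g]) (phi v) := cphi v0 _ h1.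
  apply: (@filterS _ _ _ _ _ _ hv) => v [g hg e].
  by exists (g * (sec v0)^-1)%g => //; rewrite mulgVK.
have loc v0 v v' a b : U a -> U b -> phi v = p (a * sec v0)%g -> phi v' = p (b * sec v0)%g ->
    tau v v' = (a * b^-1)%g.
  move=> Ua Ub ea eb; rewrite /tau (tauE v v' (b * a^-1)%g (UW _ _ Ua Ub)).
    by rewrite invgM invgK.
  have e : p (sec v) = p (a * sec v0)%g by rewrite secP.
  by rewrite (coset_act _ e) -mulgA mulKg.
have htau : local_cocycle tau.
  move=> v0; exists [set v | exists2 a, U a & phi v = p (a * sec v0)%g]; first exact: locn.
  move=> x y z [a Ua ea] [b Ub eb] [c Uc ec].
  rewrite (loc v0 x y a b) // (loc v0 y z b c) // (loc v0 x z a c) //.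
  by rewrite mulgA mulgVK.
have [L hL] := star_trivialize htau.
have step v0 (U' : set G) : nbhs 1%g U' -> \forall v \near v0, exists w,
    [/\ U' w, (L v)^-1%g = (w * (L v0)^-1)%g & phi v = p (w * sec v0)%g].
  move=> hU'; have [Wv Wv0 hWv] := hL v0.
  have UU : nbhs 1%g (U `&` U') by exact: filterI.
  have h := locn v0 _ UU.
  refine (filterS _ (filterI Wv0 h)) => v [Wvv [w [Uw U'w] e]].
  exists w; split => //.
  rewrite (hWv v0 v) //; last exact: nbhs_singleton.
  have U1g : U 1%g by exact: nbhs_singleton.
  rewrite (loc v0 v0 v 1%g w) //; first by rewrite mul1g invgM invgK.
  by rewrite mul1g secP.
have cst v : p (L v * sec v)%g = p (L 0 * sec 0)%g.
  apply: (line_constant (f := fun v => p (L v * sec v)%g)) => v0.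
  apply: (@filterS _ _ _ _ _ _ (step v0 _ (filterT : nbhs 1%g setT))) => u [w [_ e1 e2]].
  have -> : L u = (L v0 * w^-1)%g by rewrite -[L u]invgK e1 invgM invgK.
  have e : p (sec u) = p (w * sec v0)%g by rewrite secP.
  by rewrite (coset_act _ e) -!mulgA mulKg.
exists (fun v => (L v)^-1 * (L 0 * sec 0))%g; split.
  move=> v0; refine (cvgMg _ _); last exact: cvg_cst.
  move=> O hO; have c : (fun w => w * (L v0)^-1)%g @ 1%g --> ((L v0)^-1)%g.
    rewrite -[X in _ --> X]mul1g; refine (cvgMg (@cvg_id_at _ _) _); exact: cvg_cst.
  apply: (@filterS _ _ _ _ _ _ (step v0 _ (c _ hO : nbhs 1%g _))) => v [w [Ow e _]].
  by rewrite /= e.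
by move=> v; rewrite -(coset_act _ (cst v)) mulKg secP.
Qed.

End DiscreteQuotient.

(** * The cover of an infra-nilmanifold *)

Section CoordinateSpace.
Context {R : realType} {k : nat} {S : topologicalType}.
Context {kap : S -> 'rV[R]_k} {psi : 'rV[R]_k -> S}.
Hypotheses (ckap : continuous kap) (cpsi : continuous psi).
Hypothesis kapK : cancel kap psi.

Lemma closed_ball_compact (v : 'rV[R]_k) (r : R) : compact [set u | `|u - v| <= r].
Proof.
apply: bounded_closed_compact.
  exists (r + `|v|); split; first exact: num_real.
  move=> z hz u /= hu; apply: le_trans (ltW hz).
  by rewrite -[u in leLHS](subrK v); apply: le_trans (ler_normD _ _) _; rewrite lerD2r.
have -> : [set u | `|u - v| <= r] = (fun u : 'rV[R]_k => `|u - v|) @^-1` [set x | x <= r] by [].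
apply: closed_comp; last exact: closed_le.
move=> u _; have h : (fun u : 'rV[R]_k => u - v) @ u --> u - v.
  by refine (cvgB (@cvg_id_at _ u) _); exact: cvg_cst.
by refine (cvg_norm h).
Qed.

Lemma coord_ball_compact v r : compact (psi @` [set u | `|u - v| <= r]).
Proof.
apply: continuous_compact; last exact: closed_ball_compact.
by apply: continuous_subspaceT.
Qed.

(** Evaluation is jointly continuous because coordinate balls are compact neighbourhoods in [S]. *)
Lemma eval_cont {U : topologicalType} (c : {compact-open, S -> U}) (x : S) :
  continuous (c : S -> U) ->
  {for (c, x), continuous (fun z : {compact-open, S -> U} * S => z.1 z.2)}.
Proof.
move=> cc O Ocx; pose O' := interior O.
have Ox : nbhs (kap x) [set u | O' (c (psi u))].
  have h : (fun u => c (psi u)) @ kap x --> c (psi (kap x)).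
    exact (cvg_at_comp (@cpsi (kap x)) (cc _)).
  apply: (h O'); rewrite kapK; exact: nbhs_interior.
have /(nbhs_ballP _ _).1 [r /= r0 hr] := Ox.
have r2 : 0 < r / 2 by rewrite divr_gt0.
pose K := psi @` [set u | `|u - kap x| <= r / 2].
have oK : open ([set g | g @` K `<=` O'] : set {compact-open, S -> U}).
  by apply: compact_open_open; [exact: coord_ball_compact | exact: open_interior].
have cK : [set g : {compact-open, S -> U} | g @` K `<=` O'] c.
  move=> _ [_ [u /= hu <-] <-]; apply: hr; rewrite -ball_normE /= distrC.
  by apply: le_lt_trans hu _; lra.
have nK : nbhs x K.
  have h : \forall y \near x, `|kap y - kap x| < r / 2.
    have := @ckap x; move=> /cvgrPdist_lt hd.
    by have := hd _ r2; apply: filterS => y; rewrite distrC.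
  by apply: (@filterS _ _ _ _ _ _ h) => y hy; exists (kap y) => //=; exact: ltW.
exists ([set g : {compact-open, S -> U} | g @` K `<=` O'], K).
  by split => //=; exact: open_nbhs_nbhs.
by move=> [g y] [/= hg Ky]; apply: interior_subset; apply: hg; exists y.
Qed.

Lemma cocompact_domain {X : topologicalType} (p : S -> X) : compact [set: X] ->
  (forall x U, nbhs x U -> nbhs (p x) (p @` U)) -> (forall y, exists x, p x = y) ->
  exists2 D : set S, compact D & forall y, exists2 x, D x & p x = y.
Proof.
move=> /compact_near_coveringP cX po ps.
have h : \forall r \near +oo, forall y, [set: X] y -> exists2 x, `|kap x| <= r & p x = y.
  apply: (cX R (+oo) (fun r y => exists2 x, `|kap x| <= r & p x = y)) => y _.
  have [x0 <-] := ps y.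
  have h1 : \forall x \near x0, `|kap x| < `|kap x0| + 1.
    by apply: (@cvgr_norm_lt _ _ _ _ _ _ _ (@ckap x0)); rewrite ltrDl.
  exists (p @` [set x | `|kap x| < `|kap x0| + 1], [set r | `|kap x0| + 1 < r]).
    by split => /=; [exact: po | exact: nbhs_pinfty_gt (num_real _)].
  by move=> [y' r] [/= [x hx <-] hr]; exists x => //; apply: ltW; apply: lt_trans hr.
have [r hr] := filter_ex h; exists (psi @` [set u | `|u - 0| <= r]).
  exact: coord_ball_compact.
move=> y; have [x hx <-] := hr y I; exists x => //.
by exists (kap x); rewrite /= ?subr0 // kapK.
Qed.

End CoordinateSpace.

(** The action is recorded without its affine form; the compact group of linear parts enters only
    through [ic_extend]. *)
Record infra_cover (R : realType) (m : nat) (X : topologicalType) (S : topGroupType)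
    (p : S -> X) (I : Type) (act : I -> S -> S) : Prop := InfraCover {
  ic_model : nilpotent_model R m S ;
  ic_quot : quotient_map p ;
  ic_eq : forall x y, p x = p y <-> exists a, y = act a x ;
  ic_act_cont : forall a, continuous (act a) ;
  ic_inv : forall a, exists b, cancel (act a) (act b) /\ cancel (act b) (act a) ;
  ic_extend : forall (G : topGroupType) k (N : nat -> set G) (chi : nat -> G -> R) (e : nat -> R -> G)
      (phi : I -> G) (f : S -> G), is_nilpotent G -> malcev k N chi e -> continuous f ->
    (forall a x, f (act a x) = (phi a * f x)%g) ->
    exists Phi : S -> G, [/\ continuous Phi, forall a x, Phi (act a x) = (phi a * Phi x)%g &
      {morph Phi : x y / (x * y)%g}] }.

Lemma orbit_nbhs (S X : topologicalType) (p : S -> X) (I : Type) (act : I -> S -> S) :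
  quotient_map p -> (forall x y, p x = p y <-> exists a, y = act a x) ->
  (forall a, continuous (act a)) ->
  (forall a, exists b, cancel (act a) (act b) /\ cancel (act b) (act a)) ->
  forall x U, nbhs x U -> nbhs (p x) (p @` U).
Proof.
move=> qp pE ca ia x U Ux; pose V := interior U.
have oV : open V by exact: open_interior.
suff oP : open (p @` V).
  have := open_nbhs_nbhs (conj oP (imageP p (Ux : V x))); apply: filterS => _ [z Vz <-].
  by exists z => //; exact: interior_subset.
apply/(qp.2); rewrite openE => y /= [z Vz e]; rewrite /interior.
have [a ea] := (pE z y).1 e; have [b [ab ba]] := ia a.
have hz : act b y = z by rewrite ea ab.
have hV : nbhs (act b y) V by rewrite hz; exact: open_nbhs_nbhs.
have hu : \forall u \near y, V (act b u) := ca b y _ hV.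
apply: (@filterS _ _ _ _ _ _ hu) => u Vu; exists (act b u) => //.
by apply/pE; exists a; rewrite ba.
Qed.

Lemma infra_cover_exists (R : realType) (m : nat) (X : topologicalType) :
  compact_infra_nilmanifold R m X ->
  compact [set: X] /\ exists (S : topGroupType) (p : S -> X) (I : Type) (act : I -> S -> S),
    infra_cover R m p act.
Proof.
move=> [cX [S [C [P [p [mS [[autC idC compC invC] cC] [PC [P1 PM PV] _ _] qp pE]]]]]].
split => //; pose I := {a : affine S | P a}.
pose act (a : I) := aff_act (sval a).
have hP (a : I) : P (sval a) by case: a.
have aut (a : I) : is_automorphism ((sval a).2 : S -> S) by apply: autC; apply: PC.
have actE a x : act a x = ((sval a).1 * (sval a).2 x)%g by [].
have c_act a : continuous (act a).
  move=> x; have [_ ca _] := aut a; refine (cvgMg _ (ca x)); exact: cvg_cst.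
have actM (a b : affine S) x : P a -> aff_act (aff_mul a b) x = aff_act a (aff_act b x).
  by move=> Pa; have [hm _ _] := autC _ (PC _ Pa); rewrite /aff_act /aff_mul /= hm mulgA.
have act1 x : aff_act (aff_one S) x = x by rewrite /aff_act /= mul1g.
have hiv (a : I) : exists b : I, aff_mul (sval a) (sval b) = aff_one S /\
    aff_mul (sval b) (sval a) = aff_one S.
  by have [b [Pb h1 h2]] := PV _ (hP a); exists (exist _ b Pb).
have [iv ivP] := choice hiv.
have ia a : exists b, cancel (act a) (act b) /\ cancel (act b) (act a).
  exists (iv a); have [h1 h2] := ivP a.
  by split => x; rewrite /act -actM // ?h1 ?h2.
have pE' x y : p x = p y <-> exists a, y = act a x.
  split=> [/pE [a Pa ->]|[a ->]]; first by exists (exist _ a Pa).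
  by apply/pE; exists (sval a).
have po := orbit_nbhs qp pE' c_act ia.
have [kS [NS [chiS [eS HS]]]] := malcev_exists mS.
have [kap [psi [ckap cpsi kapK _]]] := malcev_coordinates HS.
have [D cD hD] := cocompact_domain ckap cpsi kapK cX po (fun y => quotient_surj y qp).
exists S, p, I, act; split => // G k N chi e phi f nG HG cf ef.
have hid : @is_automorphism S idfun by apply: autC.
pose cp (a b : I) : I := exist _ (aff_mul (sval a) (sval b)) (PM _ _ (hP a) (hP b)).
have iv2 (a : I) x : (sval a).2 ((sval (iv a)).2 x) = x.
  by have [h1 _] := ivP a; have := congr1 snd h1 => /(congr1 (fun h : S -> S => h x)).
have iv2' (a : I) x : (sval (iv a)).2 ((sval a).2 x) = x.
  by have [_ h1] := ivP a; have := congr1 snd h1 => /(congr1 (fun h : S -> S => h x)).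
have [|||||||||| Phi [c1 e1 h1]] := @extend_hom R S G {compact-open, S -> S} I C
   (fun c x => c x) D (fun a => (sval a).1) (fun a => (sval a).2) iv cp phi cC cD _ _ _ _ _ _ _ _ _ _ nG
   k N chi e HG f cf ef.
- move=> c x Cc; apply: (eval_cont ckap cpsi kapK); by have [_ h _] := autC _ Cc.
- by move=> a; exists (sval a).2 => //; exact: PC.
- by move=> c /autC [hm _ _]; apply: (mulgI (c 1%g)); rewrite -hm !mulg1.
- by move=> a x y; have [hm _ _] := aut a; exact: hm.
- by move=> a x; exact: iv2'.
- by move=> a x; exact: iv2.
- by [].
- by exists (exist _ (aff_one S) P1).
- move=> x; have [y Dy e1] := hD (p x); have [a ea] := (pE' y x).1 e1.
  by exists a; exists y.
- by case: mS.
by exists Phi.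
Qed.

(** * Equivariant maps and coincidences *)

Lemma centered_coordinates (R : realType) (n : nat) (G : topGroupType) : nilpotent_model R n G ->
  exists k (kap : G -> 'rV[R]_k) (psi : 'rV[R]_k -> G),
    [/\ continuous kap, continuous psi, cancel kap psi, cancel psi kap & kap 1%g = 0].
Proof.
move=> mG; have [k [N [chi [e HG]]]] := malcev_exists mG.
have [kap [psi [ck cp kK pK]]] := malcev_coordinates HG.
exists k, (fun g => kap g - kap 1%g), (fun v => psi (v + kap 1%g)); split.
- by move=> g; refine (cvgB (ck g) _); exact: cvg_cst.
- move=> v; have h : (fun u : 'rV[R]_k => u + kap 1%g) @ v --> v + kap 1%g.
    by refine (cvgD (@cvg_id_at _ v) _); exact: cvg_cst.
  exact (cvg_at_comp h (cp _)).
- by move=> g; rewrite subrK kK.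
- by move=> v; rewrite pK addrK.
- by rewrite subrr.
Qed.

Lemma counting_eq0 (R : realType) (T : choiceType) (A : set T) : counting A = 0%E :> \bar R -> A = set0.
Proof.
rewrite /counting; case: asboolP => // fA [] /eqP; rewrite pnatr_eq0 => /eqP h.
exact: (fset_set_set0 fA (finmap.cardfs0_eq h)).
Qed.

Section EquivariantMaps.
Context {R : realType} {m n : nat} {X Y : topologicalType} {S G : topGroupType}.
Context {pX : S -> X} {I : Type} {act : I -> S -> S} {Gam : set G} {pY : G -> Y}.
Hypothesis hS : infra_cover R m pX act.
Hypothesis mG : nilpotent_model R n G.
Hypothesis sG : is_subgroup Gam.
Hypothesis dG : discrete_subset Gam.
Hypothesis qY : quotient_map pY.
Hypothesis YE : forall x y : G, pY x = pY y <-> Gam (x^-1 * y)%g.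
Hypothesis cY : compact [set: Y].

Let mS := ic_model hS.
Let qX := ic_quot hS.
Let XE := ic_eq hS.
Let act_cont : forall a, continuous (act a) := ic_act_cont hS.
Let connS : connected [set: S]. Proof. by case: mS. Qed.
Let cpX : continuous pX := quotient_cont qX.
Let cpY : continuous pY := quotient_cont qY.
Let oX : forall x U, nbhs x U -> nbhs (pX x) (pX @` U).
Proof. exact: orbit_nbhs qX XE act_cont (ic_inv hS). Qed.
Let connR : connected [set: R].
Proof. by apply/connected_intervalP => ? ? _ _ ? _. Qed.

Definition equivariant_map (phi : I -> G) (E : S -> G) :=
  continuous E /\ forall a x, E (act a x) = (phi a * E x)%g.

(** Since [Y] consists of left cosets, the inverse makes the lattice act on lifts by left
    multiplication. Right multiplication of a lift by an invariant map then preserves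
    equivariance. *)
Definition covers (E : S -> G) (f : X -> Y) := forall x, pY (E x)^-1%g = f (pX x).

Let YEV x y : pY x^-1%g = pY y^-1%g <-> Gam (x * y^-1)%g.
Proof. by rewrite YE invgK. Qed.

(** The quotient of [E (act a x)] by [E x] lies in a discrete subgroup, so it is constant in [x];
    this constant is [phi a]. *)
Lemma lift_map (f : X -> Y) : continuous f -> exists E phi,
  [/\ equivariant_map phi E, forall a, Gam (phi a) & covers E f].
Proof.
move=> cf; have [k [kap [psi [ck cp kK pK k1]]]] := centered_coordinates mS.
have cphi : continuous (fun v => f (pX (psi v))).
  by move=> v; exact (cvg_at_comp (cvg_at_comp (cp v) (@cpX _)) (cf _)).
have [F [cF hF]] := lift_exists (R := R) sG dG qY YE cY cphi.
pose E x := (F (kap x))^-1%g.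
have cE : continuous E by move=> x; refine (cvgVg (cvg_at_comp (ck x) (cF _))).
have hE : covers E f by move=> x; rewrite /E invgK hF kK.
have GE a x : Gam (E (act a x) * (E x)^-1)%g.
  apply/YEV; rewrite !hE; congr f; apply/esym/XE; by exists a.
exists E, (fun a => E (act a 1%g) * (E 1%g)^-1)%g; split => //; split => // a x.
have c : continuous (fun x => E (act a x) * (E x)^-1)%g.
  by move=> y; exact (cvgMg (cvg_at_comp (@act_cont a y) (cE _)) (cvgVg (cE y))).
have e : (E (act a 1) * (E 1)^-1 = E (act a x) * (E x)^-1)%g.
  by apply: (discrete_constant sG dG connS c) => y; exact: GE.
by rewrite e mulgVK.
Qed.

(** Two constants come from discreteness: the lattice element that makes the lift start at [E], and
    the equivariance factor, which cannot change with time. *)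
Lemma lift_homotopy (f f1 : X -> Y) (F : R * X -> Y) phi E : is_homotopy f f1 F ->
  equivariant_map phi E -> covers E f -> exists Eh : R * S -> G,
  [/\ continuous Eh, forall x, Eh (0, x) = E x,
      forall t x, pY (Eh (t, x))^-1%g = F (clamp t, pX x) &
      forall t, equivariant_map phi (fun x => Eh (t, x))].
Proof.
move=> [cF F0 F1] [cE eE] hE.
have [k [kap [psi [ck cp kK pK k1]]]] := centered_coordinates mS.
have cphi : continuous (F \o (fun z : R * 'rV[R]_k => (clamp z.1, pX (psi z.2)))).
  apply: (within_comp cF) => [z|z]; last by split => //=; exact: clamp_itv.
  refine (cvg_pair_at _ _).
    by refine (cvg_at_comp _ (@clamp_cont R _)); exact: cvg_fst.
  refine (cvg_at_comp _ (@cpX _)); refine (cvg_at_comp _ (cp _)); exact: cvg_snd.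
have [L [cL hL]] := lift_exists (R := R) sG dG qY YE cY cphi.
pose Fh (z : R * S) := L (z.1, kap z.2).
have cFh : continuous Fh.
  move=> z; refine (cvg_at_comp _ (cL _)); refine (cvg_pair_at _ _); first exact: cvg_fst.
  by refine (cvg_at_comp _ (ck _)); exact: cvg_snd.
have hFh t x : pY (Fh (t, x)) = F (clamp t, pX x) by rewrite /Fh hL /= kK.
have c1 (t : R) : continuous (fun x : S => (t, x)).
  by move=> x; refine (cvg_pair_at _ (@cvg_id_at _ x)); exact: cvg_cst.
have c2 (x : S) : continuous (fun t : R => (t, x)).
  by move=> t; refine (cvg_pair_at (@cvg_id_at _ t) _); exact: cvg_cst.
pose g x := ((Fh (0%R, x))^-1 * (E x)^-1)%g.
have Gg x : Gam (g x) by apply/YE; rewrite hFh clamp0 F0 hE.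
have cg : continuous g.
  by move=> x; refine (cvgMg (cvgVg _) (cvgVg (cE x))); exact (cvg_at_comp (@c1 0 x) (cFh _)).
have gE x : g x = g 1%g by exact: (discrete_constant sG dG connS cg Gg).
pose Eh z := (Fh z * g 1%g)^-1%g.
have cEh : continuous Eh.
  by move=> z; refine (cvgVg (cvgMg (cFh z) _)); exact: cvg_cst.
have Eh0 x : Eh (0, x) = E x by rewrite /Eh -(gE x) /g mulVKg invgK.
have hEh t x : pY (Eh (t, x))^-1%g = F (clamp t, pX x).
  by rewrite /Eh invgK -hFh; apply/esym/YE; rewrite mulKg.
exists Eh; split => // t; split; first by move=> x; exact (cvg_at_comp (@c1 t x) (cEh _)).
move=> a x.
have c : continuous (fun s => Eh (s, act a x) * (Eh (s, x))^-1)%g.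
  by move=> s; exact (cvgMg (cvg_at_comp (@c2 (act a x) s) (cEh _)) (cvgVg (cvg_at_comp (@c2 x s) (cEh _)))).
have GE s : Gam (Eh (s, act a x) * (Eh (s, x))^-1)%g.
  apply/YEV; rewrite !hEh; congr (F (_, _)); apply/esym/XE; by exists a.
have e : (Eh (t, act a x) * (Eh (t, x))^-1 = Eh (0%R, act a x) * (Eh (0%R, x))^-1)%g.
  exact: (discrete_constant sG dG connR c GE).
rewrite !Eh0 eE mulgK in e.
by rewrite -e mulgVK.
Qed.

Lemma equivariant_covers phi E : (forall a, Gam (phi a)) -> equivariant_map phi E ->
  exists2 f : X -> Y, continuous f & covers E f.
Proof.
move=> Gphi [cE eE]; have [sec secP] := choice (fun y => quotient_surj y qX).
have hf x : pY (E x)^-1%g = pY (E (sec (pX x)))^-1%g.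
  apply/YEV; have [a ea] := (XE (sec (pX x)) x).1 (secP _).
  by rewrite {1}ea eE mulgK.
exists (fun y => pY (E (sec y))^-1%g) => [y|x]; last exact: hf.
have [x <-] := quotient_surj y qX.
have c : (fun x => pY (E x)^-1%g) @ x --> pY (E x)^-1%g by exact (cvg_at_comp (cvgVg (cE x)) (@cpY _)).
move=> W; rewrite -hf => /c hW.
have := oX hW; apply: filterS => _ [z Wz <-] /=.
by rewrite -hf.
Qed.

(** [E^-1 * E'] is invariant under the action, so shrinking it to 1 in coordinates is an equivariant
    deformation. *)
Lemma equivariant_homotopic phi E E' (f f' : X -> Y) : (forall a, Gam (phi a)) ->
  equivariant_map phi E -> equivariant_map phi E' -> covers E f -> covers E' f' -> homotopic R f f'.
Proof.
move=> Gphi [cE eE] [cE' eE'] hf hf'.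
have [k [kap [psi [ck cp kK pK k1]]]] := centered_coordinates mG.
have psi0 : psi 0 = 1%g by rewrite -k1 kK.
pose H (z : R * S) := (E z.2 * psi (z.1 *: kap ((E z.2)^-1 * E' z.2)%g))%g.
have cH : continuous H.
  move=> z; have c2 : (fun z : R * S => z.2) @ z --> z.2 by exact: cvg_snd.
  have cEz : (fun z : R * S => E z.2) @ z --> E z.2 by exact (cvg_at_comp c2 (cE _)).
  have cEz' : (fun z : R * S => E' z.2) @ z --> E' z.2 by exact (cvg_at_comp c2 (cE' _)).
  refine (cvgMg cEz (cvg_at_comp _ (cp _))); refine (cvgZ _ _); first exact: cvg_fst.
  exact (cvg_at_comp (cvgMg (cvgVg cEz) cEz') (ck _)).
have eH a t x : H (t, act a x) = (phi a * H (t, x))%g.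
  rewrite /H /= eE eE' -mulgA; congr (_ * (_ * psi (_ *: kap _)))%g.
  by rewrite invgM -mulgA mulKg.
have [sec secP] := choice (fun y => quotient_surj y qX).
pose F (z : R * X) := pY (H (z.1, sec z.2))^-1%g.
have hF t x : F (t, pX x) = pY (H (t, x))^-1%g.
  rewrite /F /=; apply/esym/YEV; have [a ea] := (XE (sec (pX x)) x).1 (secP _).
  by rewrite {1}ea eH mulgK.
exists F; split.
- apply: continuous_subspaceT => -[t y]; have [x <-] := quotient_surj y qX.
  have c : (fun z => pY (H z)^-1%g) @ (t, x) --> pY (H (t, x))^-1%g.
    exact (cvg_at_comp (cvgVg (cH _)) (@cpY _)).
  move=> W; rewrite hF => /c [[A B] /= [At Bx] AB].
  exists (A, pX @` B); first by split => //=; exact: oX.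
  move=> [t' _] [/= At' [x' Bx' <-]]; rewrite /= hF.
  exact: (AB (t', x')).
- move=> y; have [x <-] := quotient_surj y qX.
  by rewrite hF /H /= scale0r psi0 mulg1 hf.
- move=> y; have [x <-] := quotient_surj y qX.
  by rewrite hF /H /= scale1r kK mulVKg hf'.
Qed.

Let path_homotopic_refl (T : topologicalType) (a : R -> T) :
  {within `[0, 1], continuous a} -> path_homotopic a a.
Proof.
move=> ca; exists (a \o (fun z => clamp z.2)); split.
- apply: continuous_subspaceT; apply: (within_comp ca) => [z|z]; last exact: clamp_itv.
  by refine (cvg_at_comp _ (@clamp_cont R _)); exact: cvg_snd.
- by move=> t ht; rewrite /= clamp_id.
- by move=> s _; rewrite /= clamp0 clamp1.
Qed.

Let coinc_refl (f g : X -> Y) x : continuous f -> continuous g -> coincidences f g x -> coinc_equiv R f g x x.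
Proof.
move=> cf cg e; exists (fun=> x); split.
  by split => //; apply: continuous_subspaceT => t; exact: cvg_cst.
have -> : g \o (fun=> x) = f \o (fun=> x : X) :> (R -> Y) by apply/funext => t /=.
by apply: path_homotopic_refl; apply: continuous_subspaceT => t; exact: cvg_cst.
Qed.

Let homotopy_end (f f1 : X -> Y) (F : R * X -> Y) : is_homotopy f f1 F -> continuous f1.
Proof.
move=> [cF _ F1]; have -> : f1 = F \o (fun x => (1, x)) by apply/funext => x /=; rewrite F1.
apply: (within_comp cF) => [x|x]; last by split => //=; rewrite in_itv /= ler01 lexx.
by refine (cvg_pair_at _ (@cvg_id_at _ x)); exact: cvg_cst.
Qed.

(* A pair of lifts that coincide at a point [x] lies over a coincidence class, which is inessential:
   along a homotopy witnessing this, no coincidence of lifts can survive, since a path from [x]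
   to it would relate the two classes. *)
Lemma lifts_coincidence_free (f g : X -> Y) phi phi' E E' : continuous f -> continuous g ->
  nielsen_number R f g = 0%E -> equivariant_map phi E -> equivariant_map phi' E' ->
  covers E f -> covers E' g ->
  exists E1 E1', [/\ equivariant_map phi E1, equivariant_map phi' E1' & forall x, E1 x <> E1' x].
Proof.
move=> cf cg hN eE eE' hE hE'.
have [[x e]|hx] := pselect (exists x, E x = E' x); last first.
  by exists E, E'; split => // x e; apply: hx; exists x.
have co : coincidences f g (pX x) by rewrite /coincidences /= -hE -hE' e.
pose gamma := [set y | coincidences f g y /\ coinc_equiv R f g (pX x) y].
have cl : coinc_class R f g gamma by exists (pX x).
have ness : ~ essential_class R f g gamma.
  by move=> h; have := counting_eq0 hN => /seteqP [/(_ gamma h)].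
have [f1 [g1 [F [F' [hF hF' hb]]]]] : exists (f1 g1 : X -> Y) (F F' : R * X -> Y), [/\ is_homotopy f f1 F, is_homotopy g g1 F' &
    ~ exists2 beta, coinc_class R f1 g1 beta & class_related F F' gamma beta].
  apply: contrapT => hn; apply: ness; split => // f1 g1 F F' hF hF'.
  by apply: contrapT => hb; apply: hn; exists f1, g1, F, F'.
have [Eh [cEh Eh0 hEh eEh]] := lift_homotopy hF eE hE.
have [Eh' [cEh' Eh0' hEh' eEh']] := lift_homotopy hF' eE' hE'.
exists (fun x => Eh (1, x)), (fun x => Eh' (1, x)); split => // y ey; apply: hb.
have F1 := let: And3 _ _ h := hF in h; have F1' := let: And3 _ _ h := hF' in h.
have co1 : coincidences f1 g1 (pX y).
  have := hEh 1 y; have := hEh' 1 y; rewrite !clamp1 F1 F1' ey => h1 h2.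
  by rewrite /coincidences /= -h1 -h2.
exists [set z | coincidences f1 g1 z /\ coinc_equiv R f1 g1 (pX y) z]; first by exists (pX y).
exists (pX x), (pX y); split.
- by split => //; exact: coinc_refl.
- split => //; apply: coinc_refl => //; [exact: homotopy_end hF | exact: homotopy_end hF'].
have [_ _ [_ /(_ x y) [c0 [cc0 c00 c01]] _] _] := mS.
pose c := c0 \o clamp.
have cc : continuous c by apply: (within_comp cc0 (@clamp_cont R)) => t; exact: clamp_itv.
have c_0 : c 0 = x by rewrite /c /= clamp0.
have c_1 : c 1 = y by rewrite /c /= clamp1.
exists (pX \o c); split.
  split; rewrite /= ?c_0 ?c_1 //; apply: continuous_subspaceT => t.
  exact (cvg_at_comp (cc t) (@cpX _)).
have [k [kap [psi [ck cp kK pK k1]]]] := centered_coordinates mG.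
pose u t := (Eh (t, c t))^-1%g; pose v t := (Eh' (t, c t))^-1%g.
have cu : continuous u.
  move=> t; refine (cvgVg (cvg_at_comp _ (cEh _))); exact (cvg_pair_at (@cvg_id_at _ t) (cc t)).
have cv : continuous v.
  move=> t; refine (cvgVg (cvg_at_comp _ (cEh' _))); exact (cvg_pair_at (@cvg_id_at _ t) (cc t)).
have u0 : u 0 = v 0 by rewrite /u /v c_0 Eh0 Eh0' e.
have u1 : u 1 = v 1 by rewrite /u /v c_1 ey.
have pu t : t \in `[0, 1] -> pY (u t) = F (t, pX (c t)) by move=> ht; rewrite hEh clamp_id.
have pv t : t \in `[0, 1] -> pY (v t) = F' (t, pX (c t)) by move=> ht; rewrite hEh' clamp_id.
have I0 : (0 : R) \in `[0, 1] by rewrite in_itv /= lexx ler01.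
have I1 : (1 : R) \in `[0, 1] by rewrite in_itv /= lexx ler01.
(* The lifted paths have common endpoints, so straight segments in the coordinates of [G] join them
   relative to the ends. *)
pose H (z : R * R) := pY (psi ((1 - z.1) *: kap (u z.2) + z.1 *: kap (v z.2))).
have He s t : u t = v t -> H (s, t) = pY (u t).
  by move=> h; rewrite /H /= -h -scalerDl subrK scale1r kK.
exists H; split.
- apply: continuous_subspaceT => z.
  have c1 : (fun z : R * R => z.1) @ z --> z.1 by exact: cvg_fst.
  have c2 : (fun z : R * R => z.2) @ z --> z.2 by exact: cvg_snd.
  refine (cvg_at_comp _ (@cpY _)); refine (cvg_at_comp _ (cp _)); refine (cvgD _ _).
    refine (cvgZ _ (cvg_at_comp (cvg_at_comp c2 (cu _)) (ck _))).
    by refine (cvgB _ c1); exact: cvg_cst.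
  exact (cvgZ c1 (cvg_at_comp (cvg_at_comp c2 (cv _)) (ck _))).
- move=> t ht; rewrite /H /= subr0 scale1r scale0r addr0 kK pu //.
  by rewrite subrr scale0r add0r scale1r kK pv.
- by move=> s hs; rewrite !He // !pu.
Qed.

End EquivariantMaps.

(** * Avoiding all lattice translates *)

Lemma discrete_countable (G : topGroupType) (Gam : set G) :
  @second_countable G -> discrete_subset Gam -> countable Gam.
Proof.
move=> [B /countable_injP [f finj] [_ bB]] dG.
have hU x : exists U, Gam x -> [/\ B U, U x & forall y, U y -> Gam y -> y = x].
  have [Gx|nGx] := pselect (Gam x); last by exists setT.
  have [_ [V Vx hV]] := dG x Gx; have [U [BU Ux] UV] := bB x _ Vx.
  exists U => _; split => // y Uy Gy.
  by have : (V `&` Gam) y by [split => //; exact: UV]; rewrite hV.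
have [U hUP] := choice hU.
apply/countable_injP; exists (fun x => f (U x)) => x y /set_mem Gx /set_mem Gy e.
have [BUx _ hx] := hUP x Gx; have [BUy Uy _] := hUP y Gy.
have e2 : U x = U y by apply: finj => //; rewrite inE.
by apply/esym/hx => //; rewrite e2.
Qed.

Lemma unit_interval_uncountable (R : realType) : ~ countable `[0 : R, 1]%classic.
Proof.
move=> /countable_lebesgue_measure0; rewrite lebesgue_measure_itv /= lte_fin ltr01.
by rewrite oppr0 adde0 => -[] /eqP; rewrite oner_eq0.
Qed.

(** The difference from the linear function vanishes at the integers, hence is periodic and bounded,
    and a bounded additive function is zero. *)
Lemma continuous_additive (R : realType) (f : R -> R) : continuous f ->
  (forall s t, f (s + t) = f s + f t) -> forall t, f t = t * f 1.
Proof.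
move=> cf fD; pose g t := f t - t * f 1.
have gD s t : g (s + t) = g s + g t by rewrite /g fD; ring.
have g0 : g 0 = 0 by have /eqP := gD 0 0; rewrite addr0 -subr_eq0 opprD addNKr oppr_eq0 => /eqP.
have gn t (k : nat) : g (k%:R * t) = k%:R * g t.
  elim: k => [|k ih]; first by rewrite !mul0r.
  by rewrite -natr1 !mulrDl !mul1r gD ih.
have gN t : g (- t) = - g t by apply/eqP; rewrite -addr_eq0 -gD addNr g0.
have g1 : g 1 = 0 by rewrite /g mul1r subrr.
have gz (a : int) : g a%:~R = 0.
  by case: a => k; rewrite ?NegzE ?mulrNz ?gN -[_%:~R]mulr1 gn g1 mulr0 ?oppr0.
have cg : continuous g.
  move=> t; refine (cvgB (cf t) _); refine (cvgMr_tmp _); exact: cvg_id.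
have [M hM] := compact_norm_bounded (@segment_compact R 0 1) (fun t _ => cg t).
have gM t : `|g t| <= M.
  have -> : g t = g (t - (Num.floor t)%:~R) by rewrite gD gN gz oppr0 addr0.
  apply: hM; have /andP[h1 h2] := floor_itv t; rewrite /= in_itv /=.
  by move: h2; rewrite intrD => h2; apply/andP; split; lra.
move=> t; apply/eqP; rewrite -subr_eq0 -/(g t) -normr_le0.
apply: (@le_harmonic_limit _ _ _ M) => k; rewrite add0r ler_pdivlMr //.
by rewrite mulrC -[k.+1%:R]ger0_norm // -normrM -gn.
Qed.

(** * Construction of the avoiding map *)

Section Avoid.
Context {R : realType} {m n : nat} {X : topologicalType} {S G : topGroupType}.
Context {pX : S -> X} {I : Type} {act : I -> S -> S} {Gam : set G}.
Hypothesis hS : infra_cover R m pX act.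
Hypothesis cX : compact [set: X].
Hypothesis mG : nilpotent_model R n G.
Hypothesis sG : is_subgroup Gam.
Hypothesis dG : discrete_subset Gam.
Context {k : nat} {N : nat -> set G} {chi : nat -> G -> R} {e : nat -> R -> G}.
Hypothesis HG : malcev k N chi e.
Variables (phi phi' : I -> G) (Phi Psi : S -> G).
Hypotheses (Gphi : forall a, Gam (phi a)) (Gphi' : forall a, Gam (phi' a)).
Hypotheses (ePhi : equivariant_map (act := act) phi Phi) (ePsi : equivariant_map (act := act) phi' Psi).
Hypotheses (hPhi : {morph Phi : x y / (x * y)%g}) (hPsi : {morph Psi : x y / (x * y)%g}).

Let cPhi : continuous Phi := ePhi.1.
Let cPsi : continuous Psi := ePsi.1.

(** The last condition keeps [Phi x * Q x] and [Psi x] in different right cosets of [Gam], so that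
    their projections never coincide. *)
Definition avoiding (Q : S -> G) := [/\ continuous Q, forall a x, Q (act a x) = Q x &
  forall x g, Gam g -> Q x <> ((Phi x)^-1 * g * Psi x)%g].

(** A crossed homomorphism. Conjugation does not change [chi j] on [N j], so each coordinate is
    additive on its own step of the filtration. *)
Let mu x := ((Phi x)^-1 * Psi x)%g.

Let morph1 (f : S -> G) : {morph f : x y / (x * y)%g} -> f 1%g = 1%g.
Proof. by move=> h; apply: (mulgI (f 1%g)); rewrite -h !mulg1. Qed.
Let morphV (f : S -> G) x : {morph f : x y / (x * y)%g} -> f (x^-1)%g = (f x)^-1%g.
Proof. by move=> h; apply: (mulgI (f x)); rewrite -h !mulgV morph1. Qed.

Let muM x y : mu (x * y)%g = ((mu x) ^ (Phi y) * mu y)%g.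
Proof. by rewrite /mu hPhi hPsi /conjg invgM -!mulgA mulVKg. Qed.

(** If one lattice element excludes two parameters, with witnesses [x] and [x'], then
    [mu (x^-1 * x')] lies in [N j] and its coordinate is the difference of the parameters, hence 0.
    So the parameters, were all excluded, would inject into a countable set. *)
Lemma avoid_central j : (j < k)%N -> (forall x, N j (mu x) -> chi j (mu x) = 0) ->
  exists Q, avoiding Q.
Proof.
move=> jk h0; apply: contrapT => hn.
have bad s : exists x, Gam (Phi x * e j s * (Psi x)^-1)%g.
  apply: contrapT => hb; apply: hn; exists (fun=> e j s); split => // [x|x g Gg eq].
    exact: cvg_cst.
  by apply: hb; exists x; rewrite eq -!mulgA mulgV mulg1 mulVKg.
have [xs hxs] := choice bad.
have [_ sc _] : [/\ hausdorff_space G, @second_countable G & True].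
  by have [[h1 h2 _] _ _ _] := mG; split.
have /countable_injP [f finj] := discrete_countable sc dG.
apply: (@unit_interval_uncountable R); apply/countable_injP.
exists (fun s => f (Phi (xs s) * e j s * (Psi (xs s))^-1)%g) => s s' _ _ eq.
have {eq} := finj _ _ (mem_set (hxs s)) (mem_set (hxs s')) eq.
set x := xs s; set x' := xs s' => eq.
pose y := (x^-1 * x')%g.
have ex' : x' = (x * y)%g by rewrite mulVKg.
have e1 : mu y = ((e j (- s)) ^ (Phi y) * e j s')%g.
  rewrite (malcev_eNeg HG) // /mu /conjg.
  have -> : Psi y = ((e j s)^-1 * Phi y * e j s')%g; last by rewrite !mulgA.
  move: eq; rewrite ex' hPhi hPsi invgM !mulgA => /mulIg.
  by rewrite -!mulgA => /mulgI ->; rewrite !invgM invgK -!mulgA mulKg mulVg mulg1.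
have [_ NM _ NJ] := malcev_normal HG (ltnW jk).
have Ne t : N j (e j t) by exact: (malcev_eN HG).
have Ny : N j (mu y) by rewrite e1; apply: NM => //; exact: NJ.
have := h0 y Ny; rewrite e1 (malcev_chiM HG) //; last exact: NJ.
rewrite (malcev_chiJ HG) // !(malcev_chie HG) // => eq2.
by apply/eqP; rewrite -subr_eq0 -oppr_eq0 opprB addrC eq2.
Qed.

Hypothesis all_onto : forall j, (j < k)%N -> exists x, N j (mu x) /\ chi j (mu x) <> 0.

(** A point with nonzero coordinate lies on a one-parameter subgroup of [S]. Along it the lower
    coordinates are linear in time and vanish at time 1, so [mu] stays in [N j]; rescaling time
    normalizes the coordinate. *)
Let param j : exists xj : R -> S, (j < k)%N ->
  continuous xj /\ forall t, N j (mu (xj t)) /\ chi j (mu (xj t)) = t.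
Proof.
have [jk|] := boolP (j < k)%N; last by exists (fun=> 1%g).
have [x [Nx cx]] := all_onto jk.
have mS := ic_model hS; have [kS [NS [chiS [eS HS]]]] := malcev_exists mS.
have [lieS _ _ _] := mS; have [ex [lg [d hE]]] := lie_group_exp lieS.
have [sg hsg s1] := one_param_through HS x hE.
have cmu : continuous (fun t => mu (sg t)).
  move=> t; exact (cvgMg (cvgVg (cvg_at_comp (hsg.1 t) (@cPhi _))) (cvg_at_comp (hsg.1 t) (@cPsi _))).
have lin i : (i < k)%N -> (forall t, N i (mu (sg t))) -> forall t, chi i (mu (sg t)) = t * chi i (mu x).
  move=> ik Ni t; have [_ _ _ NJ] := malcev_normal HG (ltnW ik).
  have cc : continuous (chi i) := malcev_chi_cont HG ik.
  rewrite -s1; apply: (continuous_additive (f := fun t => chi i (mu (sg t)))) => [u|u v].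
    exact (cvg_at_comp (cmu u) (cc _)).
  by rewrite hsg.2 muM (malcev_chiM HG) ?(malcev_chiJ HG) //; exact: NJ.
have Nsg i : (i <= j)%N -> forall t, N i (mu (sg t)).
  elim: i => [_ t|i ih ij t]; first by rewrite (malcev_top HG).
  have ik : (i < k)%N by exact: ltn_trans ij jk.
  have Ni := ih (ltnW ij); apply/(malcev_ker HG _ ik); split => //.
  have /(malcev_ker HG _ ik) [_ c0] : N i.+1 (mu x) by exact: malcev_subset_le HG _ _ _ ij (ltnW jk) Nx.
  by rewrite lin // c0 mulr0.
exists (fun t => sg (t / chi j (mu x))) => _; split => [t|t].
  refine (cvg_at_comp _ (hsg.1 _)); refine (cvgMr_tmp _); exact: cvg_id.
split; first exact: Nsg.
rewrite lin //; last exact: Nsg.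
by rewrite divfK //; apply/eqP.
Qed.

Let xs := projT1 (choice param).
Let xsP j : (j < k)%N -> continuous (xs j) /\ forall t, N j (mu (xs j t)) /\ chi j (mu (xs j t)) = t.
Proof. exact: (projT2 (choice param)). Qed.

(** Each factor kills one more coordinate of [(Phi y)^-1 * z * Psi y]. At the end this element is 1,
    so that [z = Phi y * (Psi y)^-1], which is [mu] at the inverse of [y]. *)
Fixpoint section_prod (z : G) (j : nat) : S :=
  if j is j'.+1 then let y := section_prod z j' in
    (y * xs j' (- chi j' ((Phi y)^-1 * z * Psi y)%g))%g
  else 1%g.

Let section_in z j : (j <= k)%N -> N j ((Phi (section_prod z j))^-1 * z * Psi (section_prod z j))%g.
Proof.
elim: j => [_|j ih jk]; first by rewrite (malcev_top HG).
have Nz := ih (ltnW jk); move: Nz => /=; set y := section_prod z j.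
set w := (_ * _)%g => Nw; set y' := xs j _; have [_ /(_ (- chi j w)) [Ny cy]] := xsP jk.
have [_ NM _ NJ] := malcev_normal HG (ltnW jk).
have -> : ((Phi (y * y'))^-1 * z * Psi (y * y') = w ^ (Phi y') * mu y')%g.
  by rewrite /w /mu hPhi hPsi /conjg invgM -!mulgA mulVKg.
apply/(malcev_ker HG _ jk); split; first by apply: NM => //; exact: NJ.
by rewrite (malcev_chiM HG) ?(malcev_chiJ HG) ?cy ?subrr //; exact: NJ.
Qed.

Let section_cont j : (j <= k)%N -> continuous (fun z => section_prod z j).
Proof.
elim: j => [_ z|j ih jk z]; first exact: cvg_cst.
have c := ih (ltnW jk) z; have [cx _] := xsP jk.
have cc : continuous (chi j) := malcev_chi_cont HG jk.
refine (cvgMg c (cvg_at_comp _ (cx _))); refine (cvgN _); refine (cvg_at_comp _ (cc _)).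
exact (cvgMg (cvgMg (cvgVg (cvg_at_comp c (@cPhi _))) (@cvg_id_at _ z)) (cvg_at_comp c (@cPsi _))).
Qed.

Let sec_exists : exists s : G -> S, continuous s /\ forall z, mu (s z) = z.
Proof.
exists (fun z => (section_prod z k)^-1)%g; split.
  by move=> z; exact (cvgVg (@section_cont k (leqnn k) z)).
move=> z; have := section_in z (leqnn k); rewrite (malcev_bot HG) => h.
rewrite /mu !morphV // invgK; move: h => /= /(congr1 (fun g => Phi (section_prod z k) * g)%g).
by rewrite -mulgA mulVKg mulg1 => <-; rewrite mulgK.
Qed.

Let cover_compact : exists2 D : set S, compact D & forall x, exists a, exists2 y, D y & x = act a y.
Proof.
have [kS [kapS [psiS [ck cp kK _ _]]]] := centered_coordinates (ic_model hS).
have qX := ic_quot hS; have XE := ic_eq hS.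
have oX := orbit_nbhs qX XE (ic_act_cont hS) (ic_inv hS).
have [D cD hD] := cocompact_domain ck cp kK cX oX (fun y => quotient_surj y qX).
exists D => // x; have [y Dy e1] := hD (pX x); have [a ea] := (XE y x).1 e1.
by exists a; exists y.
Qed.

Lemma avoid_onto (E E' : S -> G) : equivariant_map (act := act) phi E ->
  equivariant_map (act := act) phi' E' -> (forall x, E x <> E' x) -> exists Q, avoiding Q.
Proof.
move=> [cE eE] [cE' eE'] hEE.
have [kV [kap [psi [ck cp kK pK k1]]]] := centered_coordinates mG.
have psi0 : psi 0 = 1%g by rewrite -k1 kK.
have [D cD hD] := cover_compact.
have [s [cs hs]] := sec_exists.
(* The invariant map that compares the homomorphisms with the lifts. Cocompactness bounds it, and it
   never equals [mu] because the lifts never coincide. *)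
pose Q0 x := ((Phi x)^-1 * E x * (E' x)^-1 * Psi x)%g.
have cQ0 : continuous Q0.
  move=> x; exact (cvgMg (cvgMg (cvgMg (cvgVg (@cPhi x)) (cE x)) (cvgVg (cE' x))) (@cPsi x)).
have Q0inv a x : Q0 (act a x) = Q0 x.
  rewrite /Q0 ePhi.2 ePsi.2 eE eE' !invgM -!mulgA; congr (_ * _)%g.
  by rewrite mulKg; congr (_ * _)%g; congr (_ * _)%g; rewrite mulKg.
have Q0mu x : Q0 x <> mu x.
  move=> eq; apply: (hEE x); move: eq; rewrite /Q0 /mu => /mulIg.
  by rewrite -mulgA -[RHS]mulg1 => /mulgI /mulg1_eq /invg_inj.
have [M hM] : exists M, forall q, D q -> `|(`|kap (Q0 q)|)| <= M.
  apply: compact_norm_bounded => // q _.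
  by refine (cvg_norm (cvg_at_comp (cQ0 q) (ck _))).
pose rho := `|M| + 1; have rho0 : 0 < rho by rewrite ltr_wpDl.
have Q0b x : `|kap (Q0 x)| < rho.
  have [a [y Dy ->]] := hD x; rewrite Q0inv.
  have := hM y Dy; rewrite normr_id => h; apply: le_lt_trans h _.
  by apply: le_lt_trans (ler_norm M) _; rewrite ltrDl.
pose h v := kap (Q0 (s (psi v))).
have ch : continuous h.
  by move=> v; exact (cvg_at_comp (cvg_at_comp (cvg_at_comp (cp v) (cs _)) (cQ0 _)) (ck _)).
have hv v : h v <> v.
  move=> eq; apply: (Q0mu (s (psi v))); rewrite hs -[in RHS]eq /h kK //.
(* [th] is a compactly supported modification of [h], still without fixed points *)
pose th v := clamp (2 - `|v| / rho) *: h v.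
have cth : continuous th.
  move=> v; refine (cvgZ (cvg_at_comp _ (@clamp_cont R _)) (ch v)).
  refine (cvgB _ _); first exact: cvg_cst.
  refine (cvgMr_tmp _); refine (cvg_norm (@cvg_id_at _ v)).
have thb v : `|th v| < rho.
  have := clamp_itv (2 - `|v| / rho); rewrite in_itv /= => /andP[c0 c1].
  rewrite /th normrZ ger0_norm //; apply: le_lt_trans (Q0b (s (psi v))).
  by rewrite -[leRHS]mul1r; apply: ler_wpM2r.
have thfix v : th v <> v.
  have [hr|hr] := lerP `|v| rho; last by move=> eq; have := thb v; rewrite eq; lra.
  have q1 : `|v| / rho <= 1 by rewrite ler_pdivrMr // mul1r.
  have -> : th v = h v; last exact: hv.
  by rewrite /th /clamp (min_idPl _) ?max_r ?scale1r // ?ler01 //; lra.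
have thsupp v : 2 * rho <= `|v| -> th v = 0.
  move=> hr; have q1 : 2 <= `|v| / rho by rewrite ler_pdivlMr.
  rewrite /th /clamp (_ : Num.max _ _ = 0) ?scale0r //; apply/max_idPl.
  by rewrite ge_min; apply/orP; right; lra.
pose u g x := kap ((Phi x)^-1 * g * Psi x)%g.
have cu g : continuous (u g).
  move=> x; refine (cvg_at_comp _ (ck _)); refine (cvgMg (cvgMg (cvgVg (@cPhi x)) _) (@cPsi x)).
  exact: cvg_cst.
have uinv g a x : u g (act a x) = u ((phi a)^-1 * g * phi' a)%g x.
  by rewrite /u ePhi.2 ePsi.2 invgM !mulgA.
have ug g x : g = (Phi x * psi (u g x) * (Psi x)^-1)%g.
  by rewrite /u kK -!mulgA mulgV mulg1 mulVKg.
have Gconj a g : Gam g -> Gam ((phi a)^-1 * g * phi' a)%g.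
  by move=> Gg; do !apply: is_subgroupM => //; exact: is_subgroupV.
(* If two lattice elements both have small coordinates at [x], their quotient is near 1, hence
   trivial. The bound is uniform on [D] by compactness, and the action carries it to all of [S]
   while permuting the lattice. *)
have [ep ep0 hep] : exists2 ep, 0 < ep & forall x g g', Gam g -> Gam g' ->
    `|u g x| < ep -> `|u g' x| < ep -> g = g'.
  pose P (z : S * R) := forall v v', `|v| < z.2 -> `|v'| < z.2 ->
    Gam (Phi z.1 * psi v * (psi v')^-1 * (Phi z.1)^-1)%g -> psi v = psi v'.
  have hP : \forall r \near (0 : R), forall x, D x -> P (x, r).
    apply: compact_near_all => // x _; pose o : 'rV[R]_kV * 'rV[R]_kV := (0, 0).
    have c : (fun z : S * ('rV[R]_kV * 'rV[R]_kV) => Phi z.1 * psi z.2.1 * (psi z.2.2)^-1 * (Phi z.1)^-1)%g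
        @ (x, o) --> 1%g.
      have c1 : (fun z : S * ('rV[R]_kV * 'rV[R]_kV) => Phi z.1) @ (x, o) --> Phi x.
        by refine (cvg_at_comp _ (@cPhi _)); exact: cvg_fst.
      have c2 : (fun z : S * ('rV[R]_kV * 'rV[R]_kV) => z.2) @ (x, o) --> o.
        exact: cvg_snd.
      have c3 : (fun z : S * ('rV[R]_kV * 'rV[R]_kV) => psi z.2.1) @ (x, o) --> psi 0.
        refine (cvg_at_comp (cvg_at_comp c2 _ : (fun z => z.2.1) @ (x, o) --> (0 : 'rV[R]_kV)) (cp _)).
        exact: cvg_fst.
      have c4 : (fun z : S * ('rV[R]_kV * 'rV[R]_kV) => psi z.2.2) @ (x, o) --> psi 0.
        refine (cvg_at_comp (cvg_at_comp c2 _ : (fun z => z.2.2) @ (x, o) --> (0 : 'rV[R]_kV)) (cp _)).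
        exact: cvg_snd.
      have e1 : (Phi x * psi 0 * (psi 0)^-1 * (Phi x)^-1 = 1)%g by rewrite mulgK mulgV.
      rewrite -[X in _ --> X]e1; exact (cvgMg (cvgMg (cvgMg c1 c3) (cvgVg c4)) (cvgVg c1)).
    have [[A B] /= [Ax [[B1 B2] /= [B10 B20] hB]] hAB] := c _ (discrete_unit sG dG).
    have Bo : nbhs (0 : 'rV[R]_kV) (B1 `&` B2) by exact: filterI.
    have /(nbhs_ballP _ _).1 [r /= r0 hr] := Bo.
    exists (A, ball (0 : R) r); first by split => //=; exact: nbhsx_ballx.
    move=> [x' r'] [/= Ax']; rewrite -ball_normE /= sub0r normrN => hr' v v' /= hv1 hv2 Gg.
    have hb w : `|w| < r' -> (B1 `&` B2) w.
      move=> hw; apply: hr; rewrite -ball_normE /= sub0r normrN.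
      by apply: lt_trans hw _; apply: le_lt_trans (ler_norm _) hr'.
    have /= /(_ Gg) := hAB (x', (v, v')) (conj Ax' (hB (v, v') (conj (hb v hv1).1 (hb v' hv2).2))).
    move=> /(congr1 (fun g => (Phi x')^-1 * g * Phi x')%g).
    by rewrite -!mulgA mulKg mulVg !mulg1 mul1g mulVg => /mulg1_eq /invg_inj.
  have /(nbhs_ballP _ _).1 [r /= r0 hr] := hP.
  have r2 : 0 < r / 2 by rewrite divr_gt0.
  have {}hr x : D x -> P (x, r / 2).
    by apply: hr; rewrite -ball_normE /= sub0r normrN ger0_norm ?ltW //; lra.
  have onD y g g' : D y -> Gam g -> Gam g' -> `|u g y| < r / 2 -> `|u g' y| < r / 2 -> g = g'.
    move=> Dy Gg Gg' h1 h2; rewrite (ug g y) (ug g' y); congr (_ * _ * _)%g.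
    apply: (hr y Dy _ _ h1 h2).
    have := is_subgroupM sG Gg (is_subgroupV sG Gg').
    rewrite {1}(ug g y) {1}(ug g' y) !invgM invgK /= => Gg2.
    by move: Gg2; rewrite -!mulgA mulKg.
  exists (r / 2) => // x g g' Gg Gg'; have [a [y Dy ->]] := hD x; rewrite !uinv => h1 h2.
  have := onD y _ _ Dy (Gconj a g Gg) (Gconj a g' Gg') h1 h2.
  by move=> /mulIg /mulgI.
(* The support radius [2 * rho] shrinks to [ep / 2], which leaves a collar below [ep], and the
   values become shorter than [ep / 4]. *)
pose c := ep / (4 * rho); have c0 : 0 < c by rewrite divr_gt0 // mulr_gt0.
have crho : 4 * (c * rho) = ep by rewrite /c; field; rewrite gt_eqF.
pose thc v := c *: th (c^-1 *: v).
have cthc : continuous thc.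
  move=> v; have h1 : (fun v : 'rV[R]_kV => c^-1 *: v) @ v --> c^-1 *: v.
    by refine (cvgZl_tmp (@cvg_id_at _ v)).
  have h2 : (fun v => th (c^-1 *: v)) @ v --> th (c^-1 *: v) by exact (cvg_at_comp h1 (cth _)).
  by refine (cvgZl_tmp h2).
have thcb v : `|thc v| < ep.
  rewrite /thc normrZ gtr0_norm //; have := thb (c^-1 *: v) => hb.
  have : c * `|th (c^-1 *: v)| < c * rho by rewrite ltr_pM2l.
  by have : 0 < c * rho by [rewrite mulr_gt0]; lra.
have thcfix v : thc v <> v.
  move=> eq; apply: (thfix (c^-1 *: v)); rewrite -[in RHS]eq /thc scalerA mulVf ?scale1r //.
  by rewrite gt_eqF.
have thcsupp v : ep / 2 <= `|v| -> thc v = 0.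
  move=> hvv; rewrite /thc thsupp ?scaler0 // normrZ normfV gtr0_norm //.
  by rewrite [leRHS]mulrC ler_pdivlMr //; lra.
(* Well defined because at most one lattice element is near; the default 0 matches the cut-off. *)
have qex x : exists q, (forall g, Gam g -> `|u g x| < ep -> q = thc (u g x)) /\
    ((forall g, Gam g -> ep <= `|u g x|) -> q = 0).
  have [[g [Gg hg]]|hng] := pselect (exists g, Gam g /\ `|u g x| < ep).
    exists (thc (u g x)); split => [g' Gg' hg'|/(_ g Gg)]; last by rewrite leNgt hg.
    by rewrite (hep x g g').
  by exists 0; split => // g Gg hg; exfalso; apply: hng; exists g.
have [q qP] := choice qex.
have far x : ~ (exists g, Gam g /\ `|u g x| < ep) -> forall g, Gam g -> ep <= `|u g x|.
  by move=> hng g Gg; rewrite leNgt; apply/negP => hg; apply: hng; exists g.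
have qb x : `|q x| < ep.
  have [[g [Gg hg]]|hng] := pselect (exists g, Gam g /\ `|u g x| < ep).
    by rewrite ((qP x).1 g).
  by rewrite ((qP x).2 (far x hng)) normr0.
exists (fun x => psi (q x)); split.
- move=> x; refine (cvg_at_comp _ (cp _)).
  have [[g [Gg hg]]|hng] := pselect (exists g, Gam g /\ `|u g x| < ep).
    rewrite ((qP x).1 g Gg hg).
    have hn : \forall y \near x, `|u g y| < ep by apply: (@cvgr_norm_lt _ _ _ _ _ _ _ (cu g x)).
    refine (cvg_eq_near _ (cvg_at_comp (cu g x) (cthc _))).
    by apply: (@filterS _ _ _ _ _ _ hn) => y hy; rewrite ((qP y).1 g).
  rewrite ((qP x).2 (far x hng)).
  have ep2 : 0 < ep / 2 by rewrite divr_gt0.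
  (* The lattice element is rebuilt from its coordinate [z.1] at the point [z.2] and then read at
     [x], which makes the comparison uniform over all of them. None has a coordinate below [ep / 2]
     near [x], as it would be below [ep] at [x]; hence nearby values vanish. *)
  pose P (z : 'rV[R]_kV * S) :=
    `|kap ((Phi x)^-1 * (Phi z.2 * psi z.1 * (Psi z.2)^-1) * Psi x)%g - z.1| < ep / 2.
  have hP : \forall y \near x, forall v, [set v | `|v - 0| <= ep / 2] v -> P (v, y).
    apply: (@compact_near_all 'rV[R]_kV S [set v | `|v - 0| <= ep / 2] x P); first exact: closed_ball_compact.
    move=> v _.
    have cv : (fun z : 'rV[R]_kV * S => kap ((Phi x)^-1 * (Phi z.2 * psi z.1 * (Psi z.2)^-1) * Psi x)%g - z.1)
        @ (v, x) --> (0 : 'rV[R]_kV).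
      have e1 : kap ((Phi x)^-1 * (Phi x * psi v * (Psi x)^-1) * Psi x)%g - v = 0.
        by rewrite -!mulgA mulVg mulg1 mulKg pK subrr.
      rewrite -[X in _ --> X]e1.
      have c1 : (fun z : 'rV[R]_kV * S => z.1) @ (v, x) --> v by exact: cvg_fst.
      have c2 : (fun z : 'rV[R]_kV * S => z.2) @ (v, x) --> x by exact: cvg_snd.
      refine (cvgB (cvg_at_comp _ (ck _)) c1).
      refine (cvgMg (cvgMg _ (cvgMg (cvgMg (cvg_at_comp c2 (@cPhi _)) (cvg_at_comp c1 (cp _)))
        (cvgVg (cvg_at_comp c2 (@cPsi _))))) _); exact: cvg_cst.
    by apply: (@cvgr_norm_lt _ _ _ _ _ _ _ cv); rewrite normr0.
  refine (cvg_eq_near _ (cvg_cst _)).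
  apply: (@filterS _ _ _ _ _ _ hP) => y hy; apply/esym.
  have [[g [Gg hg]]|hng'] := pselect (exists g, Gam g /\ `|u g y| < ep); last exact: (qP y).2 (far y hng').
  rewrite ((qP y).1 g Gg hg); apply: thcsupp; rewrite leNgt; apply/negP => hs2.
  have := hy (u g y); rewrite /P /= subr0 -ug => /(_ (ltW hs2)) hu.
  apply: hng; exists g; split => //; rewrite -(subrK (u g y) (u g x)).
  by apply: le_lt_trans (ler_normD _ _) _; rewrite /u in hu hs2 *; lra.
- move=> a x; congr psi.
  have [[g [Gg hg]]|hng] := pselect (exists g, Gam g /\ `|u g (act a x)| < ep).
    have hg' := hg; rewrite uinv in hg'.
    by rewrite ((qP _).1 g Gg hg) ((qP x).1 _ (Gconj a g Gg) hg') uinv.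
  rewrite ((qP _).2 (far _ hng)); apply/esym/(qP x).2/far => -[g [Gg hg]].
  apply: hng; exists (phi a * g * (phi' a)^-1)%g; split.
    by do !apply: is_subgroupM => //; exact: is_subgroupV.
  by rewrite uinv -!mulgA mulVg mulg1 mulKg.
(* Values of [q] are shorter than [ep], so an equality takes place where [q] is the model without
   fixed points. *)
- move=> x g Gg eq; have eq2 : q x = u g x by rewrite /u -eq pK.
  have [hg|hg] := ltP `|u g x| ep; last by have := qb x; rewrite eq2 ltNge hg.
  by apply: (thcfix (u g x)); rewrite -((qP x).1 g Gg hg).
Qed.

End Avoid.

(** * Deformation to a coincidence-free pair *)

Theorem mainTheorem4 (R : realType) (X Y : topologicalType) (m n : nat)
    (hX : compact_infra_nilmanifold R m X)
    (hY : compact_nilmanifold R n Y)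
    (hdim : (n <= m)%N)
    (f g : X -> Y) (hf : continuous f) (hg : continuous g)
    (hN : nielsen_number R f g = 0%E) :
  exists f' g' : X -> Y,
    [/\ continuous f', continuous g',
        homotopic R f f', homotopic R g g'
      & coincidences f' g' = set0].
Proof.
have [cX [S [pX [I [act hS]]]]] := infra_cover_exists hX.
have [cY [G [Gam [pY [mG sG dG qY YE]]]]] := hY.
have [E [phi [eE Gphi hE]]] := lift_map hS sG dG qY YE cY hf.
have [E' [phi' [eE' Gphi' hE']]] := lift_map hS sG dG qY YE cY hg.
have [E1 [E1' [eE1 eE1' hne]]] :=
  lifts_coincidence_free hS mG sG dG qY YE cY hf hg hN eE eE' hE hE'.
have [k [N [chi [e HG]]]] := malcev_exists mG.
have nG : is_nilpotent G by case: mG.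
have [Phi [cPhi ePhi mPhi]] := ic_extend hS nG HG eE.1 eE.2.
have [Psi [cPsi ePsi mPsi]] := ic_extend hS nG HG eE'.1 eE'.2.
have [Q [cQ Qinv Qav]] : exists Q, avoiding (act := act) (Gam := Gam) Phi Psi Q.
  have [[j jk hj]|hn] := pselect (exists2 j, (j < k)%N &
      forall x, N j ((Phi x)^-1 * Psi x)%g -> chi j ((Phi x)^-1 * Psi x)%g = 0).
    exact: (avoid_central mG dG HG mPhi mPsi jk hj).
  apply: (avoid_onto hS cX mG sG dG HG Gphi Gphi' (conj cPhi ePhi) (conj cPsi ePsi) mPhi mPsi _
    eE1 eE1' hne) => j jk.
  apply: contrapT => hx; apply: hn; exists j => // x Nx.
  by apply: contrapT => cx; apply: hx; exists x.
have eF : equivariant_map (act := act) phi (fun x => Phi x * Q x)%g.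
  split; first by move=> x; exact (cvgMg (cPhi x) (cQ x)).
  by move=> a x; rewrite ePhi Qinv mulgA.
have eF' : equivariant_map (act := act) phi' Psi by [].
have [f' cf' hf'] := equivariant_covers hS qY YE Gphi eF.
have [g' cg' hg'] := equivariant_covers hS qY YE Gphi' eF'.
exists f', g'; split => //.
- exact: (equivariant_homotopic hS mG qY YE Gphi eE eF hE hf').
- exact: (equivariant_homotopic hS mG qY YE Gphi' eE' eF' hE' hg').
apply/seteqP; split => // y; have [x <-] := quotient_surj y (ic_quot hS).
(* A coincidence puts [Phi x * Q x * (Psi x)^-1] in the lattice, and this element is one that [Q]
   avoids. *)
rewrite /coincidences /= -hf' -hg' => /YE; rewrite invgK => hgam.
apply: (Qav x _ hgam); by rewrite -!mulgA mulVg mulg1 mulKg.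
Qed.
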